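(* Let $n\ge 1$. For every right $\mathbb F_p[\mathrm{GL}_n(\mathbb F_p)]$-module $X$, there is an isomorphism of projective right $\mathbb F_p[\mathrm{GL}_{n-1}(\mathbb F_p)]$-modules $$\delta_n(\mathrm{St}_n\otimes X)\cong\mathrm{St}_{n-1}\otimes\mathrm{Res}^{\mathrm{GL}_n}_{\mathrm{GL}_{n-1}}X.$$
   Context: Let $p$ be a prime; $\mathrm{GL}_n=\mathrm{GL}_n(\mathbb F_p)$, and $\mathrm{GL}_{n-1}$ is the subgroup of $\mathrm{GL}_n$ given by $g\mapsto\begin{pmatrix}g&0\\0&1\end{pmatrix}$. Unadorned tensor products are over $\mathbb F_p$, with diagonal action. $\mathrm{St}_n$ is the (mod $p$) Steinberg representation of $\mathrm{GL}_n(\mathbb F_p)$; it is projective, so $\mathrm{St}_n\otimes X$ is projective. $\mathrm{GL}_n\mathrm{-proj}$ is the category of projective right $\mathbb F_p[\mathrm{GL}_n]$-modules. Let $V_n=(\mathbb F_p)^n$, $H^*V_n$ its mod $p$ cohomology (an unstable module over the mod $p$ Steenrod algebra, with right action $x.g=g^*(x)$ of $\mathrm{GL}_n$), $H:=H^*(\mathbb Z/p;\mathbb F_p)$, $\overline H$ its reduced version. For $P$ in $\mathrm{GL}_n\mathrm{-proj}$, $M_P:=\mathrm{Hom}_{\mathbb F_p[\mathrm{GL}_n]}(P,H^*V_n)$. Let $\mathcal I(V)$ be the augmentation ideal of the group algebra $\mathbb F_p[V^*]$, in degree $0$, with right action induced by $[\mu].g=[\mu\circ g]$; $\mathcal I(V)\otimes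 H^*V$ has the diagonal action and the equivariant $H$-module structure $u.((\mu)\otimes x)=(\mu)\otimes\mu^*(u)x$, where $(\mu)=[\mu]-[0]$, $u\in H$, $\mu\in V^*$, $x\in H^*V$. The exact functor $\delta_n:\mathrm{GL}_n\mathrm{-proj}\to\mathrm{GL}_{n-1}\mathrm{-proj}$ is the one induced by $P\mapsto\mathbb F_p\otimes_H\mathrm{Hom}_{\mathbb F_p[\mathrm{GL}_n]}(P,\mathcal I(V_n)\otimes H^*V_n)$: it satisfies $M_{\delta_n(P)}\cong\mathbb F_p\otimes_H\mathrm{Hom}_{\mathbb F_p[\mathrm{GL}_n]}(P,\mathcal I(V_n)\otimes H^*V_n)$ naturally in $P$, and $\overline{\mathrm T}(M_P)\cong H\otimes M_{\delta_n(P)}$ as unstable modules, where $\overline{\mathrm T}$ is the reduced Lannes functor, left adjoint of $M\mapsto M\otimes\overline H$ on unstable modules. *)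

(* Defs.v *)
From HB Require Import structures.
From mathcomp Require Import all_boot all_order all_algebra all_fingroup.
From mathcomp.multinomials Require Import mpoly.

Set Implicit Arguments.
Unset Strict Implicit.
Unset Printing Implicit Defensive.

Import GRing.Theory.
Local Open Scope ring_scope.

(* MathComp's {'GL_n[R]} is GL_(max n 1); here GL_0 must be the trivial group. *)
Record GL (p n : nat) : Type := MkGL { GLval : 'M['F_p]_n; _ : GLval \in unitmx }.

HB.instance Definition _ (p n : nat) := [isSub for @GLval p n].
HB.instance Definition _ (p n : nat) := [Finite of GL p n by <:].

Section GLGroup.
Variables p n : nat.

Definition GL1 : GL p n := MkGL (unitmx1 _ _).

Fact GLmul_subproof (A B : GL p n) : val A *m val B \in unitmx.
Proof. by rewrite unitmx_mul (valP A) (valP B). Qed.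
Definition GLmul (A B : GL p n) : GL p n := MkGL (GLmul_subproof A B).

Fact GLinv_subproof (A : GL p n) : invmx (val A) \in unitmx.
Proof. by rewrite unitmx_inv (valP A). Qed.
Definition GLinv (A : GL p n) : GL p n := MkGL (GLinv_subproof A).

Fact GLmulA : associative GLmul.
Proof. by move=> A B C; apply: val_inj; rewrite /= mulmxA. Qed.
Fact GLmul1 : left_id GL1 GLmul.
Proof. by move=> A; apply: val_inj; rewrite /= mul1mx. Qed.
Fact GLmulV : left_inverse GL1 GLinv GLmul.
Proof. by move=> A; apply: val_inj; rewrite /= mulVmx // (valP A). Qed.

HB.instance Definition _ := Finite_isGroup.Build (GL p n) GLmulA GLmul1 GLmulV.

Lemma val_GLM (g h : GL p n) : val (g * h)%g = val g *m val h.
Proof. by []. Qed.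

Lemma val_GL1 : val (1%g : GL p n) = 1%:M.
Proof. by []. Qed.

End GLGroup.

Section GLembedding.
Variables p m : nat.

Definition GLemb_mx (g : 'M['F_p]_m) : 'M['F_p]_m.+1 :=
  castmx (addn1 m, addn1 m) (block_mx g 0 0 1%:M).

Fact GLemb_subproof (g : GL p m) : GLemb_mx (val g) \in unitmx.
Proof.
rewrite /GLemb_mx; case: _ / (addn1 m).
by rewrite castmx_id unitmxE det_ublock det1 mulr1 -unitmxE (valP g).
Qed.

Definition GLemb (g : GL p m) : GL p m.+1 := MkGL (GLemb_subproof g).

Lemma GLemb1 : GLemb 1%g = 1%g.
Proof.
apply: val_inj; rewrite /= /GLemb_mx; case: _ / (addn1 m).
by rewrite castmx_id -scalar_mx_block.
Qed.

Lemma GLembM (g h : GL p m) : GLemb (g * h)%g = (GLemb g * GLemb h)%g.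
Proof.
apply: val_inj; rewrite /= /GLemb_mx; case: _ / (addn1 m).
by rewrite !castmx_id mulmx_block !mulmx0 !mul0mx !addr0 add0r mulmx1.
Qed.

End GLembedding.

Record rmodule (p : nat) (gT : finGroupType) := RModule {
  rcar :> lmodType 'F_p;
  act : rcar -> gT -> rcar;
  act_linear : forall g, linear (act^~ g);
  act1 : forall x, act x 1%g = x;
  actM : forall x g h, act x (g * h)%g = act (act x g) h
}.
Arguments act {p gT r} _ _.
Arguments RModule {p gT} rcar act _ _ _.

Record rhom (p : nat) (gT : finGroupType) (X Y : rmodule p gT) := RHom {
  rfun :> {linear X -> Y};
  rhom_act : forall x g, rfun (act x g) = act (rfun x) g
}.

Definition riso (p : nat) (gT : finGroupType) (X Y : rmodule p gT) : Prop :=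
  exists f : rhom X Y, bijective f.

Definition surj (A B : Type) (f : A -> B) : Prop := forall y, exists x, f x = y.

Definition projective (p : nat) (gT : finGroupType) (P : rmodule p gT) : Prop :=
  forall (X Y : rmodule p gT) (f : rhom X Y) (g : rhom P Y),
    surj f -> exists h : rhom P X, forall x, f (h x) = g x.

Record projmod (p : nat) (gT : finGroupType) := ProjMod {
  pmod :> rmodule p gT;
  pmodP : projective pmod
}.

Definition short_exact (p : nat) (gT : finGroupType) (X Y Z : rmodule p gT)
    (f : rhom X Y) (g : rhom Y Z) : Prop :=
  [/\ injective f, surj g & forall y, g y = 0 <-> exists x, f x = y].

Definition bilinear_map (p : nat) (A B C : lmodType 'F_p) (b : A -> B -> C) :
    Prop :=
  (forall x, linear (b x)) /\ (forall y, linear (b^~ y)).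

(* [T] with [b : A -> B -> T] is the tensor product of A and B over F_p, with
   the diagonal action. *)
Record tensor_product (p : nat) (gT : finGroupType) (A B T : rmodule p gT)
    (b : A -> B -> T) : Prop := TensorProduct {
  tens_bilinear : bilinear_map b;
  tens_diagonal : forall x y g, b (act x g) (act y g) = act (b x y) g;
  tens_universal : forall (C : lmodType 'F_p) (c : A -> B -> C),
    bilinear_map c ->
    exists f : {linear T -> C}, (forall x y, f (b x y) = c x y) /\
      (forall f' : {linear T -> C}, (forall x y, f' (b x y) = c x y) -> f' =1 f)
}.

Section Restriction.
Variables (p m : nat) (X : rmodule p (GL p m.+1)).

Fact res_act1 (x : X) : act x (GLemb (1%g : GL p m)) = x.
Proof. by rewrite GLemb1 act1. Qed.
Fact res_actM (x : X) (g h : GL p m) :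
  act x (GLemb (g * h)%g) = act (act x (GLemb g)) (GLemb h).
Proof. by rewrite GLembM actM. Qed.

Definition Res : rmodule p (GL p m) :=
  RModule X (fun x g => act x (GLemb g)) (fun g => act_linear (GLemb g))
    res_act1 res_actM.

End Restriction.

Section Steinberg.
Variables p n : nat.

(* The group algebra F_p[GL_n]: the function [a] stands for sum_g a(g) g. *)
Definition galg : Type := {ffun GL p n -> ('F_p)^o}.
HB.instance Definition _ := GRing.Lmodule.on galg.
HB.instance Definition _ := Finite.on galg.

Definition gconst (g : GL p n) : galg := [ffun h => (h == g)%:R].
Definition gmul (a b : galg) : galg :=
  [ffun g => \sum_h a h * b (h^-1 * g)%g].
Definition gact (a : galg) (g : GL p n) : galg := [ffun h => a (h * g^-1)%g].

Fact perm_GL_subproof (s : 'S_n) : perm_mx s \in @unitmx 'F_p n.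
Proof. exact: unitmx_perm. Qed.
Definition perm_GL (s : 'S_n) : GL p n := MkGL (perm_GL_subproof s).

Definition borel : {set GL p n} := [set b | is_trig_mx (val b)^T].

(* The Steinberg idempotent is this element divided by the index in GL_n of the
   group of unitriangular matrices, which is a unit of F_p: it generates the
   same right ideal. *)
Definition steinberg_elt : galg :=
  gmul (\sum_(b in borel) gconst b)
       (\sum_(s : 'S_n) (-1) ^+ s *: gconst (perm_GL s)).

Definition in_St (a : galg) : bool := [exists b : galg, a == gmul steinberg_elt b].

Lemma gmul_linear (a : galg) : linear (gmul a).
Proof.
move=> k b c; apply/ffunP=> g; rewrite !ffunE scaler_sumr -big_split /=.
by apply: eq_bigr => h _; rewrite !ffunE mulrDr scalerAr.
Qed.

Lemma gmul_gact (a b : galg) (g : GL p n) : gact (gmul a b) g = gmul a (gact b g).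
Proof.
by apply/ffunP=> h; rewrite !ffunE; apply: eq_bigr => k _; rewrite ffunE mulgA.
Qed.

Fact in_St_submod : submod_closed in_St.
Proof.
have lin a := gmul_linear a.
split=> [|k u v /existsP[b /eqP->] /existsP[c /eqP->]].
  apply/existsP; exists 0; apply/eqP/ffunP=> g; rewrite !ffunE big1 // => h _.
  by rewrite [X in _ * X]ffunE mulr0.
by apply/existsP; exists (k *: b + c); rewrite lin.
Qed.

HB.instance Definition _ := GRing.isSubmodClosed.Build 'F_p galg in_St in_St_submod.

Record St_type : Type := StElt { St_val : galg; _ : in_St St_val }.
HB.instance Definition _ := [isSub for St_val].
HB.instance Definition _ := [Choice of St_type by <:].
HB.instance Definition _ := [SubChoice_isSubLmodule of St_type by <:].

Fact St_act_subproof (a : St_type) (g : GL p n) : in_St (gact (St_val a) g).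
Proof.
have /existsP[b /eqP->] := valP a; apply/existsP; exists (gact b g).
by rewrite gmul_gact.
Qed.
Definition St_act (a : St_type) (g : GL p n) : St_type :=
  StElt (St_act_subproof a g).

Fact St_act_linear (g : GL p n) : linear (St_act^~ g).
Proof. by move=> k a b; apply: val_inj; apply/ffunP=> h; rewrite /= !ffunE. Qed.
Fact St_act1 (a : St_type) : St_act a 1%g = a.
Proof. by apply: val_inj; apply/ffunP=> h; rewrite /= ffunE invg1 mulg1. Qed.
Fact St_actM (a : St_type) (g h : GL p n) :
  St_act a (g * h)%g = St_act (St_act a g) h.
Proof. by apply: val_inj; apply/ffunP=> k; rewrite /= !ffunE invMg mulgA. Qed.

Definition St : rmodule p (GL p n) :=
  RModule St_type St_act St_act_linear St_act1 St_actM.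

End Steinberg.

(* H^*V_n is generated by the coordinate functions x_i in degree 1 and by their
   Bocksteins y_i in degree 2, where x_i ^ 2 = 0 for p odd and x_i ^ 2 = y_i for
   p = 2: it is the tensor product of the exterior algebra on the x_i and of
   F_p[y_1, .., y_n] for p odd, and F_2[x_1, .., x_n] for p = 2.  In both cases
   it is free over F_p[y_1, .., y_n] on the increasing products
   x_I = prod_(i in I) x_i, and the function [z] stands for sum_I x_I z(I). *)
Definition HV (p n : nat) : Type := {ffun {set 'I_n} -> {mpoly 'F_p[n]}}.
HB.instance Definition _ (p n : nat) := GRing.Lmodule.on (HV p n).

Section Cohomology.
Variables p n : nat.
Implicit Types (z u v : HV p n) (I J K : {set 'I_n}) (d k : nat).

Definition xbasis I : HV p n := [ffun J => (J == I)%:R].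
Definition hx (i : 'I_n) : HV p n := xbasis [set i].
Definition hpoly (f : {mpoly 'F_p[n]}) : HV p n :=
  [ffun J => if J == set0 then f else 0].

(* x_I x_J = (-1) ^ inv(I, J) (prod_(i in I :&: J) x_i ^ 2) x_K, where K is the
   symmetric difference of I and J. *)
Definition inversions I J : nat :=
  #|[set ij : 'I_n * 'I_n | [&& ij.1 \in I, ij.2 \in J & (ij.2 < ij.1)%N]]|.
Definition xsquare (i : 'I_n) : {mpoly 'F_p[n]} := if p == 2 then 'X_i else 0.
Definition hmul u v : HV p n :=
  [ffun K => \sum_(I : {set 'I_n})
      \sum_(J : {set 'I_n} | (I :\: J) :|: (J :\: I) == K)
        (-1) ^+ inversions I J * (\prod_(i in I :&: J) xsquare i) * u I * v J].

Definition homogeneous d z : Prop :=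
  forall I m, m \in msupp (z I) -> (#|I| + (mdeg m).*2)%N = d.

Definition hcomp d z : HV p n :=
  [ffun I => \sum_(m <- msupp (z I) | (#|I| + (mdeg m).*2)%N == d)
      (z I)@_m *: 'X_[m]].

(* The Bockstein: the derivation with x_i |-> y_i and y_i |-> 0. *)
Definition bockstein z : HV p n :=
  [ffun K : {set 'I_n} => \sum_(i | i \notin K)
      (-1) ^+ #|[set j in K | (j < i)%N]| * 'X_i * z (i |: K)].

End Cohomology.

(* The ring morphism with x_i |-> a i and y_i |-> b i. *)
Definition hsubst (p k n : nat) (a : 'I_k -> HV p n)
    (b : 'I_k -> {mpoly 'F_p[n]}) (z : HV p k) : HV p n :=
  \sum_(I : {set 'I_k})
    hmul (\big[@hmul p n/hpoly 1]_(i <- enum I) a i)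
         (hpoly (comp_mpoly [tuple b i | i < k] (z I))).

(* A^* : H^*V_k -> H^*V_n, for the linear map A : V_n -> V_k. *)
Definition pullback (p k n : nat) (A : 'M['F_p]_(k, n)) : HV p k -> HV p n :=
  hsubst (fun i => \sum_j A i j *: hx p j) (fun i => \sum_j A i j *: 'X_j).

(* The total operation [sum_k Sq^k] for p = 2 and [sum_k P^k] for p odd, which
   is a ring morphism. *)
Definition total_power (p n : nat) : HV p n -> HV p n :=
  hsubst (fun i => if p == 2 then hx p i + hpoly 'X_i else hx p i)
         (fun i => 'X_i + 'X_i ^+ p).

(* The part of degree k of the total operation, on classes of degree d: Sq^k for
   p = 2; for p odd, P^j if k = 2j(p-1), and 0 if 2(p-1) does not divide k. *)
Definition steenrod (p n d k : nat) (z : HV p n) : HV p n :=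
  hcomp (d + k) (total_power z).

(* F_p[V_n^*] (x) H^*V_n: linear forms are row vectors, and the function [F]
   stands for sum_mu [mu] (x) F(mu). *)
Definition FVH (p n : nat) : Type := {ffun 'rV['F_p]_n -> HV p n}.
HB.instance Definition _ (p n : nat) := GRing.Lmodule.on (FVH p n).

Section AugmentationIdeal.
Variables p n : nat.

Definition in_IVH (F : FVH p n) : Prop := \sum_mu F mu = 0.

(* (mu) (x) z, where (mu) = [mu] - [0]. *)
Definition aug_tensor (mu : 'rV['F_p]_n) (z : HV p n) : FVH p n :=
  [ffun nu => (nu == mu)%:R *: z - (nu == 0)%:R *: z].

(* The element F of I(V) (x) H^*V is the sum of the (mu) (x) F(mu). *)
Definition Hact (u : HV p 1) (F : FVH p n) : FVH p n :=
  \sum_(mu : 'rV['F_p]_n) aug_tensor mu (hmul (pullback mu u) (F mu)).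

(* The coefficient of [nu] in sum_mu [mu o g] (x) g^*(F(mu)). *)
Definition FVH_act (F : FVH p n) (g : GL p n) : FVH p n :=
  [ffun nu => pullback (val g) (F (nu *m val (g^-1)%g))].

End AugmentationIdeal.

Section HomModules.
Variables (p n : nat) (P : rmodule p (GL p n)).

(* f is in the degree d part of M_P = Hom(P, H^*V_n). *)
Definition in_M (d : nat) (f : P -> HV p n) : Prop :=
  [/\ linear f,
      forall x g, f (act x g) = pullback (val g) (f x)
    & forall x, homogeneous d (f x)].

(* F is in the degree d part of Hom(P, I(V_n) (x) H^*V_n). *)
Definition in_N (d : nat) (F : P -> FVH p n) : Prop :=
  [/\ linear F,
      forall x, in_IVH (F x),
      forall x g, F (act x g) = FVH_act (F x) g
    & forall x mu, homogeneous d (F x mu)].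

(* F is in the degree d part of H^+ . Hom(P, I(V_n) (x) H^*V_n), the kernel of
   the projection to F_p (x)_H Hom(P, I(V_n) (x) H^*V_n). *)
Definition in_HplusN (d : nat) (F : P -> FVH p n) : Prop :=
  exists (r : nat) (e d' : 'I_r -> nat) (u : 'I_r -> HV p 1)
         (G : 'I_r -> P -> FVH p n),
    (forall k, [/\ (0 < e k)%N, (e k + d' k)%N = d,
                   homogeneous (e k) (u k) & in_N (d' k) (G k)]) /\
    (forall x, F x = \sum_k Hact (u k) (G k x)).

End HomModules.

(* An exact functor delta : GL_(m+1)-proj -> GL_m-proj together with an
   isomorphism of unstable modules
     F_p (x)_H Hom(P, I(V_(m+1)) (x) H^*V_(m+1)) ~ M_(delta P),
   natural in P.  The source is the quotient of Hom(P, I(V) (x) H^*V) by its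
   submodule generated by the classes of H of positive degree; the isomorphism
   is given by the linear map dquo P d that it induces in degree d on
   Hom(P, I(V) (x) H^*V), of which only the values on [in_N d] are relevant. *)
Record delta_functor (p m : nat) := DeltaFunctor {
  dobj :> projmod p (GL p m.+1) -> projmod p (GL p m);
  dmap : forall P Q : projmod p (GL p m.+1), rhom P Q -> rhom (dobj P) (dobj Q);
  dmap_id : forall (P : projmod p (GL p m.+1)) (f : rhom P P),
    (forall x, f x = x) -> forall y, dmap f y = y;
  dmap_comp : forall (P Q R : projmod p (GL p m.+1))
      (f : rhom P Q) (g : rhom Q R) (h : rhom P R),
    (forall x, h x = g (f x)) -> forall y, dmap h y = dmap g (dmap f y);
  dmap_exact : forall (P Q R : projmod p (GL p m.+1))
      (f : rhom P Q) (g : rhom Q R),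
    short_exact f g -> short_exact (dmap f) (dmap g);
  dquo : forall (P : projmod p (GL p m.+1)) (d : nat),
    (P -> FVH p m.+1) -> (dobj P -> HV p m);
  dquo_in_M : forall P d F, in_N d F -> in_M d (dquo (P := P) d F);
  dquo_linear : forall P d (c : 'F_p) F G, in_N d F -> in_N d G ->
    forall y, dquo (P := P) d (fun x => c *: F x + G x) y
              = c *: dquo d F y + dquo d G y;
  dquo_surj : forall (P : projmod p (GL p m.+1)) d (f : dobj P -> HV p m),
    in_M d f -> exists2 F : P -> FVH p m.+1, in_N d F & dquo d F =1 f;
  dquo_ker : forall P d F, in_N d F ->
    (forall y, dquo (P := P) d F y = 0) <-> in_HplusN d F;
  dquo_steenrod : forall P d k F, in_N d F ->
    forall y, dquo (P := P) (d + k) (fun x => [ffun mu => steenrod d k (F x mu)]) y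
              = steenrod d k (dquo d F y);
  dquo_bockstein : forall P d F, in_N d F ->
    forall y, dquo (P := P) d.+1 (fun x => [ffun mu => bockstein (F x mu)]) y
              = bockstein (dquo d F y);
  dquo_natural : forall (P Q : projmod p (GL p m.+1)) (h : rhom P Q) d F,
    in_N d F ->
    forall y, dquo (P := P) d (fun x => F (h x)) y = dquo (P := Q) d F (dmap h y)
}.

(* Main.v *)
From HB Require Import structures.
From mathcomp Require Import all_boot all_order all_algebra all_fingroup finfield zify ring.
From mathcomp Require classical_sets boolp.
From mathcomp.multinomials Require Import mpoly.
Require Import Defs.

Set Implicit Arguments.
Unset Strict Implicit.
Unset Printing Implicit Defensive.

Import GRing.Theory.
Local Open Scope ring_scope.

(** Write G for GL_m, Gamma for GL_(m+1), S_m for F_p[y_1, .., y_m] and A^* for the linear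
  substitution with matrix A.  Let mu0 be the last coordinate form on V_(m+1); its stabilizer
  in Gamma is the affine group, an extension of G (the linear parts) by its unipotent
  radical U.

  Multiplication by the classes of H of positive degree acts on the component at mu0 of
  I(V) (x) H^*V through multiples of the class of mu0, which restrict to 0 on the hyperplane
  mu0 = 0.  As Gamma permutes the nonzero linear forms transitively, a class in
  F_p (x)_H Hom(P, I(V) (x) H^*V) is therefore determined, up to exterior classes, by the
  restriction to the hyperplane of its component at mu0, a map from P to S_m that is
  equivariant for the affine group acting through linear parts.  Conversely, if P has a linear
  endomorphism whose trace over the affine group is the identity, averaging over Gamma
  extends every such map.  The exterior classes are lost for odd p, but the top operation
  kills them and is the Frobenius, hence injective, on polynomials.  Thus the equivariant maps
  from delta P to S_m are the affine-equivariant maps from P to S_m, compatibly with the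
  operations (delta_map_inj, delta_map_surj, delta_map_natural, delta_map_rpow).

  This determines delta P as a module and not only M_(delta P), because the linear
  endomorphisms of S_m commuting with the operations are the combinations of the substitutions
  A^* (umap_pullspan), which are linearly independent (pull_indep).  The substitutions that
  are not invertible are discarded by multiplication by Dickson's product of the nonzero
  linear forms: it is invariant under G and restricts to 0 on every proper subspace.  For P
  the group algebra of Gamma this produces an element b of delta P on which the coefficient of
  the identity substitution is the indicator function of U (unit_elt).  Its images under the
  maps from the group algebra to P define a linear map from P to delta P that is constant on
  the orbits of U and compatible with G (aff_point): a map from the coinvariants of U
  in P to delta P, which evaluation of affine maps shows to be an isomorphism in the case at
  hand (point_inj, point_surj).

  For the Steinberg module the coinvariants are known.  By the theorem
  of Solomon and Tits, St_n is the module of cycles of the building (cycle_in_St), and a cycle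
  is determined by its values on the flags whose hyperplane does not contain mu0 (cycle_eq0).
  These flags form disjoint copies of the flags of V_m, permuted simply transitively by U, and
  the values on each copy are an arbitrary cycle: so the restriction of St_(m+1) to the affine
  group is induced from St_m (St_affine).  This property passes to
  tensor products (tensor_induced) and provides the traces that averaging and projectivity
  require (affine_induced_trace, trace_aff, projective_of_trace).  Hence the coinvariants of U
  in St_(m+1) (x) X are St_m (x) Res X (delta_induced). *)

(** * Linear algebra in arbitrary dimension *)

Section Complements.
Variables (F : fieldType) (V : lmodType F).
Implicit Types (W C : V -> Prop) (x y v : V) (a : F).

Definition lin_closed W := forall a x y, W x -> W y -> W (a *: x + y).

Lemma lin_closedZ W a x : W 0 -> lin_closed W -> W x -> W (a *: x).
Proof. by move=> W0 Wlin Wx; rewrite -[_ *: _]addr0; apply: Wlin. Qed.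

Lemma lin_closedB W x y : lin_closed W -> W x -> W y -> W (x - y).
Proof. by move=> Wlin Wx Wy; rewrite addrC -scaleN1r; apply: Wlin. Qed.

(** A maximal subspace meeting W only in 0 is a complement of W: adding to it the line of
  an element outside the sum would keep the intersection with W equal to 0. *)
Lemma linear_projection W : W 0 -> lin_closed W ->
  exists2 pi : V -> V, linear pi & (forall x, W x -> pi x = 0) /\ (forall x, W (x - pi x)).
Proof.
move=> W0 Wlin.
(* The empty set is allowed, as the union of the empty chain. *)
pose indep C := lin_closed C /\ forall x, C x -> W x -> x = 0.
have [|C [[Clin CW] Cmax]] := @classical_sets.Zorn_bigcup V indep.
  move=> FF FFindep FFtot; split=> [a x y [A FA Ax] [B FB By]|x [A FA Ax]].
    by have [AB|BA] := FFtot _ _ FA FB;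
      [exists B => //; apply: (FFindep _ FB).1 => //; apply: AB
      |exists A => //; apply: (FFindep _ FA).1 => //; apply: BA].
  exact: (FFindep _ FA).2.
have max_C B : indep B -> (forall x, C x -> B x) -> forall x, B x -> C x.
  move=> Bindep CB x Bx; case: (boolp.pselect (C x)) => // nCx; exfalso.
  by apply: (Cmax B) => //; split=> // BC; apply: nCx; apply: BC.
have C0 : C 0.
  case: (boolp.pselect (exists x, C x)) => [[x Cx] | noC].
    by rewrite -(subrr x); apply: lin_closedB.
  apply: (max_C (fun x => x = 0)) => // [|x Cx]; last by case: noC; exists x.
  by split=> // a x y -> ->; rewrite scaler0 addr0.
have decomp x : exists c, C c /\ W (x - c).
  case: (boolp.pselect (exists c, C c /\ W (x - c))) => // no; exfalso.
  pose B y := exists c a, C c /\ y = c + a *: x.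
  have Bindep : indep B.
    split=> [a _ _ [c [b [Cc ->]]] [c' [b' [Cc' ->]]] | _ [c [b [Cc ->]]] Wy].
      exists (a *: c + c'), (a * b + b'); split; first exact: Clin.
      by rewrite scalerDr scalerDl scalerA addrACA.
    have [b0|b_neq0] := eqVneq b 0.
      by move: Wy; rewrite b0 scale0r addr0 => Wc; apply: CW.
    case: no; exists (- (b^-1 *: c)); split.
      by rewrite -scaleNr; apply: lin_closedZ.
    rewrite opprK addrC -[x]scale1r -(mulVf b_neq0) -scalerA -scalerDr.
    exact: lin_closedZ.
  have CB y : C y -> B y by move=> Cy; exists y, 0; split; rewrite ?scale0r ?addr0.
  apply: no; exists x; split; last by rewrite subrr.
  by apply: (max_C B) => //; exists 0, 1; split; rewrite ?scale1r ?add0r.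
pose pi x := sval (boolp.constructive_indefinite_description (decomp x)).
have Cpi x : C (pi x) by rewrite /pi; case: boolp.constructive_indefinite_description => c [].
have Wpi x : W (x - pi x) by rewrite /pi; case: boolp.constructive_indefinite_description => c [].
have piE x c : C c -> W (x - c) -> pi x = c.
  move=> Cc Wxc; apply/eqP; rewrite -subr_eq0; apply/eqP/CW; first exact: lin_closedB.
  have -> : pi x - c = (x - c) - (x - pi x) by rewrite opprB [RHS]addrC addrA subrK.
  exact: lin_closedB.
exists pi; last first.
  by split=> // x Wx; apply: piE; rewrite ?subr0.
move=> a x y; apply: piE; first exact: Clin.
by rewrite opprD addrACA -scalerBr; apply: Wlin.
Qed.

(** Duality in infinite dimension: the line of a vector outside W survives in a complement
  of W, and a second projection splits it off. *)
Lemma linear_functional W v : W 0 -> lin_closed W -> ~ W v ->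
  exists2 phi : V -> F^o, linear phi & (forall x, W x -> phi x = 0) /\ phi v = 1.
Proof.
move=> W0 Wlin nWv; have [pi pi_lin [piW Wpi]] := linear_projection W0 Wlin.
pose u := pi v; have u_neq0 : u != 0.
  by apply/eqP => u0; apply: nWv; have := Wpi v; rewrite -/u u0 subr0.
pose L x := exists a, x = a *: u.
have [||rho rho_lin [rhoL Lrho]] := @linear_projection L.
- by exists 0; rewrite scale0r.
- by move=> a _ _ [b ->] [c ->]; exists (a * b + c); rewrite scalerDl scalerA.
pose phi x := sval (boolp.constructive_indefinite_description (Lrho (pi x))).
have phiE x : pi x - rho (pi x) = phi x *: u.
  by rewrite /phi; case: boolp.constructive_indefinite_description.
have uI : injective (fun a : F => a *: u).
  move=> a b /eqP; rewrite -subr_eq0 -scalerBl scaler_eq0 (negbTE u_neq0) orbF subr_eq0.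
  by move/eqP.
exists phi => [a x y|].
  apply: uI; transitivity (a *: (phi x *: u) + phi y *: u); last by rewrite scalerDl scalerA.
  rewrite -!phiE pi_lin rho_lin; by rewrite opprD addrACA -scalerBr.
split=> [x /piW pix0|]; apply: uI => /=.
  by rewrite -phiE pix0 rhoL ?subr0 ?scale0r //; exists 0; rewrite scale0r.
by rewrite -phiE -/u rhoL ?subr0 ?scale1r //; exists 1; rewrite scale1r.
Qed.

Lemma linear_section (Z : lmodType F) (f : V -> Z) : linear f -> surj f ->
  exists2 s : Z -> V, linear s & cancel s f.
Proof.
move=> f_lin f_surj.
have fB x y : f (x - y) = f x - f y.
  by rewrite addrC -scaleN1r f_lin scaleN1r addrC.
have f0 : f 0 = 0 by rewrite -(subrr 0) fB subrr.
have [||pi pi_lin [piW Wpi]] := @linear_projection (fun x => f x = 0) => //.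
  by move=> a x y fx fy; rewrite f_lin fx fy scaler0 addr0.
have fpi x : f (pi x) = f x by apply/esym/eqP; rewrite -subr_eq0 -fB Wpi.
have piB x y : pi (x - y) = pi x - pi y.
  by rewrite addrC -scaleN1r pi_lin scaleN1r addrC.
have pi_eq x y : f x = f y -> pi x = pi y.
  by move=> eq_f; apply/eqP; rewrite -subr_eq0 -piB piW // fB eq_f subrr.
pose g z := sval (boolp.constructive_indefinite_description (f_surj z)).
have gK z : f (g z) = z by rewrite /g; case: boolp.constructive_indefinite_description.
exists (fun z => pi (g z)) => [a x y|z]; last by rewrite fpi gK.
by rewrite -pi_lin; apply: pi_eq; rewrite f_lin !gK.
Qed.

End Complements.

Section LinearProp.
Variables (R : pzRingType) (U V : lmodType R) (f : U -> V).
Hypothesis f_lin : linear f.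
Let F : {linear U -> V} := HB.pack f (GRing.isLinear.Build R U V *:%R f f_lin).

Lemma lin_sum I r (P : pred I) (E : I -> U) :
  f (\sum_(i <- r | P i) E i) = \sum_(i <- r | P i) f (E i).
Proof. exact: (raddf_sum F). Qed.
Lemma lin0 : f 0 = 0. Proof. exact: (raddf0 F). Qed.
Lemma linD x y : f (x + y) = f x + f y. Proof. exact: (raddfD F). Qed.
Lemma linN x : f (- x) = - f x. Proof. exact: (raddfN F). Qed.
Lemma linB x y : f (x - y) = f x - f y. Proof. exact: (raddfB F). Qed.
Lemma linZ c x : f (c *: x) = c *: f x. Proof. exact: (linearZ_LR F). Qed.
Lemma linE : exists L : {linear U -> V}, L =1 f. Proof. by exists F. Qed.
End LinearProp.

Lemma lin_exchange (R : comPzRingType) (V : lmodType R) (c e : R) (a b a' b' : V) :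
  c *: (e *: a + b) + (e *: a' + b') = e *: (c *: a + a') + (c *: b + b').
Proof. by rewrite !scalerDr !scalerA addrACA mulrC. Qed.

(** * The Steenrod operations on polynomials *)

Section PolyInduction.
Variables (R : comNzRingType) (n : nat).
Implicit Types (f g : {mpoly R[n]}).

Lemma monomial_ind (K : 'X_{1..n} -> Prop) :
  K 0%MM -> (forall i m, K m -> K (U_(i) + m)%MM) -> forall m, K m.
Proof.
move=> K0 KS m; move: {2}(mdeg m) (leqnn (mdeg m)) => d.
elim: d m => [|d IHd] m; first by rewrite leqn0 mdeg_eq0 => /eqP ->.
case: (pickP (fun i => m i != 0%N)) => [i mi_neq0 | m0] le_md.
  have le_im : (U_(i) <= m)%MM by rewrite lep1mP.
  rewrite -(submK le_im) addmC; apply: KS; apply: IHd.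
  by move: le_md; rewrite -{1}(submK le_im) mdegD mdeg1 addn1 ltnS.
have ->: m = 0%MM by apply/mnmP=> i; apply/eqP; rewrite mnm0E; apply/negbFE/m0.
exact: K0.
Qed.

Lemma mpoly_alg_ind (K : {mpoly R[n]} -> Prop) :
  (forall c, K c%:MP) -> (forall f g, K f -> K g -> K (f + g)) ->
  (forall i f, K f -> K ('X_i * f)) -> forall f, K f.
Proof.
move=> KC KD KX; elim/mpolyind=> [|c m f _ _ Kf]; first by rewrite -mpolyC0.
apply: KD => //; elim/monomial_ind: m => [|i m Km].
  by rewrite mpolyX0 alg_mpolyC.
by rewrite mpolyXD scalerAr; apply: KX.
Qed.

End PolyInduction.

Definition sigma_gen (p n : nat) (i : 'I_n) : {poly {mpoly 'F_p[n]}} :=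
  ('X_i)%:P + 'X * ('X_i ^+ p)%:P.
(** The operation P^0 + t P^1 + t ^ 2 P^2 + .. as a ring morphism to polynomials in t. *)
HB.lock Definition sigma (p n : nat) (f : {mpoly 'F_p[n]}) : {poly {mpoly 'F_p[n]}} :=
  mmap (polyC \o @mpolyC n 'F_p) (@sigma_gen p n) f.
Canonical sigma_unlockable := Unlockable sigma.unlock.

(** The derivation y |-> y ^ (p ^ j); for j > 0 it is Milnor's primitive operation. *)
HB.lock Definition dpow (p n j : nat) (f : {mpoly 'F_p[n]}) : {mpoly 'F_p[n]} :=
  \sum_i 'X_i ^+ (p ^ j) * f^`M(i).
Canonical dpow_unlockable := Unlockable dpow.unlock.

(** The same operation at t = 1, where the degree keeps track of the exponent of t. *)
HB.lock Definition tpow (p n : nat) (f : {mpoly 'F_p[n]}) : {mpoly 'F_p[n]} :=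
  f \mPo [tuple 'X_i + 'X_i ^+ p | i < n].

Section SigmaMorphism.
Variables p n : nat.
Implicit Types f : {mpoly 'F_p[n]}.

Lemma sigmaE f : sigma f = mmap (polyC \o @mpolyC n 'F_p) (@sigma_gen p n) f.
Proof. by rewrite unlock. Qed.

Lemma dpowE j f : dpow j f = \sum_i 'X_i ^+ (p ^ j) * f^`M(i).
Proof. by rewrite unlock. Qed.

Fact sigma_is_zmod_morphism : zmod_morphism (@sigma p n).
Proof. by move=> f g; rewrite !sigmaE rmorphB. Qed.
Fact sigma_is_monoid_morphism : monoid_morphism (@sigma p n).
Proof. by split=> [|f g]; rewrite !sigmaE ?rmorph1 ?rmorphM. Qed.
HB.instance Definition _ :=
  GRing.isZmodMorphism.Build {mpoly 'F_p[n]} {poly {mpoly 'F_p[n]}}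
    (@sigma p n) sigma_is_zmod_morphism.
HB.instance Definition _ :=
  GRing.isMonoidMorphism.Build {mpoly 'F_p[n]} {poly {mpoly 'F_p[n]}}
    (@sigma p n) sigma_is_monoid_morphism.

End SigmaMorphism.

Lemma exprD_pchar (R : comNzRingType) (p : nat) (charRp : p \in [pchar R]) (x y : R) :
  (x + y) ^+ p = x ^+ p + y ^+ p.
Proof. exact: (pFrobenius_autD_comm charRp (mulrC x y)). Qed.

Section CharP.
Variables (p : nat) (p_prime : prime p).

Lemma natr_val_Fp (c : 'F_p) : (c : nat)%:R = c.
Proof. exact: natr_Zp. Qed.

Lemma expf_p (c : 'F_p) : c ^+ p = c.
Proof. by rewrite -[in X in _ ^+ X](card_Fp p_prime) expf_card. Qed.

(** Over the prime field a ring morphism is automatically linear. *)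
Lemma rmorph_mpoly_ext n (T : nzRingType) (f g : {rmorphism {mpoly 'F_p[n]} -> T}) :
  (forall i, f 'X_i = g 'X_i) -> f =1 g.
Proof.
move=> eqX; elim/mpoly_alg_ind=> [c | u v eq_u eq_v | i u eq_u].
- by rewrite -(natr_val_Fp c) mpolyC_nat !rmorph_nat.
- by rewrite !rmorphD /= eq_u eq_v.
- by rewrite !rmorphM /= eq_u eqX.
Qed.

Lemma pchar_mpoly n : p \in [pchar {mpoly 'F_p[n]}].
Proof.
by rewrite inE p_prime /= -mpolyC_nat (pcharf0 (pchar_Fp p_prime)) mpolyC0.
Qed.

Section OneN.
Variable n : nat.
Implicit Types (f g h : {mpoly 'F_p[n]}) (i : 'I_n) (j l : nat).

Let S := {mpoly 'F_p[n]}.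

Lemma frobD f g : (f + g) ^+ p = f ^+ p + g ^+ p.
Proof. exact: exprD_pchar (pchar_mpoly n) f g. Qed.

Lemma frobZ (c : 'F_p) f : (c *: f) ^+ p = c *: f ^+ p.
Proof. by rewrite exprZn expf_p. Qed.

Lemma frob_sum (I : Type) (r : seq I) (Q : pred I) (F : I -> S) :
  (\sum_(i <- r | Q i) F i) ^+ p = \sum_(i <- r | Q i) F i ^+ p.
Proof.
apply: (big_morph (fun f => f ^+ p) frobD).
by rewrite expr0n -[p == 0%N]negbK -lt0n prime_gt0.
Qed.

Lemma frob_inj f g : f ^+ p = g ^+ p -> f = g.
Proof.
move=> eq_fg; apply/eqP; rewrite -subr_eq0; move: (frobD (f - g) g).
rewrite subrK eq_fg -[LHS]add0r => /addIr/esym/eqP.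
by rewrite expf_eq0 => /andP[].
Qed.

(** The Frobenius also raises the parameter t to the power p. *)
Lemma coef_frob (q : {poly S}) l :
  (q ^+ p)`_l = if (p %| l)%N then q`_(l %/ p) ^+ p else 0.
Proof.
have p_gt0 := prime_gt0 p_prime.
have charPX : p \in [pchar {poly S}].
  by rewrite inE p_prime /= -polyC_natr (pcharf0 (pchar_mpoly n)).
elim/poly_ind: q l => [|q c IHq] l.
  by rewrite expr0n -[p == 0%N]negbK -lt0n p_gt0 coef0 coef0 expr0n
             -[p == 0%N]negbK -lt0n p_gt0; case: ifP.
rewrite (exprD_pchar charPX) exprMn -polyC_exp [LHS]coefD coefMXn coefC IHq.
rewrite coefD coefMX coefC; case: (posnP l) => [-> | l_gt0].
  by rewrite p_gt0 dvdn0 div0n eqxx !add0r.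
case: (leqP p l) => [le_pl | lt_lp].
  rewrite addr0 dvdn_subl //; case: ifP => // p_l.
  have l_p_gt0: (0 < l %/ p)%N by rewrite divn_gt0.
  rewrite -(subnK le_pl) divnDr // divnn p_gt0 addn1 /= addr0 addnK.
  by [].
by rewrite add0r gtnNdvd.
Qed.

Definition rpow j f : S := (sigma f)`_j.

Lemma sigmaX i : sigma 'X_i = @sigma_gen p n i.
Proof. by rewrite sigmaE mmapX mmap1U. Qed.

Lemma sigmaC c : sigma (c%:MP : S) = (c%:MP)%:P.
Proof. by rewrite sigmaE mmapC. Qed.

Lemma rpow_linear j : linear (rpow j).
Proof.
move=> c f g; rewrite /rpow -mul_mpolyC rmorphD rmorphM /= sigmaC coefD coefCM.
by rewrite mul_mpolyC.
Qed.
HB.instance Definition _ j :=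
  GRing.isLinear.Build 'F_p S S *:%R (rpow j) (rpow_linear j).

Lemma rpow0C c : rpow 0 c%:MP = c%:MP.
Proof. by rewrite /rpow sigmaC coefC. Qed.

Lemma rpowSC j c : rpow j.+1 c%:MP = 0.
Proof. by rewrite /rpow sigmaC coefC. Qed.

Lemma rpow0XM i f : rpow 0 ('X_i * f) = 'X_i * rpow 0 f.
Proof.
by rewrite /rpow rmorphM /= sigmaX mulrDl -mulrA coefD coefCM coefXM addr0.
Qed.

Lemma rpowXM j i f : rpow j.+1 ('X_i * f) = 'X_i * rpow j.+1 f + 'X_i ^+ p * rpow j f.
Proof.
by rewrite /rpow rmorphM /= sigmaX mulrDl -mulrA coefD coefCM coefXM coefCM.
Qed.

Lemma rpow0 f : rpow 0 f = f.
Proof.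
elim/mpoly_alg_ind: f => [c|f g Hf Hg|i f Hf]; first exact: rpow0C.
  by rewrite raddfD /= Hf Hg.
by rewrite rpow0XM Hf.
Qed.

Lemma rpow_frob j f :
  rpow j (f ^+ p) = if (p %| j)%N then rpow (j %/ p) f ^+ p else 0.
Proof. by rewrite /rpow rmorphXn /= coef_frob. Qed.

Lemma rpow_homog d j f : f \is d.-homog -> rpow j f \is (d + j * p.-1).-homog.
Proof.
move=> f_hom; have p1 : (p = p.-1.+1)%N by rewrite prednK // prime_gt0.
rewrite (mpolyE f) raddf_sum /= rpred_sum // => m _; rewrite linearZZ /=.
have [->|fm] := eqVneq f@_m 0; first by rewrite scale0r rpred0.
apply: rpredZ; rewrite -mcoeff_msupp in fm.
have {fm f_hom d} <- : mdeg m = d := dhomogP _ _ _ f_hom _ fm.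
elim/monomial_ind: m j => [|i m IHm] j; first rewrite mdeg0.
  case: j => [|j]; rewrite mpolyX0 -mpolyC1; last by rewrite rpowSC rpred0.
  by rewrite rpow0C mpolyC1; exact: dhomog1.
rewrite mpolyXD; case: j => [|j]; first by rewrite rpow0 -mpolyXD dhomogX addn0 /=.
rewrite rpowXM mdegD mdeg1 rpredD //.
  by rewrite -addnA; apply: dhomogM (IHm _); rewrite dhomogX /= mdeg1.
have ->: (1 + mdeg m + j.+1 * p.-1 = p + (mdeg m + j * p.-1))%N.
  by rewrite {2}p1 mulSn; lia.
apply: dhomogM (IHm _); rewrite -[X in X.-homog]mul1n.
by apply: dhomogMn; rewrite dhomogX /= mdeg1.
Qed.

Lemma rpow_gt m e : (mdeg m < e)%N -> rpow e 'X_[m] = 0.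
Proof.
elim/monomial_ind: m e => [|i m IHm] [|e] //; first by rewrite mpolyX0 -mpolyC1 rpowSC.
rewrite mdegD mdeg1 ltnS mpolyXD rpowXM => lt_me.
by rewrite !IHm ?mulr0 ?addr0 // ltnW.
Qed.

(** Instability: on a monomial of degree d the coefficient of t ^ d is the product of the
  y ^ p, as every factor y + t y ^ p must contribute its second term. *)
Lemma rpow_top d f : f \is d.-homog -> rpow d f = f ^+ p.
Proof.
move=> f_hom; rewrite (mpolyE f) raddf_sum frob_sum /=.
apply: eq_big_seq => m fm; rewrite linearZZ /= frobZ; congr (_ *: _).
have {fm f_hom} <- : mdeg m = d := dhomogP _ _ _ f_hom _ fm.
elim/monomial_ind: m => [|i m IHm].
  by rewrite mdeg0 mpolyX0 -mpolyC1 rpow0C mpolyC1 expr1n.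
by rewrite mdegD mdeg1 mpolyXD rpowXM IHm rpow_gt // mulr0 add0r exprMn.
Qed.

Lemma tpow_comp f : tpow f = f \mPo [tuple 'X_i + 'X_i ^+ p | i < n].
Proof. by rewrite tpow.unlock. Qed.

Lemma tpowE f : tpow f = \sum_(j < size (sigma f)) rpow j f.
Proof.
have ->: tpow f = (sigma f).[1].
  rewrite tpow_comp.
  rewrite -[RHS]/((horner_eval (1 : S) \o @sigma p n) f); apply: rmorph_mpoly_ext => i /=.
  rewrite /horner_eval comp_mpolyXU -tnth_nth tnth_mktuple sigmaX.
  by rewrite !hornerE.
by rewrite horner_coef; apply: eq_bigr => j _; rewrite expr1n mulr1.
Qed.

Lemma rpow_total d j f :
  f \is d.-homog -> pihomog mdeg (d + j * p.-1) (tpow f) = rpow j f.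
Proof.
have p1 : (0 < p.-1)%N by rewrite -ltnS prednK ?prime_gt1 // prime_gt0.
move=> f_hom; rewrite tpowE raddf_sum /=.
have pi_rpow (k : nat) :
    pihomog mdeg (d + j * p.-1) (rpow k f) = if k == j then rpow k f else 0.
  case: eqP => [-> | neq_ij]; first by rewrite pihomog_dE // rpow_homog.
  by apply: pihomog_ne0 (rpow_homog k f_hom); rewrite eqn_add2l eqn_pmul2r //; apply/eqP.
rewrite (eq_bigr _ (fun (k : 'I__) _ => pi_rpow k)) -big_mkcond /=.
have [lt_j | le_j] := ltnP j (size (sigma f)).
  by rewrite (big_pred1 (Ordinal lt_j)).
rewrite big1 => [|k /eqP eq_kj]; first by rewrite /rpow nth_default.
by have := ltn_ord k; rewrite eq_kj ltnNge le_j.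
Qed.

Lemma dpow_linear j : linear (@dpow p n j).
Proof.
move=> c f g; rewrite !dpowE scaler_sumr -big_split /=; apply: eq_bigr => i _.
by rewrite linearP /= mulrDr scalerAr.
Qed.
HB.instance Definition _ j :=
  GRing.isLinear.Build 'F_p S S *:%R (@dpow p n j) (dpow_linear j).

Lemma mderivX1 i k : ('X_i : S)^`M(k) = (i == k)%:R.
Proof.
rewrite mderivX mnm1E; case: eqP => [->|_]; last by rewrite scale0r.
by rewrite scale1r -mpolyX0; congr 'X_[_]; apply/mnmP=> l; rewrite mnmBE subnn mnm0E.
Qed.

Lemma mderiv_exp k l f : (f ^+ l)^`M(k) = f ^+ l.-1 * f^`M(k) *+ l.
Proof.
elim: l => [|[|l] IHl]; first by rewrite expr0 -mpolyC1 mderivC mulr0n.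
  by rewrite expr1 expr0 mul1r.
rewrite exprS mderivM IHl /= -mulrnAr mulrA -exprS -[in LHS]/(f ^+ l.+1) mulrnAr.
by rewrite [_ * f ^+ _]mulrC -mulrS.
Qed.

Lemma mderiv_frob k f : (f ^+ p)^`M(k) = 0.
Proof. by rewrite mderiv_exp -mulr_natr (pcharf0 (pchar_mpoly n)) mulr0. Qed.

Lemma mderiv_frobM k f g : (f ^+ p * g)^`M(k) = f ^+ p * g^`M(k).
Proof. by rewrite mderivM mderiv_frob mul0r add0r. Qed.

Lemma dpowXM j i f : dpow j ('X_i * f) = 'X_i ^+ (p ^ j) * f + 'X_i * dpow j f.
Proof.
rewrite !dpowE mulr_sumr.
under eq_bigr => k _ do rewrite mderivM mulrDr mderivX1.
rewrite big_split /=; congr (_ + _); last by apply: eq_bigr => k _; rewrite mulrCA.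
rewrite (bigD1 i) //= eqxx mul1r big1 ?addr0 // => k /negbTE.
by rewrite eq_sym => ->; rewrite mul0r mulr0.
Qed.

Lemma dpow_frobM j f g : dpow j (f ^+ p * g) = f ^+ p * dpow j g.
Proof.
by rewrite !dpowE mulr_sumr; apply: eq_bigr => i _; rewrite mderiv_frobM mulrCA.
Qed.

Lemma dpow_frob j f : dpow j (f ^+ p) = 0.
Proof. by rewrite !dpowE big1 // => i _; rewrite mderiv_frob mulr0. Qed.

Lemma dpowC j c : dpow j (c%:MP : S) = 0.
Proof. by rewrite !dpowE big1 // => i _; rewrite mderivC mulr0. Qed.

Lemma rpow1 f : rpow 1 f = dpow 1 f.
Proof.
elim/mpoly_alg_ind: f => [c|f g Hf Hg|i f Hf]; first by rewrite rpowSC dpowC.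
  by rewrite !raddfD /= Hf Hg.
by rewrite rpowXM rpow0 dpowXM expn1 Hf addrC.
Qed.

(** A derivation kills the second term of y + t y ^ p, so that the partial derivatives
  commute with the total operation. *)
Lemma dpow_rpow j l f : dpow j.+1 (rpow l f) = \sum_i 'X_i ^+ (p ^ j.+1) * rpow l f^`M(i).
Proof.
elim/mpoly_alg_ind: f l => [c|f g Hf Hg|i f Hf] l.
- rewrite big1 => [|i _]; last by rewrite mderivC raddf0 mulr0.
  by case: l => [|l]; rewrite ?rpow0C ?rpowSC ?dpowC ?raddf0.
- have rpowD u v : rpow l (u + v) = rpow l u + rpow l v by exact: raddfD.
  have dpowD u v : dpow j.+1 (u + v) = dpow j.+1 u + dpow j.+1 v
    := raddfD (@dpow p n j.+1) u v.
  rewrite rpowD dpowD Hf Hg -big_split; apply: eq_bigr => i _.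
  by rewrite /= mderivD rpowD mulrDr.
case: l => [|l]; first by rewrite rpow0 dpowE; apply: eq_bigr => k _; rewrite rpow0.
rewrite rpowXM raddfD /= dpowXM dpow_frobM !Hf.
under [RHS]eq_bigr => k _ do rewrite mderivM mderivX1 raddfD /= rpowXM !mulrDr.
rewrite !big_split /= -!addrA; congr (_ + _).
  rewrite (bigD1 i) //= eqxx mul1r big1 ?addr0 // => k /negbTE.
  by rewrite eq_sym => ->; rewrite mul0r raddf0 mulr0.
rewrite !mulr_sumr; congr (_ + _); apply: eq_bigr => k _; exact: mulrCA.
Qed.

Lemma sigma_Xpj j i :
  sigma ('X_i ^+ (p ^ j) : S) = ('X_i ^+ (p ^ j))%:P + 'X^(p ^ j) * ('X_i ^+ (p ^ j.+1))%:P.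
Proof.
have charPX : p \in [pchar {poly S}].
  by rewrite inE p_prime /= -polyC_natr (pcharf0 (pchar_mpoly n)).
rewrite rmorphXn /= sigmaX /sigma_gen; elim: j => [|j IHj]; first by rewrite expr1.
rewrite expnSr exprM {}IHj.
rewrite (exprD_pchar charPX).
by rewrite exprMn -!polyC_exp -!exprM -!expnSr.
Qed.

Lemma rpow_Xpj j i f :
  rpow (p ^ j) ('X_i ^+ (p ^ j) * f)
  = 'X_i ^+ (p ^ j) * rpow (p ^ j) f + 'X_i ^+ (p ^ j.+1) * f.
Proof.
rewrite /rpow rmorphM /= sigma_Xpj mulrDl coefD coefCM -mulrA coefXnM.
by rewrite ltnn subnn coefCM -[(sigma f)`_0]/(rpow 0 f) rpow0.
Qed.

(** Milnor's recursion: only P^0 and P^(p^j) are nonzero on y ^ (p ^ j), so that the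
  commutator of P^(p^j) with a derivation only involves y ^ (p ^ (j + 1)). *)
Lemma dpowS j f :
  dpow j.+2 f = rpow (p ^ j.+1) (dpow j.+1 f) - dpow j.+1 (rpow (p ^ j.+1) f).
Proof.
rewrite dpow_rpow [dpow j.+1 f]dpowE (raddf_sum (rpow _)) -sumrB [LHS]dpowE.
by apply: eq_bigr => i _; rewrite /= rpow_Xpj addrC addKr.
Qed.

(** For N large the multiples of the different powers y_i ^ N have no common
  monomial. *)
Lemma dpow_indep N (w : 'I_n -> S) :
  (forall i, msize (w i) <= N)%N -> \sum_i 'X_i ^+ N * w i = 0 -> forall i, w i = 0.
Proof.
move=> le_wN sum0 i; apply/mpolyP=> m; rewrite mcoeff0.
case: (boolP (m \in msupp (w i))) => [wi_m | /memN_msupp_eq0 //].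
have lt_mN : (mdeg m < N)%N by apply: leq_trans (msize_mdeg_lt wi_m) (le_wN i).
have := congr1 (mcoeff (U_(i) *+ N + m)%MM) sum0.
rewrite mcoeff0 raddf_sum /= (bigD1 i) //= [X in _ + X]big1 => [|k neq_ki].
  by rewrite addr0 mulrC mpolyXn mcoeffMX.
apply: memN_msupp_eq0; rewrite mulrC mpolyXn.
rewrite (perm_mem (msuppMX _ _)); apply/mapP=> -[m' _ /mnmP/(_ k)].
rewrite !mnmDE !mulmnE !mnm1E eqxx mul1n eq_sym (negbTE neq_ki) mul0n add0n => eq_m.
have : (m k <= mdeg m)%N by rewrite mdegE (bigD1 k) //= leq_addr.
by rewrite eq_m leqNgt (leq_trans lt_mN) // leq_addr.
Qed.

End OneN.
End CharP.

(** * Morphisms of modules over the operations *)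

(** The p-th root, meaningful on p-th powers; the other monomials are dropped. *)
HB.lock Definition proot (p n : nat) (f : {mpoly 'F_p[n]}) : {mpoly 'F_p[n]} :=
  \sum_(m : 'X_{1..n < msize f}) f@_(m *+ p) *: 'X_[m].
Canonical proot_unlockable := Unlockable proot.unlock.

Section FrobeniusRoot.
Variables (p : nat) (p_prime : prime p) (n : nat).
Local Notation S := {mpoly 'F_p[n]}.
Implicit Types (f g h : S) (i k l : 'I_n) (j : nat) (m : 'X_{1..n}).

Let p_gt0 : (0 < p)%N := prime_gt0 p_prime.

Lemma mcoeff_proot m f : (proot f)@_m = f@_(m *+ p).
Proof.
have [lt_m | le_m] := ltnP (mdeg m) (msize f); first by rewrite unlock (mcoeff_mpoly (fun m => f@_(m *+ p))).
rewrite [RHS]memN_msupp_eq0; last first.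
  by apply: msize_mdeg_ge; rewrite mdegMn (leq_trans le_m) // leq_pmulr.
rewrite unlock raddf_sum big1 // => k _; rewrite /= mcoeffZ mcoeffX.
case: eqP => [eq_km|_]; last by rewrite mulr0.
by have := bmdeg k; rewrite eq_km ltnNge le_m.
Qed.

Lemma proot_linear : linear (@proot p n).
Proof.
by move=> c f g; apply/mpolyP=> m; rewrite mcoeffD mcoeffZ !mcoeff_proot mcoeffD mcoeffZ.
Qed.
HB.instance Definition _ := GRing.isLinear.Build 'F_p S S *:%R (@proot p n) proot_linear.

Lemma mulm_inj : injective (fun m => (m *+ p)%MM).
Proof.
move=> m1 m2 /mnmP eq_m; apply/mnmP=> i; have := eq_m i.
by rewrite !mulmnE => /eqP; rewrite eqn_pmul2r // => /eqP.
Qed.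

Lemma mcoeff_frob m f : (f ^+ p)@_(m *+ p) = f@_m.
Proof.
rewrite {1}(mpolyE f) (frob_sum p_prime) raddf_sum [in RHS](mpolyE f) [RHS]raddf_sum /=.
apply: eq_bigr => k _; rewrite frobZ // !mcoeffZ mcoeffXn mcoeffX.
by rewrite (inj_eq mulm_inj).
Qed.

Lemma mcoeff_frob0 m i f : ~~ (p %| m i)%N -> (f ^+ p)@_m = 0.
Proof.
move=> p'mi; rewrite {1}(mpolyE f) (frob_sum p_prime) raddf_sum /= big1 // => k _.
rewrite frobZ // mcoeffZ mcoeffXn; case: eqP => [eq_m|_]; last by rewrite mulr0.
by move: p'mi; rewrite -eq_m mulmnE dvdn_mull.
Qed.

Lemma frobK : cancel (fun f => f ^+ p) (@proot p n).
Proof. by move=> f; apply/mpolyP=> m; rewrite mcoeff_proot mcoeff_frob. Qed.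

(** A monomial killed by all the derivations has exponents divisible by p. *)
Lemma proot_constK f : (forall i, f^`M(i) = 0) -> proot f ^+ p = f.
Proof.
move=> df0; apply/mpolyP=> m.
case: (boolP [forall i, p %| m i]%N) => [/forallP p_m | /forallPn[i p'mi]].
  have eq_m : m = ([multinom m i %/ p | i < n] *+ p)%MM.
    by apply/mnmP=> i; rewrite mulmnE mnmE divnK.
  by rewrite eq_m mcoeff_frob mcoeff_proot.
rewrite (mcoeff_frob0 _ p'mi); symmetry.
have mi_gt0 : m i != 0%N by apply: contraNneq p'mi => ->; rewrite dvdn0.
have := congr1 (mcoeff (m - U_(i))%MM) (df0 i).
rewrite mcoeff_deriv submK ?lep1mP // mcoeff0 mnmBE mnm1E eqxx subn1 prednK ?lt0n //.
rewrite -mulr_natr => /eqP; rewrite mulf_eq0 => /orP[/eqP //|].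
by rewrite -(dvdn_pcharf (pchar_Fp p_prime)) (negbTE p'mi).
Qed.

Lemma proot_homog d f : f \is (d * p).-homog -> proot f \is d.-homog.
Proof.
move/dhomogP=> f_hom; apply/dhomogP=> m; rewrite mcoeff_msupp mcoeff_proot -mcoeff_msupp.
by move/f_hom => /= /eqP; rewrite mdegMn eqn_pmul2r // => /eqP.
Qed.

Lemma mderiv_homog d i f : f \is d.+1.-homog -> f^`M(i) \is d.-homog.
Proof.
move/dhomogP=> f_hom; apply/dhomogP=> m; rewrite mcoeff_msupp mcoeff_deriv => fm.
have /f_hom : (m + U_(i))%MM \in msupp f.
  by rewrite mcoeff_msupp; apply: contraNneq fm => ->; rewrite mul0rn.
by rewrite /= mdegD mdeg1 addn1 => -[].
Qed.

Lemma euler d f : f \is d.-homog -> \sum_i 'X_i * f^`M(i) = d%:R *: f.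
Proof.
move=> /dhomogP f_hom; apply/mpolyP=> m; rewrite raddf_sum mcoeffZ /=.
transitivity (\sum_i f@_m *+ m i).
  apply: eq_bigr => i _; rewrite mulrC; have [mi0|mi0] := posnP (m i); last first.
    have le_im : (U_(i) <= m)%MM by rewrite lep1mP -lt0n.
    have eq_m : m = (U_(i) + (m - U_(i)))%MM by rewrite addmC submK.
    rewrite [in LHS]eq_m mcoeffMX mcoeff_deriv submK //.
    by rewrite mnmBE mnm1E eqxx subn1 prednK.
  rewrite mi0 mulr0n; apply: memN_msupp_eq0; rewrite (perm_mem (msuppMX _ _)).
  by apply/mapP=> -[m' _ eq_m]; move: mi0; rewrite eq_m mnmDE mnm1E eqxx.
have [->|fm] := eqVneq f@_m 0.
  by rewrite mulr0 big1 // => i _; rewrite mul0rn.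
rewrite sumrMnr -mdegE mulr_natl (_ : mdeg m = d) //.
by apply: f_hom; rewrite mcoeff_msupp.
Qed.

Lemma mderiv_XfrobM i l f : ('X_i * f ^+ p)^`M(l) = (i == l)%:R * f ^+ p.
Proof. by rewrite mderivM mderivX1 mderiv_frob // mulr0 addr0. Qed.

(** Morphisms of unstable modules from the polynomial algebra to itself. *)
Definition umap (psi : S -> S) : Prop :=
  [/\ linear psi,
      forall d f, f \is d.-homog -> psi f \is d.-homog
    & forall j f, psi (rpow j f) = rpow j (psi f)].

Section Umap.
Variables (psi : S -> S) (psiU : umap psi).

Lemma umapD f g : psi (f + g) = psi f + psi g.
Proof. by case: psiU => L _ _; exact: (linD L). Qed.
Lemma umapB f g : psi (f - g) = psi f - psi g.
Proof. by case: psiU => L _ _; exact: (linB L). Qed.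
Lemma umap0 : psi 0 = 0.
Proof. by case: psiU => L _ _; exact: (lin0 L). Qed.
Lemma umapZ c f : psi (c *: f) = c *: psi f.
Proof. by case: psiU => L _ _; exact: (linZ L). Qed.
Lemma umap_sum (I : Type) (r : seq I) (Q : pred I) (F : I -> S) :
  psi (\sum_(i <- r | Q i) F i) = \sum_(i <- r | Q i) psi (F i).
Proof. by case: psiU => L _ _; exact: (lin_sum L). Qed.
Lemma umap_homog d f : f \is d.-homog -> psi f \is d.-homog.
Proof. by case: psiU => _ H _; exact: H. Qed.
Lemma umap_rpow j f : psi (rpow j f) = rpow j (psi f).
Proof. by case: psiU => _ _ H; exact: H. Qed.

(** The Frobenius is the top operation in each degree. *)
Lemma umap_frob f : psi (f ^+ p) = psi f ^+ p.
Proof.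
rewrite (pihomog_partitionE (leqnn (msize f))) (frob_sum p_prime) !umap_sum.
rewrite (frob_sum p_prime); apply: eq_bigr => d _.
have hom := pihomogP mdeg d f; rewrite -(rpow_top p_prime hom) umap_rpow.
by rewrite (rpow_top p_prime (umap_homog hom)).
Qed.

Lemma umap_dpow j f : psi (dpow j.+1 f) = dpow j.+1 (psi f).
Proof.
elim: j f => [|j IHj] f; first by rewrite -!rpow1 umap_rpow.
by rewrite !(dpowS p_prime) umapB IHj !umap_rpow IHj.
Qed.

End Umap.

End FrobeniusRoot.

(** The restriction along the linear map with matrix A, contravariant in A as for
  cohomology. *)
HB.lock Definition pull (p k n : nat) (A : 'M['F_p]_(k, n)) (f : {mpoly 'F_p[k]}) :
    {mpoly 'F_p[n]} :=
  f \mPo [tuple \sum_j A i j *: 'X_j | i < k].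

Section Pull.
Variables (p : nat).

Section OnePull.
Variables (k n : nat) (A : 'M['F_p]_(k, n)).

Fact pull_is_zmod_morphism : zmod_morphism (@pull p k n A).
Proof. by move=> f g; rewrite pull.unlock rmorphB. Qed.
Fact pull_is_monoid_morphism : monoid_morphism (@pull p k n A).
Proof. by rewrite pull.unlock; split=> [|f g]; rewrite ?rmorph1 ?rmorphM. Qed.
HB.instance Definition _ :=
  GRing.isZmodMorphism.Build {mpoly 'F_p[k]} {mpoly 'F_p[n]} (@pull p k n A)
    pull_is_zmod_morphism.
HB.instance Definition _ :=
  GRing.isMonoidMorphism.Build {mpoly 'F_p[k]} {mpoly 'F_p[n]} (@pull p k n A)
    pull_is_monoid_morphism.

Lemma pullE f : pull A f = f \mPo [tuple \sum_j A i j *: 'X_j | i < k].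
Proof. by rewrite pull.unlock. Qed.

Lemma pullXi i : pull A 'X_i = \sum_j A i j *: 'X_j.
Proof. by rewrite pull.unlock comp_mpolyXU -tnth_nth tnth_mktuple. Qed.

Lemma pullC c : pull A c%:MP = c%:MP.
Proof. by rewrite pull.unlock comp_mpolyC. Qed.

Lemma pullD f g : pull A (f + g) = pull A f + pull A g. Proof. exact: rmorphD. Qed.
Lemma pullM f g : pull A (f * g) = pull A f * pull A g. Proof. exact: rmorphM. Qed.
Lemma pull0 : pull A 0 = 0. Proof. exact: rmorph0. Qed.
Lemma pull1 : pull A 1 = 1. Proof. exact: rmorph1. Qed.
Lemma pullX f j : pull A (f ^+ j) = pull A f ^+ j. Proof. exact: rmorphXn. Qed.
Lemma pullZ c f : pull A (c *: f) = c *: pull A f.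
Proof. by rewrite -!mul_mpolyC pullM pullC. Qed.
Lemma pull_sum (I : Type) (r : seq I) (Q : pred I) (F : I -> {mpoly 'F_p[k]}) :
  pull A (\sum_(i <- r | Q i) F i) = \sum_(i <- r | Q i) pull A (F i).
Proof. exact: raddf_sum. Qed.

Lemma pull_homog d f : f \is d.-homog -> pull A f \is d.-homog.
Proof.
move=> f_hom; rewrite (mpolyE f) pull_sum rpred_sum // => m _; rewrite pullZ.
have [->|fm] := eqVneq f@_m 0; first by rewrite scale0r rpred0.
apply: rpredZ; rewrite -mcoeff_msupp in fm.
have {fm f_hom d} <- : mdeg m = d := dhomogP _ _ _ f_hom _ fm.
elim/monomial_ind: m => [|i m IHm].
  by rewrite mdeg0 mpolyX0 pull1; exact: dhomog1.
rewrite mpolyXD pullM mdegD; apply: dhomogM => //; rewrite mdeg1 pullXi rpred_sum // => j _.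
by apply: rpredZ; rewrite dhomogX /= mdeg1.
Qed.

Lemma pull_rpow (p_prime : prime p) j f : pull A (rpow j f) = rpow j (pull A f).
Proof.
have rpowA i j' g : rpow j'.+1 (pull A 'X_i * g)
    = pull A 'X_i * rpow j'.+1 g + pull A 'X_i ^+ p * rpow j' g.
  rewrite pullXi mulr_suml (raddf_sum (rpow _)) (frob_sum p_prime) !mulr_suml -big_split.
  apply: eq_bigr => l _ /=; rewrite -scalerAl linearZZ /= rpowXM frobZ // scalerDr.
  by rewrite -!scalerAl.
elim/mpoly_alg_ind: f j => [c|f g Hf Hg|i f Hf] j.
- by case: j => [|j]; rewrite ?rpow0 // pullC !rpowSC pull0.
- have rpowD q u v : rpow j (u + v) = rpow j u + rpow j v :> {mpoly 'F_p[q]} by exact: raddfD.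
  by rewrite rpowD !pullD rpowD Hf Hg.
case: j => [|j]; first by rewrite !rpow0.
by rewrite rpowXM pullD !pullM pullX !Hf rpowA.
Qed.

End OnePull.

Lemma pull_comp (p_prime : prime p) k l n (A : 'M['F_p]_(k, l)) (B : 'M['F_p]_(l, n)) f :
  pull B (pull A f) = pull (A *m B) f.
Proof.
rewrite -[LHS]/((@pull p l n B \o @pull p k l A) f); apply: rmorph_mpoly_ext => // i /=.
rewrite !pullXi pull_sum.
under eq_bigr => j _ do rewrite pullZ pullXi scaler_sumr.
rewrite exchange_big /=; apply: eq_bigr => j _; rewrite mxE scaler_suml.
by apply: eq_bigr => h _; rewrite scalerA.
Qed.

Lemma pull_id (p_prime : prime p) n f : pull (1%:M : 'M['F_p]_n) f = f.
Proof.
rewrite -[RHS]/(idfun f); apply: rmorph_mpoly_ext => // i /=.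
rewrite pullXi (bigD1 i) //= mxE eqxx scale1r big1 ?addr0 // => j neq_ji.
by rewrite mxE eq_sym (negbTE neq_ji) scale0r.
Qed.

End Pull.

Section PowerSums.
Variables (p : nat) (p_prime : prime p).

Lemma power_sum_Fp j : (j < p)%N ->
  \sum_(a : 'F_p) a ^+ j = - (j == p.-1)%:R.
Proof.
move=> lt_jp; have p_gt1 := prime_gt1 p_prime; case: eqP => [->|/eqP neq_j].
  rewrite (bigD1 0) //= expr0n -[(p.-1 == 0)%N]negbK -lt0n -ltnS prednK ?(ltnW p_gt1) //.
  rewrite p_gt1 add0r (eq_bigr (fun=> 1)) => [|a a_neq0].
    rewrite sumr_const cardC1 card_Fp //; apply/eqP; rewrite mulr1n -addr_eq0.
    by rewrite -mulrSr prednK ?(ltnW p_gt1) // (pcharf0 (pchar_Fp p_prime)).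
  apply: (mulfI a_neq0); rewrite -exprS prednK ?(ltnW p_gt1) // expf_p // mulr1.
  by [].
rewrite oppr0.
have {lt_jp neq_j}: (j < p.-1)%N by rewrite ltn_neqAle neq_j -ltnS prednK // ltnW.
have [-> _|j_gt0 lt_j] := posnP j.
  under eq_bigr do rewrite expr0.
  by rewrite sumr_const card_Fp // (pcharf0 (pchar_Fp p_prime)).
have [b b_neq0 bj] : exists2 b : 'F_p, b != 0 & b ^+ j != 1.
  apply/exists_inP; apply: contraLR lt_j; rewrite -leqNgt negb_exists_in => /forall_inP all1.
  have root_all : all (root ('X^j - 1)) (enum [pred a : 'F_p | a != 0]).
    apply/allP=> a; rewrite mem_enum inE => /all1; rewrite negbK => /eqP aj.
    by rewrite rootE !hornerE aj subrr.
  have nz : 'X^j - 1 != 0 :> {poly 'F_p} by rewrite -size_poly_eq0 size_XnsubC.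
  have := max_poly_roots nz root_all (enum_uniq _).
  by rewrite size_XnsubC // -cardE cardC1 card_Fp.
apply/eqP; have /eqP: b ^+ j * \sum_(a : 'F_p) a ^+ j = \sum_(a : 'F_p) a ^+ j.
  rewrite mulr_sumr [RHS](reindex_inj (mulfI b_neq0)); apply: eq_bigr => a _.
  by rewrite exprMn.
rewrite -[X in _ == X]mul1r -subr_eq0 -mulrBl mulf_eq0 subr_eq0 (negbTE bj).
by [].
Qed.

End PowerSums.

(** The component psi_(c, l) of psi in the expansion psi ('X_c g) = sum_l 'X_l psi_(c, l) (g)
  of umap_X.  It is read off on p-th powers, where a derivative isolates it. *)
HB.lock Definition ucomp (p n : nat) (c l : 'I_n)
    (psi : {mpoly 'F_p[n]} -> {mpoly 'F_p[n]}) (g : {mpoly 'F_p[n]}) : {mpoly 'F_p[n]} :=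
  proot (psi ('X_c * g ^+ p))^`M(l).

Section Components.
Variables (p : nat) (p_prime : prime p) (n : nat).
Local Notation S := {mpoly 'F_p[n]}.
Implicit Types (f g h : S) (c e i k l : 'I_n) (j d : nat) (psi : S -> S).

Let p_gt0 : (0 < p)%N := prime_gt0 p_prime.

(** The derivative with respect to y_l isolates the l-th summand, as p-th powers
  are constants of derivation. *)
Lemma frob_root_indep (w v : 'I_n -> S) :
  \sum_l 'X_l * w l ^+ p = \sum_l 'X_l * v l ^+ p -> w =1 v.
Proof.
have root_sum (u : 'I_n -> S) l : proot (\sum_k 'X_k * u k ^+ p)^`M(l) = u l.
  rewrite (raddf_sum (mderiv l)) /= (bigD1 l) //= big1 => [|k neq_kl].
    by rewrite mderiv_XfrobM // eqxx mul1r addr0 frobK.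
  by rewrite mderiv_XfrobM // (negbTE neq_kl) mul0r.
by move=> eq_wv l; rewrite -(root_sum w) eq_wv root_sum.
Qed.

Lemma indep_pow (w : 'I_n -> S) :
  (forall j, \sum_i 'X_i ^+ (p ^ j.+1) * w i = 0) -> forall i, w i = 0.
Proof.
move=> sum0; pose N := (\max_i msize (w i))%N.
suff le_w i : (msize (w i) <= p ^ N.+1)%N by exact: (dpow_indep le_w (sum0 N)).
have le_wN : (msize (w i) <= N)%N by exact: (leq_bigmax (F := fun i => msize (w i))).
apply: leq_trans le_wN _; apply: leq_trans (leqnSn _) (ltnW _).
exact: ltn_expl (prime_gt1 p_prime).
Qed.

Lemma dpow_const f : (forall j, dpow j.+1 f = 0) -> forall i, f^`M(i) = 0.
Proof. by move=> df0; apply: indep_pow => j; rewrite -dpowE df0. Qed.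

Lemma dpow_Xfrob j c g : dpow j.+1 ('X_c * g ^+ p) = ('X_c ^+ (p ^ j) * g) ^+ p.
Proof. by rewrite dpowXM dpow_frob // mulr0 addr0 exprMn -exprM -expnSr. Qed.

(** The primitives commute with psi and two of them annihilate 'X_c g ^ p.  Their
  values determine the partial derivatives by dpow_indep. *)
Lemma umap_mderiv2 psi c g i l :
  umap psi -> ((psi ('X_c * g ^+ p))^`M(l))^`M(i) = 0.
Proof.
move=> psiU; move: l; apply: indep_pow => j; set z := psi _.
transitivity ((dpow j.+1 z)^`M(i)).
  rewrite dpowE (raddf_sum (mderiv i)); apply: eq_bigr => l _ /=.
  by rewrite expnSr exprM mderiv_frobM.
apply: dpow_const => j'.
by rewrite -!(umap_dpow p_prime psiU) dpow_Xfrob dpow_frob // (umap0 psiU).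
Qed.

Section OneMap.
Variables (psi : S -> S) (psiU : umap psi).

Lemma ucomp_frob c l g : ucomp c l psi g ^+ p = (psi ('X_c * g ^+ p))^`M(l).
Proof. by rewrite unlock proot_constK // => i; apply: umap_mderiv2. Qed.

Lemma ucomp_linear c l : linear (ucomp c l psi).
Proof.
move=> a f g; apply: (frob_inj p_prime); rewrite frobD // frobZ // !ucomp_frob.
rewrite frobD // frobZ // mulrDr -scalerAr (umapD psiU) (umapZ psiU).
by rewrite mderivD mderivZ.
Qed.

(** Euler's formula in a degree congruent to 1 modulo p. *)
Lemma umap_Xfrob c g : psi ('X_c * g ^+ p) = \sum_l 'X_l * ucomp c l psi g ^+ p.
Proof.
under eq_bigr => l _ do rewrite ucomp_frob.
have key d f : f \is d.-homog ->
    psi ('X_c * f ^+ p) = \sum_l 'X_l * (psi ('X_c * f ^+ p))^`M(l).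
  move=> f_hom; have Xf_hom : 'X_c * f ^+ p \is (1 + d * p).-homog.
    by apply: dhomogM (dhomogMn _ f_hom); rewrite dhomogX /= mdeg1.
  rewrite (euler (umap_homog psiU Xf_hom)) natrD natrM.
  by rewrite (pcharf0 (pchar_Fp p_prime)) mulr0 addr0 scale1r.
rewrite (pihomog_partitionE (leqnn (msize g))) (frob_sum p_prime) mulr_sumr.
rewrite (umap_sum psiU); under [LHS]eq_bigr => d _ do rewrite (key _ _ (pihomogP mdeg d g)).
rewrite exchange_big /=; apply: eq_bigr => l _.
by rewrite -mulr_sumr (raddf_sum (mderiv l)).
Qed.

(** The primitive y |-> y ^ p sends 'X_c g ^ p to ('X_c g) ^ p, which transfers the
  expansion from p-th powers to all polynomials. *)
Lemma umap_X c g : psi ('X_c * g) = \sum_l 'X_l * ucomp c l psi g.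
Proof.
apply: (frob_inj p_prime); rewrite -(umap_frob p_prime psiU).
have := dpow_Xfrob 0 c g; rewrite expn0 expr1 => <-.
rewrite (umap_dpow p_prime psiU) umap_Xfrob (frob_sum p_prime) (raddf_sum (dpow 1)).
by apply: eq_bigr => l _ /=; rewrite dpow_Xfrob expn0 expr1.
Qed.

Lemma rpow_Xfrob j c g : rpow (j * p) ('X_c * g ^+ p) = 'X_c * rpow j g ^+ p.
Proof.
case: j => [|j]; first by rewrite mul0n !rpow0.
have eq_jp : (j.+1 * p = (j * p + p.-1).+1)%N by rewrite mulSn; lia.
rewrite {1}eq_jp rpowXM -eq_jp !rpow_frob // dvdn_mull // mulnK // dvdn_addr ?dvdn_mull //.
have [p1 | p_gt1] := leqP p.-1 0; last by rewrite gtnNdvd ?mulr0 ?addr0 // prednK.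
by have := prime_gt1 p_prime; lia.
Qed.

(** The operation P^(jp) acts on 'X_c g ^ p as P^j acts on g. *)
Lemma ucomp_umap c l : umap (ucomp c l psi).
Proof.
split; first exact: ucomp_linear.
  move=> d f f_hom; rewrite unlock; apply: proot_homog => //.
  apply: mderiv_homog; apply: (umap_homog psiU).
  have: 'X_c * f ^+ p \is (1 + d * p).-homog; last by rewrite add1n.
  by apply: dhomogM (dhomogMn _ f_hom); rewrite dhomogX /= mdeg1.
move=> j f; move: l.
apply: (@frob_root_indep (fun l => ucomp c l psi (rpow j f))
                         (fun l => rpow j (ucomp c l psi f))).
rewrite -[LHS](umap_Xfrob c (rpow j f)) -rpow_Xfrob.
rewrite (umap_rpow psiU) (umap_Xfrob c f) (raddf_sum (rpow _)); apply: eq_bigr => l _ /=.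
exact: rpow_Xfrob.
Qed.

End OneMap.

(** The primitive y |-> y ^ (p ^ 2) turns 'X_e ('X_c f ^ p) ^ p into ('X_c ('X_e f) ^ p) ^ p,
  which exchanges the roles of the two variables. *)
Lemma ucompC psi c e i k : umap psi ->
  ucomp c i (ucomp e k psi) =1 ucomp e k (ucomp c i psi).
Proof.
move=> psiU g.
have U c' i' := ucomp_umap psiU c' i'.
suff H f : \sum_l 'X_l * ucomp c l (ucomp e k psi) f
         = \sum_l 'X_l * ucomp e k (ucomp c l psi) f.
  move: i; apply: (@frob_root_indep (fun l => ucomp c l (ucomp e k psi) g)
                                    (fun l => ucomp e k (ucomp c l psi) g)).
  have := H (g ^+ p).
  under eq_bigr => l _ do rewrite (umap_frob p_prime (ucomp_umap (U _ _) _ _)).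
  by under [RHS]eq_bigr => l _ do rewrite (umap_frob p_prime (ucomp_umap (U _ _) _ _)).
rewrite -(umap_X (U _ _)); move: k.
apply: (@frob_root_indep (fun k => ucomp e k psi ('X_c * f))
                         (fun k => \sum_l 'X_l * ucomp e k (ucomp c l psi) f)).
rewrite -[LHS](umap_Xfrob psiU e ('X_c * f)).
apply: (frob_inj p_prime); rewrite -(umap_frob p_prime psiU).
have := dpow_Xfrob 1 c ('X_e * f ^+ p); rewrite expn1 mulrCA -exprMn => <-.
rewrite (umap_dpow p_prime psiU) umap_Xfrob // (raddf_sum (dpow 2)) (frob_sum p_prime) /=.
under eq_bigr => l _ do rewrite dpow_Xfrob expn1 (umap_Xfrob (U _ _)) mulr_sumr (frob_sum p_prime).
rewrite exchange_big; apply: eq_bigr => k _ /=; rewrite -(frob_sum p_prime).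
congr (_ ^+ p); rewrite (frob_sum p_prime) mulr_sumr; apply: eq_bigr => l _.
by rewrite mulrCA -exprMn.
Qed.

End Components.

Section Classification.
Variables (p : nat) (p_prime : prime p) (n : nat).
Local Notation S := {mpoly 'F_p[n]}.
Implicit Types (f g h : S) (c e i k l : 'I_n) (j d : nat) (psi chi : S -> S) (a b : 'F_p).

Let p_gt0 : (0 < p)%N := prime_gt0 p_prime.

Lemma eq_ucomp c l psi chi : psi =1 chi -> ucomp c l psi =1 ucomp c l chi.
Proof. by move=> eq_pc g; rewrite unlock eq_pc. Qed.

Lemma ucompZ c l a psi g : ucomp c l (fun h => a *: psi h) g = a *: ucomp c l psi g.
Proof. by rewrite unlock mderivZ (linearZZ (@proot p n)). Qed.

Lemma ucompB c l psi chi g :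
  ucomp c l (fun h => psi h - chi h) g = ucomp c l psi g - ucomp c l chi g.
Proof. by rewrite unlock mderivB (raddfB (@proot p n)). Qed.

Lemma ucomp_sum c l (I : Type) (r : seq I) (Q : pred I) (F : I -> S -> S) g :
  ucomp c l (fun h => \sum_(i <- r | Q i) F i h) g = \sum_(i <- r | Q i) ucomp c l (F i) g.
Proof. by rewrite unlock (raddf_sum (mderiv l)) (raddf_sum (@proot p n)). Qed.

Lemma umapBf psi chi : umap psi -> umap chi -> umap (fun h => psi h - chi h).
Proof.
move=> psiU chiU; split=> [a f g|d f f_hom|j f].
- by rewrite !(umapD psiU, umapD chiU, umapZ psiU, umapZ chiU) scalerBr addrACA opprD.
- by rewrite rpredB // (umap_homog psiU, umap_homog chiU).
- by rewrite (umap_rpow psiU) (umap_rpow chiU) (raddfB (rpow j)).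
Qed.

Lemma umapZf a psi : umap psi -> umap (fun h => a *: psi h).
Proof.
move=> psiU; split=> [b f g|d f f_hom|j f].
- by rewrite (umapD psiU) (umapZ psiU) scalerDr !scalerA mulrC.
- by rewrite rpredZ // (umap_homog psiU).
- by rewrite (umap_rpow psiU) (linearZZ (@rpow p n j)).
Qed.

Lemma umap_sumf (I : Type) (r : seq I) (Q : pred I) (F : I -> S -> S) :
  (forall x, umap (F x)) -> umap (fun h => \sum_(i <- r | Q i) F i h).
Proof.
move=> FU; split=> [b f g|d f f_hom|j f].
- rewrite scaler_sumr -big_split; apply: eq_bigr => x _ /=.
  by rewrite (umapD (FU x)) (umapZ (FU x)).
- by apply: rpred_sum => x _; apply: (umap_homog (FU x)).
- rewrite (raddf_sum (@rpow p n j)); apply: eq_bigr => x _ /=.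
  by rewrite (umap_rpow (FU x)).
Qed.

Lemma iter_ucomp_umap c i j psi : umap psi -> umap (iter j (ucomp c i) psi).
Proof. by move=> psiU; elim: j => //= j IHj; apply: ucomp_umap. Qed.

Lemma ucomp_iterC c i e k j psi : umap psi ->
  ucomp e k (iter j (ucomp c i) psi) =1 iter j (ucomp c i) (ucomp e k psi).
Proof.
move=> psiU; elim: j => //= j IHj g; rewrite ucompC //; last exact: iter_ucomp_umap.
exact: eq_ucomp.
Qed.

Definition uword (w : seq ('I_n * 'I_n)) psi := foldr (fun ci => ucomp ci.1 ci.2) psi w.

(** By umap_X, the values of psi are computed from the scalars that its iterated
  components take at 1. *)
Lemma umap_eq0 psi : umap psi -> (forall w, uword w psi 1 = 0) -> forall f, psi f = 0.
Proof.
move=> + + f; elim/mpoly_alg_ind: f psi => [c|f g Hf Hg|c f Hf] psi psiU psi0.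
- rewrite -[c%:MP]mulr1 mul_mpolyC (umapZ psiU).
  by have /= -> := psi0 [::]; rewrite scaler0.
- by rewrite (umapD psiU) Hf // Hg // addr0.
rewrite umap_X // big1 // => l _; rewrite Hf ?mulr0 //; first exact: ucomp_umap.
by move=> w; have := psi0 (w ++ [:: (c, l)]); rewrite /uword foldr_cat.
Qed.

Lemma umap1 psi : umap psi -> psi 1 = ((psi 1)@_0%MM)%:MP.
Proof.
move=> psiU; have /dhomogP hom1 := umap_homog psiU (dhomog1 'F_p (@mdeg n)).
apply/mpolyP=> m; rewrite mcoeffC; have [->|m_neq0] := eqVneq; first by rewrite mulr1.
rewrite mulr0; apply: memN_msupp_eq0; apply: contra m_neq0 => /hom1 /= /eqP.
by rewrite mdeg_eq0.
Qed.

(** The projection to the i-th axis, where only the components of index i survive. *)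
Definition axis i : 'M['F_p]_n := delta_mx i i.

Lemma pull_axis i l : pull (axis i) 'X_l = (l == i)%:R * 'X_i :> S.
Proof.
rewrite pullXi (bigD1 i) //= mxE eqxx andbT big1 ?addr0 => [|j neq_ji].
  by case: eqP => _; rewrite ?scale1r ?mul1r // scale0r mul0r.
by rewrite mxE (negbTE neq_ji) andbF scale0r.
Qed.

Lemma pull_axis_ucomp c i j psi g : umap psi ->
  pull (axis i) (psi ('X_c ^+ j * g))
  = 'X_i ^+ j * pull (axis i) (iter j (ucomp c i) psi g).
Proof.
elim: j psi g => [|j IHj] psi g psiU; first by rewrite !mul1r.
rewrite exprS -mulrA umap_X // pull_sum (bigD1 i) //= big1 => [|l neq_li].
  rewrite addr0 pullM pull_axis eqxx mul1r IHj; last exact: ucomp_umap.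
  by rewrite -iterSr exprS mulrA.
by rewrite pullM pull_axis (negbTE neq_li) !mul0r.
Qed.

(** On an axis, psi ('X_c ^ p) = psi ('X_c) ^ p says that the scalar of the p-th iterate
  at 1 is the p-th power of the scalar of the component, and scalars are fixed by the
  Frobenius; umap_eq0 extends the equality from 1 to all polynomials. *)
Lemma ucomp_iter_p c i psi : umap psi -> iter p (ucomp c i) psi =1 ucomp c i psi.
Proof.
have at1 chi : umap chi -> iter p (ucomp c i) chi 1 = ucomp c i chi 1.
  move=> chiU.
  have := pull_axis_ucomp c i p 1 chiU; have := pull_axis_ucomp c i 1 1 chiU.
  rewrite !mulr1 !expr1 (umap_frob p_prime chiU) pullX /= => ->.
  rewrite (umap1 (iter_ucomp_umap c i p chiU)) (umap1 (ucomp_umap p_prime chiU c i)).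
  set u := mcoeff _ (iter _ _ _ _); set v := mcoeff _ (ucomp _ _ _ _).
  rewrite !pullC exprMn -(rmorphXn (@mpolyC n 'F_p)) /= expf_p // => /mulfI -> //.
  by rewrite expf_neq0 // -msize_poly_eq0 msizeX.
move=> psiU g; apply/eqP; rewrite -subr_eq0; apply/eqP.
apply: (umap_eq0 (psi := fun h => iter p (ucomp c i) psi h - ucomp c i psi h)).
  by apply: umapBf; [apply: iter_ucomp_umap | apply: ucomp_umap].
move=> w; suff: forall h, uword w (fun h => iter p (ucomp c i) psi h - ucomp c i psi h) h
    = iter p (ucomp c i) (uword w psi) h - ucomp c i (uword w psi) h.
  by move->; rewrite at1 ?subrr //; elim: w => //= ck w IHw; apply: ucomp_umap.
elim: w => //= -[e k] w IHw h /=; rewrite (eq_ucomp e k IHw) ucompB.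
have wU : umap (uword w psi) by elim: w {IHw} => //= ck w IHw; apply: ucomp_umap.
by rewrite ucomp_iterC // ucompC.
Qed.

(** For an operator X with X ^ p = X this is 1 - (X - a) ^ (p - 1), the projection on the
  eigenspace of a. *)
Definition eproj a c i psi g : S :=
  psi g - \sum_(j < p) a ^+ (p.-1 - j) *: iter j (ucomp c i) psi g.

Lemma eproj_umap a c i psi : umap psi -> umap (eproj a c i psi).
Proof.
move=> psiU; apply: umapBf => //; apply: umap_sumf => j; apply: umapZf.
exact: iter_ucomp_umap.
Qed.

Lemma eproj_sum c i psi g : psi g = \sum_a eproj a c i psi g.
Proof.
rewrite sumrB sumr_const card_Fp // -scaler_nat (pcharf0 (pchar_Fp p_prime)) scale0r.
rewrite exchange_big add0r /=.
under eq_bigr => j _ do rewrite -scaler_suml.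
have lt_p1 : (p.-1 < p)%N by rewrite prednK.
rewrite (bigD1 (Ordinal p_gt0)) //= subn0 (power_sum_Fp _ lt_p1) // eqxx scaleN1r.
rewrite big1 ?addr0 ?opprK // => j neq_j0.
have j_gt0 : (0 < j)%N.
  by rewrite lt0n; apply: contra neq_j0 => /eqP j0; apply/eqP/val_inj.
have lt_jp := ltn_ord j.
rewrite (power_sum_Fp p_prime); last by lia.
by case: eqP => [eq_j|_]; [lia | rewrite oppr0 scale0r].
Qed.

Lemma ucomp_eproj_comm a c i e k psi : umap psi ->
  ucomp e k (eproj a c i psi) =1 eproj a c i (ucomp e k psi).
Proof.
move=> psiU g; rewrite /eproj ucompB ucomp_sum; congr (_ - _); apply: eq_bigr => j _.
by rewrite ucompZ ucomp_iterC.
Qed.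

Lemma eq_eproj a c i psi chi : psi =1 chi -> eproj a c i psi =1 eproj a c i chi.
Proof.
move=> eq_pc g; rewrite /eproj eq_pc; congr (_ - _); apply: eq_bigr => j _.
congr (_ *: _); move: g; elim: (nat_of_ord j) => //= j' IHj.
exact: eq_ucomp.
Qed.

Lemma eprojZ a b c i psi g : eproj a c i (fun h => b *: psi h) g = b *: eproj a c i psi g.
Proof.
rewrite /eproj scalerBr scaler_sumr; congr (_ - _); apply: eq_bigr => j _.
rewrite [RHS]scalerA mulrC -scalerA; congr (_ *: _); move: g; elim: (nat_of_ord j) => //= j' IHj g.
by rewrite -ucompZ; apply: eq_ucomp.
Qed.

Lemma ucomp_eproj a c i psi : umap psi ->
  ucomp c i (eproj a c i psi) =1 (fun h => a *: eproj a c i psi h).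
Proof.
move=> psiU g; rewrite /eproj ucompB ucomp_sum scalerBr scaler_sumr.
pose F j := a ^+ (p - j) *: iter j (ucomp c i) psi g.
have eq1 : \sum_(j < p) ucomp c i (fun h => a ^+ (p.-1 - j) *: iter j (ucomp c i) psi h) g
         = \sum_(j < p) F j.+1.
  apply: eq_bigr => j _; rewrite ucompZ /F -iterS; congr (_ ^+ _ *: _).
  by rewrite subnS predn_sub.
have eq2 : \sum_(j < p) a *: (a ^+ (p.-1 - j) *: iter j (ucomp c i) psi g) = \sum_(j < p) F j.
  apply: eq_bigr => j _; rewrite scalerA -exprS /F; congr (_ ^+ _ *: _).
  by have := ltn_ord j; lia.
have eq3 : \sum_(j < p) F j.+1 - \sum_(j < p) F j = ucomp c i psi g - a *: psi g.
  rewrite -sumrB -(big_mkord xpredT (fun j => F j.+1 - F j)) telescope_sumr // /F subnn subn0.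
  by rewrite expr0 scale1r ucomp_iter_p // expf_p.
have -> : \sum_(j < p) ucomp c i (fun h => a ^+ (p.-1 - j) *: iter j (ucomp c i) psi h) g
        = ucomp c i psi g - a *: psi g + \sum_(j < p) F j by rewrite eq1 -eq3 subrK.
by rewrite eq2 opprD addrA opprB [X in X - _]addrC subrK.
Qed.

Definition pullspan psi := exists s : 'M['F_p]_n -> 'F_p,
  forall f, psi f = \sum_A s A *: pull A f.

(** When every component is a multiple of psi, with factors the entries of A, the
  expansion of umap_X says that psi is multiplicative up to the scalar psi 1. *)
Lemma pullspan_eigen psi : umap psi ->
  (forall c i, exists a, ucomp c i psi =1 fun h => a *: psi h) -> pullspan psi.
Proof.
move=> psiU eig.
have [F eigF] := fin_all_exists (fun ci : 'I_n * 'I_n => eig ci.1 ci.2).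
pose A : 'M['F_p]_n := \matrix_(c, i) F (c, i).
have eigA c i : ucomp c i psi =1 fun h => A c i *: psi h.
  by move=> h; rewrite mxE; apply: (eigF (c, i)).
have eq_psi f : psi f = (psi 1)@_0%MM *: pull A f.
  elim/mpoly_alg_ind: f => [c|f g Hf Hg|c f Hf].
  - by rewrite -[c%:MP]mulr1 mul_mpolyC (umapZ psiU) {1}(umap1 psiU) pullZ pull1
               scalerA mulrC -scalerA alg_mpolyC.
  - by rewrite (umapD psiU) Hf Hg pullD scalerDr.
  rewrite umap_X // pullM pullXi mulr_suml scaler_sumr; apply: eq_bigr => i _.
  by rewrite eigA Hf -!scalerAl -!scalerAr !scalerA mulrC.
exists (fun B => (B == A)%:R * (psi 1)@_0%MM) => f; rewrite eq_psi (bigD1 A) //= eqxx mul1r.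
by rewrite big1 ?addr0 // => B /negbTE ->; rewrite mul0r scale0r.
Qed.

Lemma pullspan_sum (I : finType) (F : I -> S -> S) psi :
  (forall f, psi f = \sum_x F x f) -> (forall x, pullspan (F x)) -> pullspan psi.
Proof.
move=> eq_psi spanF; have [s sE] := fin_all_exists spanF.
exists (fun A => \sum_x s x A) => f; rewrite eq_psi.
under eq_bigr => x _ do rewrite sE.
by rewrite exchange_big; apply: eq_bigr => A _; rewrite scaler_suml.
Qed.

(** The components commute and satisfy X ^ p = X, so psi is a sum of common
  eigenvectors of all the components. *)
Theorem umap_pullspan psi : umap psi -> pullspan psi.
Proof.
move=> psiU.
suff: forall r : seq ('I_n * 'I_n), forall psi, umap psi ->
    (forall ci, ci \notin r -> exists a, ucomp ci.1 ci.2 psi =1 fun h => a *: psi h) ->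
    pullspan psi.
  by move/(_ (enum [set: 'I_n * 'I_n]) psi psiU); apply=> ci; rewrite mem_enum inE.
elim=> [|[c i] r IHr] {}psi {}psiU eig.
  by apply: pullspan_eigen => // c i; apply: (eig (c, i)).
apply: (@pullspan_sum 'F_p (fun a => eproj a c i psi)); first exact: eproj_sum.
move=> a; apply: IHr => [|[e k] ek_r /=]; first exact: eproj_umap.
have [[-> ->]|/eqP neq_ek] := (e, k) =P (c, i); first by exists a; apply: ucomp_eproj.
have [|b eigb] := eig (e, k); first by rewrite inE negb_or neq_ek.
exists b => g; rewrite ucomp_eproj_comm // -eprojZ; exact: eq_eproj.
Qed.

(** Dedekind's independence of characters, with polynomial coefficients. *)
Lemma pull_indep (q : nat) (r : seq 'M['F_p]_(q, n)) (s : 'M['F_p]_(q, n) -> S) : uniq r ->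
  (forall f : {mpoly 'F_p[q]}, \sum_(A <- r) s A * pull A f = 0) -> forall A, A \in r -> s A = 0.
Proof.
elim: r s => //= B r IHr s /andP[Br r_uniq] sum0.
have s0 A : A \in r -> s A = 0.
  move=> Ar; have [c neq_c] : exists c : 'I_q, pull A 'X_c != pull B 'X_c.
    apply/existsP; apply: contraNT Br => /existsPn eqAB; suff <- : A = B by [].
    apply/matrixP=> c j; have /negbNE/eqP/(congr1 (mcoeff U_(j))) := eqAB c.
    rewrite !pullXi !raddf_sum /= (bigD1 j) // [in RHS](bigD1 j) //=.
    have coefU (C : 'M['F_p]_(q, n)) i : (C c i *: 'X_i)@_U_(j) = C c i * (i == j)%:R.
      by rewrite mcoeffZ mcoeffXU.
    rewrite !coefU eqxx !mulr1 !big1 ?addr0 // => i /negbTE neq_ij;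
      by rewrite coefU neq_ij mulr0.
  have /eqP : s A * (pull A 'X_c - pull B 'X_c) = 0.
    apply: (IHr (fun C => s C * (pull C 'X_c - pull B 'X_c)) r_uniq _ A Ar) => f.
    have tailE (g : {mpoly 'F_p[q]}) : \sum_(C <- r) s C * pull C g = - (s B * pull B g).
      by apply/eqP; rewrite -addr_eq0 addrC; have := sum0 g; rewrite big_cons => ->.
    transitivity (\sum_(C <- r) s C * pull C ('X_c * f)
                  - pull B 'X_c * \sum_(C <- r) s C * pull C f).
      by rewrite mulr_sumr -sumrB; apply: eq_bigr => C _; rewrite pullM; ring.
    by rewrite !tailE pullM; ring.
  by rewrite mulf_eq0 subr_eq0 (negbTE neq_c) orbF => /eqP.
move=> A; rewrite inE => /orP[/eqP->|/s0 //].
have := sum0 1; rewrite big_cons pull1 mulr1 big_seq big1 ?addr0 // => C Cr.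
by rewrite s0 // mul0r.
Qed.

End Classification.

(** * The polynomial part of the cohomology *)

(** The image of x_i under spart. *)
Definition sgen (p n : nat) (i : 'I_n) : {mpoly 'F_p[n]} := if p == 2 then 'X_i else 0.
(** The coefficients of an element of the cohomology are polynomials in the classes y_i, and
  y_i = x_i ^ 2 for p = 2. *)
Definition tau (p n : nat) (f : {mpoly 'F_p[n]}) : {mpoly 'F_p[n]} :=
  if p == 2 then f ^+ p else f.
Definition chi (p n : nat) (I : {set 'I_n}) : {mpoly 'F_p[n]} := \prod_(i in I) sgen p i.

(** The ring morphism with x_i |-> 0 for p odd, and the isomorphism x_i |-> 'X_i for p = 2.
  It identifies the cohomology with polynomials up to nilpotent elements. *)
HB.lock Definition spart (p n : nat) (z : HV p n) : {mpoly 'F_p[n]} :=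
  \sum_I chi p I * tau (z I).

Section HVPoly.
Variables (p : nat) (p_prime : prime p).

Let p_gt0 : (0 < p)%N := prime_gt0 p_prime.

Section Tau.
Variable n : nat.
Local Notation S := {mpoly 'F_p[n]}.
Implicit Types (f g : S) (i : 'I_n) (I J K : {set 'I_n}) (u v z : HV p n).

Lemma tauD f g : tau (f + g) = tau f + tau g.
Proof. by rewrite /tau; case: eqP => // _; rewrite frobD. Qed.
Lemma tauZ c f : tau (c *: f) = c *: tau f.
Proof. by rewrite /tau; case: eqP => // _; rewrite frobZ. Qed.
Lemma tauM f g : tau (f * g) = tau f * tau g.
Proof. by rewrite /tau; case: eqP => // _; rewrite exprMn. Qed.
Lemma tau0 : tau (0 : S) = 0.
Proof. by rewrite /tau; case: eqP => // _; rewrite expr0n -[p == 0%N]negbK -lt0n p_gt0. Qed.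
Lemma tau1 : tau (1 : S) = 1.
Proof. by rewrite /tau expr1n if_same. Qed.
Lemma tau_sum (X : Type) (r : seq X) (Q : pred X) (F : X -> S) :
  tau (\sum_(i <- r | Q i) F i) = \sum_(i <- r | Q i) tau (F i).
Proof. exact: (big_morph (@tau p n) tauD tau0). Qed.

Lemma tau_sq i : tau (xsquare p i) = sgen p i ^+ 2 :> S.
Proof.
by rewrite /tau /xsquare /sgen; case: eqP => [->|_]; rewrite ?expr0n.
Qed.

Lemma chi_odd I : p != 2 -> chi p I = (I == set0)%:R.
Proof.
move=> /negbTE p2; rewrite /chi; have [->|/set0Pn[i iI]] := eqVneq; first by rewrite big_set0.
by rewrite (bigD1 i) //= /sgen p2 mul0r.
Qed.

(** For p odd only the empty monomials contribute; for p = 2 signs are trivial and the common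
  generators of I and J give squares. *)
Lemma chiM I J :
  chi p ((I :\: J) :|: (J :\: I)) * tau ((-1) ^+ inversions I J * \prod_(i in I :&: J) xsquare p i)
  = chi p I * chi p J.
Proof.
have [p2|p2] := boolP (p == 2); last first.
  rewrite !chi_odd // /tau (negbTE p2) /xsquare (negbTE p2).
  have [->|] := eqVneq I set0.
    rewrite set0D setD0 set0U set0I big_set0 mulr1 mul1r; case: eqVneq => [->|_].
      rewrite mul1r /inversions (_ : [set _ | _] = set0) ?cards0 //.
      by apply/setP=> ij; rewrite !inE.
    by rewrite mul0r.
  move=> I_neq0; rewrite mul0r; case: eqVneq => [IJ0|_]; last by rewrite mul0r.
  have [i iI] := set0Pn _ I_neq0.
  have iJ : i \in J by have := in_set0 i; rewrite -IJ0 !inE iI; case: (i \in J).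
  by rewrite (bigD1 i) /= ?inE ?iI // mul0r !mulr0.
have neg1 : -1 = 1 :> S.
  apply/eqP; rewrite eq_sym -subr_eq0 opprK -mulr2n.
  by have := pcharf0 (pchar_mpoly p_prime n); rewrite (eqP p2) => ->.
rewrite neg1 expr1n mul1r (big_morph (@tau p n) tauM tau1).
under [X in _ * X]eq_bigr => i _ do rewrite tau_sq.
rewrite /chi big_mkcond [X in _ * X]big_mkcond /= -big_split.
rewrite [X in _ = X * _]big_mkcond [X in _ = _ * X]big_mkcond -big_split /=.
apply: eq_bigr => i _; rewrite !inE.
by case: (i \in I); case: (i \in J); rewrite /= ?mulr1 ?mul1r.
Qed.

Lemma spartE (z : HV p n) : spart z = \sum_I chi p I * tau (z I).
Proof. by rewrite spart.unlock. Qed.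

Lemma spart_linear : linear (@spart p n).
Proof.
move=> c u v; rewrite !spartE scaler_sumr -big_split; apply: eq_bigr => I _ /=.
by rewrite !ffunE tauD tauZ mulrDr scalerAr.
Qed.

Lemma spartD u v : spart (u + v) = spart u + spart v.
Proof. exact: (linD spart_linear). Qed.
Lemma spart0 : spart (0 : HV p n) = 0.
Proof. exact: (lin0 spart_linear). Qed.
Lemma spartZ c u : spart (c *: u) = c *: spart u.
Proof. exact: (linZ spart_linear). Qed.
Lemma spartB u v : spart (u - v) = spart u - spart v.
Proof. exact: (linB spart_linear). Qed.
Lemma spart_sum (X : Type) (r : seq X) (Q : pred X) (F : X -> HV p n) :
  spart (\sum_(i <- r | Q i) F i) = \sum_(i <- r | Q i) spart (F i).
Proof. exact: (lin_sum spart_linear). Qed.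

Lemma spartM u v : spart (hmul u v) = spart u * spart v.
Proof.
rewrite !spartE; transitivity (\sum_K \sum_I \sum_(J | (I :\: J) :|: (J :\: I) == K)
    (chi p I * tau (u I)) * (chi p J * tau (v J))).
  apply: eq_bigr => K _; rewrite ffunE tau_sum mulr_sumr; apply: eq_bigr => I _.
  rewrite tau_sum mulr_sumr; apply: eq_bigr => J /eqP <-.
  by rewrite !tauM mulrACA -chiM !tauM; ring.
rewrite exchange_big mulr_suml /=; apply: eq_bigr => I _.
rewrite mulr_sumr (exchange_big_dep predT) //=; apply: eq_bigr => J _.
by rewrite (big_pred1 ((I :\: J) :|: (J :\: I))) // => K; rewrite /= eq_sym.
Qed.

Lemma spart_basis I f : spart [ffun J => if J == I then f else 0] = chi p I * tau f.
Proof.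
rewrite !spartE (bigD1 I) //= ffunE eqxx big1 ?addr0 // => J /negbTE neq_JI.
by rewrite ffunE neq_JI tau0 mulr0.
Qed.

Lemma spart_hx i : spart (hx p i) = sgen p i.
Proof.
rewrite !spartE (bigD1 [set i]) //= ffunE eqxx big1 ?addr0 => [|J /negbTE neq_J].
  by rewrite tau1 mulr1 /chi big_set1.
by rewrite ffunE neq_J tau0 mulr0.
Qed.

Lemma spart_hpoly f : spart (hpoly f) = tau f.
Proof. by rewrite spart_basis /chi big_set0 mul1r. Qed.

Lemma hmul_hpoly u f K : hmul u (hpoly f) K = u K * f.
Proof.
rewrite ffunE (bigD1 K) //= [X in _ + X]big1 => [|I neq_IK].
  rewrite addr0 (bigD1 set0) /=; last by rewrite setD0 set0D setU0.
  rewrite [X in _ + X]big1 ?addr0; last by move=> J /andP[_ /negbTE J0]; rewrite !ffunE J0 mulr0.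
  rewrite setI0 big_set0 ffunE eqxx mulr1 /inversions (_ : [set _ | _] = set0) ?cards0 ?mul1r //.
  by apply/setP=> ij; rewrite !inE /= andbF.
rewrite big1 // => J /eqP eqK; rewrite !ffunE; case: eqP => [J0|_]; last by rewrite mulr0.
by move: neq_IK; rewrite -eqK J0 setD0 set0D setU0 eqxx.
Qed.

End Tau.

Lemma spart_hsubst k n (a : 'I_k -> HV p n) (b : 'I_k -> {mpoly 'F_p[n]}) (z : HV p k) :
  spart (hsubst a b z) = \sum_(I : {set 'I_k}) (\prod_(i in I) spart (a i))
                                * tau (comp_mpoly [tuple b i | i < k] (z I)).
Proof.
rewrite /hsubst spart_sum; apply: eq_bigr => I _ /=; rewrite spartM spart_hpoly.
congr (_ * _).
have s1 : spart (hpoly 1) = 1 :> {mpoly 'F_p[n]} by rewrite spart_hpoly tau1.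
by rewrite (big_morph (@spart p n) (@spartM n) s1) big_enum.
Qed.

Lemma pull_sgen k n (A : 'M['F_p]_(k, n)) i : pull A (sgen p i) = \sum_j A i j *: sgen p j.
Proof.
rewrite /sgen; case: eqP => _; first exact: pullXi.
by rewrite pull0 big1 // => j _; rewrite scaler0.
Qed.

Lemma tau_pull k n (A : 'M['F_p]_(k, n)) f : tau (pull A f) = pull A (tau f).
Proof. by rewrite /tau; case: eqP => // _; rewrite pullX. Qed.

Lemma spart_pullback k n (A : 'M['F_p]_(k, n)) z : spart (pullback A z) = pull A (spart z).
Proof.
rewrite /pullback spart_hsubst !spartE pull_sum; apply: eq_bigr => I _.
rewrite pullM -tau_pull [pull A (z I)]pullE; congr (_ * _); rewrite /chi.
rewrite (big_morph (@pull p k n A) (pullM A) (pull1 A)); apply: eq_bigr => i _.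
rewrite /= spart_sum pull_sgen; apply: eq_bigr => j _ /=.
by rewrite spartZ spart_hx.
Qed.

Lemma spart_total n (z : HV p n) : spart (total_power z) = tpow (spart z).
Proof.
rewrite /total_power spart_hsubst !spartE tpow_comp raddf_sum; apply: eq_bigr => I _ /=.
rewrite rmorphM rmorph_prod /=; congr (_ * _).
  apply: eq_bigr => i _; rewrite /sgen; case: ifP => p2.
    rewrite spartD spart_hx spart_hpoly /sgen /tau p2.
    by rewrite comp_mpolyXU -tnth_nth tnth_mktuple.
  by rewrite spart_hx /sgen p2 rmorph0.
by rewrite /tau; case: ifP => // _; rewrite rmorphXn.
Qed.

End HVPoly.

(** The cohomological degree of the polynomial generators. *)
Definition ywt (p : nat) : nat := if p == 2 then 1%N else 2%N.

Definition half_mnm (n : nat) (m : 'X_{1..n}) : 'X_{1..n} := [multinom (m i)./2 | i < n].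
Definition odd_mnm (n : nat) (m : 'X_{1..n}) : {set 'I_n} := [set i | odd (m i)].

(** A section of spart.  For p = 2 the exponents are split in an even part, which goes to the
  coefficient, and an odd part, which is the index. *)
HB.lock Definition rpart (p n : nat) (f : {mpoly 'F_p[n]}) : HV p n :=
  if p == 2 then [ffun I => \sum_(m <- msupp f | odd_mnm m == I) f@_m *: 'X_[half_mnm m]]
  else hpoly f.

Section HVDegree.
Variables (p : nat) (p_prime : prime p).
Let p_gt0 : (0 < p)%N := prime_gt0 p_prime.

Section OneN.
Variable n : nat.
Local Notation S := {mpoly 'F_p[n]}.
Implicit Types (f g : S) (i : 'I_n) (I J K : {set 'I_n}) (u v z : HV p n) (m : 'X_{1..n}).

Lemma chi2 I : p == 2 -> chi p I = 'X_[mesym1 I].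
Proof.
move=> p2; rewrite /chi mpolyXE_id big_mkcond; apply: eq_bigr => i _.
by rewrite /sgen p2 mnmE; case: (i \in I).
Qed.

Lemma odd_halfE m : m = (mesym1 (odd_mnm m) + half_mnm m *+ 2)%MM.
Proof.
by apply/mnmP=> i; rewrite mnmDE mulmnE !mnmE inE muln2 odd_double_half.
Qed.

Lemma spart_hcomp d z : spart (hcomp (ywt p * d) z) = pihomog mdeg d (spart z).
Proof.
rewrite !spartE raddf_sum; apply: eq_bigr => I _ /=; rewrite ffunE tau_sum // mulr_sumr.
rewrite [in RHS](mpolyE (z I)) tau_sum // mulr_sumr raddf_sum [RHS]big_seq [LHS]big_mkcond.
rewrite [LHS]big_seq; apply: eq_bigr => m _ /=; rewrite tauZ // -scalerAr linearZZ /=.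
suff -> : pihomog mdeg d (chi p I * tau 'X_[m])
    = if (#|I| + (mdeg m).*2)%N == (ywt p * d)%N then chi p I * tau 'X_[m] else 0.
  by case: ifP => _; rewrite ?scaler0.
rewrite /ywt; have [p2|p2] := boolP (p == 2).
  rewrite chi2 // /tau p2 mpolyXn -mpolyXD pihomogX /= mdegD mdegMn mdeg_mesym1 mul1n.
  by rewrite (eqP p2) muln2.
rewrite chi_odd // /tau (negbTE p2); case: eqP => [->|_]; last first.
  by rewrite mul0r raddf0 if_same.
by rewrite mul1r cards0 add0n mul2n (inj_eq double_inj) pihomogX.
Qed.

Lemma hcomp_id d z : homogeneous d z -> hcomp d z = z.
Proof.
move=> z_hom; apply/ffunP=> I; rewrite ffunE [RHS]mpolyE big_seq_cond [RHS]big_seq.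
by apply: eq_bigl => m; case zm: (m \in msupp _) => //=; rewrite z_hom ?eqxx.
Qed.

Lemma hcomp_homog d z : homogeneous d (hcomp d z).
Proof.
move=> I m; rewrite ffunE => zm.
have : exists2 m', m' \in msupp (z I) & (#|I| + (mdeg m').*2 == d)%N && (m == m').
  apply/hasP; move: zm; apply: contraLR => /hasPn no.
  rewrite -mcoeff_eq0 raddf_sum /= big_seq_cond big1 // => m' /andP[zm' deg].
  by have := no _ zm'; rewrite deg /= mcoeffZ mcoeffX eq_sym => /negbTE ->; rewrite mulr0.
by case=> m' _ /andP[/eqP <- /eqP ->].
Qed.

Lemma hcomp_homogeneous d z : hcomp d z = z -> homogeneous d z.
Proof. by move=> <-; apply: hcomp_homog. Qed.

Lemma spart_homog d z : homogeneous (ywt p * d) z -> spart z \is d.-homog.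
Proof. by move=> /hcomp_id <-; rewrite spart_hcomp pihomogP. Qed.

Lemma spart_inj2 z : p == 2 -> spart z = 0 -> z = 0.
Proof.
move=> p2 z0; apply/ffunP=> I; rewrite ffunE; apply/mpolyP=> m; rewrite mcoeff0.
have := congr1 (mcoeff (mesym1 I + m *+ p)%MM) z0; rewrite mcoeff0 => <-.
rewrite spartE raddf_sum (bigD1 I) //= big1 => [|J neq_JI].
  by rewrite addr0 chi2 // /tau p2 mulrC mcoeffMX mcoeff_frob.
rewrite chi2 // /tau p2 mulrC; apply: memN_msupp_eq0; rewrite (perm_mem (msuppMX _ _)).
apply/mapP=> -[m' zm' eq_m].
have [i neq_i] : exists i, (i \in J) != (i \in I).
  by apply/existsP; apply: contraR neq_JI => /existsPn eqJI; apply/eqP/setP=> i;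
     have := eqJI i; rewrite negbK => /eqP.
have /mnmP/(_ i) := eq_m; rewrite !mnmDE mulmnE !mnmE.
have : (p %| m' i)%N.
  by apply: contraTT zm' => p'm'; rewrite -mcoeff_eq0 (mcoeff_frob0 p_prime _ p'm').
rewrite (eqP p2) dvdn2 => /negbTE ev /(congr1 odd); rewrite !oddD oddM ev andbF !addbF.
by move: neq_i; case: (i \in J); case: (i \in I).
Qed.

Lemma rpartK f : spart (rpart f) = f.
Proof.
rewrite rpart.unlock; have [p2|p2] := ifP; last by rewrite spart_hpoly // /tau p2.
rewrite spartE [RHS]mpolyE.
transitivity (\sum_I \sum_(m <- msupp f | odd_mnm m == I) f@_m *: 'X_[m]).
  apply: eq_bigr => I _; rewrite ffunE tau_sum // mulr_sumr; apply: eq_bigr => m /eqP <-.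
  rewrite tauZ // -scalerAr chi2 // /tau p2 mpolyXn -mpolyXD; congr (_ *: 'X_[_]).
  by rewrite (eqP p2) -odd_halfE.
rewrite (exchange_big_dep predT) //=; apply: eq_bigr => m _.
by rewrite (big_pred1 (odd_mnm m)) // => I; rewrite /= eq_sym.
Qed.

Lemma spartK2 z : p == 2 -> rpart (spart z) = z.
Proof.
move=> p2; apply/eqP; rewrite -subr_eq0; apply/eqP/(spart_inj2 p2).
by rewrite spartB // rpartK subrr.
Qed.

(** For p = 2 because spart is injective, for p odd because the polynomials are a
  complement of its kernel. *)
Lemma rpartE f z : spart z = f -> (p != 2 -> exists g, z = hpoly g) -> z = rpart f.
Proof.
move=> <- odd_z; have [p2|p2] := boolP (p == 2); first by rewrite spartK2.
have [g ->] := odd_z p2; rewrite rpart.unlock (negbTE p2) spart_hpoly // /tau (negbTE p2).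
by [].
Qed.

Lemma rpart_odd f : p != 2 -> rpart f = hpoly f.
Proof. by move=> /negbTE p2; rewrite rpart.unlock p2. Qed.

Lemma rpart_linear : linear (@rpart p n).
Proof.
move=> c f g; apply/esym/rpartE.
  by rewrite spartD // spartZ // !rpartK.
move=> p2; exists (c *: f + g); rewrite !rpart_odd //; apply/ffunP=> I; rewrite !ffunE.
by case: eqP => _ //; rewrite scaler0 addr0.
Qed.
HB.instance Definition _ := GRing.isLinear.Build 'F_p S (HV p n) *:%R (@rpart p n) rpart_linear.

Lemma hcomp_hpoly d f : hcomp d (hpoly f : HV p n) = hpoly (\sum_(m <- msupp f | (mdeg m).*2 == d) f@_m *: 'X_[m]).
Proof.
apply/ffunP=> I; rewrite !ffunE; case: eqP => [->|_]; first by rewrite cards0.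
by rewrite msupp0 big_nil.
Qed.

Lemma hcomp_rpart d f : hcomp (ywt p * d) (rpart f) = rpart (pihomog mdeg d f).
Proof.
apply: rpartE; first by rewrite spart_hcomp rpartK.
by move=> p2; rewrite rpart_odd // hcomp_hpoly; eexists.
Qed.

Lemma rpart_homog d f : f \is d.-homog -> homogeneous (ywt p * d) (rpart f).
Proof. by move=> f_hom; apply: hcomp_homogeneous; rewrite hcomp_rpart pihomog_dE. Qed.

Lemma rpartM f g : hmul (rpart f) (rpart g) = rpart (f * g).
Proof.
apply: rpartE; first by rewrite spartM // !rpartK.
move=> p2; exists (f * g); rewrite !rpart_odd //; apply/ffunP=> I.
by rewrite hmul_hpoly // !ffunE; case: eqP; rewrite ?mul0r.
Qed.

End OneN.

Lemma hsubst_hpoly k n (a : 'I_k -> HV p n) (b : 'I_k -> {mpoly 'F_p[n]}) f :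
  hsubst a b (hpoly f) = hpoly (f \mPo [tuple b i | i < k]).
Proof.
rewrite /hsubst (bigD1 set0) //= big1 => [|I /negbTE I0].
  rewrite addr0 enum_set0 big_nil ffunE eqxx; apply/ffunP=> I.
  by rewrite hmul_hpoly // !ffunE; case: eqP; rewrite ?mul1r ?mul0r.
rewrite ffunE I0 comp_mpoly0; apply/ffunP=> J.
by rewrite hmul_hpoly // mulr0 ffunE.
Qed.

Lemma pullback_rpart k n (A : 'M['F_p]_(k, n)) f : pullback A (rpart f) = rpart (pull A f).
Proof.
apply: rpartE; first by rewrite spart_pullback // rpartK.
by move=> p2; rewrite rpart_odd // /pullback hsubst_hpoly; eexists.
Qed.

Lemma total_rpart n (f : {mpoly 'F_p[n]}) : total_power (rpart f) = rpart (tpow f).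
Proof.
apply: rpartE; first by rewrite spart_total // rpartK.
by move=> p2; rewrite rpart_odd // /total_power hsubst_hpoly; eexists.
Qed.

Lemma steenrod_rpart n d j (f : {mpoly 'F_p[n]}) : f \is d.-homog ->
  steenrod (ywt p * d) (ywt p * (j * p.-1)) (rpart f) = rpart (rpow j f).
Proof.
by move=> f_hom; rewrite /steenrod total_rpart -mulnDr hcomp_rpart rpow_total.
Qed.

Lemma spart_steenrod n d j (z : HV p n) : homogeneous (ywt p * d) z ->
  spart (steenrod (ywt p * d) (ywt p * (j * p.-1)) z) = rpow j (spart z).
Proof.
move=> z_hom; rewrite /steenrod -mulnDr spart_hcomp spart_total // rpow_total //.
exact: spart_homog.
Qed.

Section OddTop.
Hypothesis p_odd : p != 2.

(** Combinations with constant coefficients of the products of e exterior generators. *)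
Definition exterior n (e : nat) (u : HV p n) :=
  forall K, exists2 c, u K = c%:MP & #|K| != e -> c = 0.

Lemma exterior_hmul n e e' (u v : HV p n) :
  exterior e u -> exterior e' v -> exterior (e + e') (hmul u v).
Proof.
move=> ue ve K.
pose cst (f : {mpoly 'F_p[n]}) := f = (f@_0%MM)%:MP.
have cstP f : cst f -> exists c, f = c%:MP by move=> ->; eexists.
pose t I J := (-1) ^+ inversions I J * (\prod_(i in I :&: J) xsquare p i) * u I * v J.
have tP I J : exists2 c, t I J = c%:MP & #|(I :\: J) :|: (J :\: I)| != (e + e')%N -> c = 0.
  have [a ua ha] := ue I; have [b vb hb] := ve J; rewrite /t ua vb.
  have [IJ0|/set0Pn[i iIJ]] := eqVneq (I :&: J) set0; last first.
    exists 0 => //; rewrite (bigD1 i) //= /xsquare (negbTE p_odd) mul0r mulr0 !mul0r.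
    by rewrite mpolyC0.
  exists ((-1) ^+ inversions I J * a * b).
    by rewrite IJ0 big_set0 mulr1 !mpolyCM rmorphXn /= mpolyCN mpolyC1.
  rewrite cardsU [(I :\: J) :&: _](_ : _ = set0) ?cards0 ?subn0; last first.
    by apply/setP=> i; rewrite !inE; case: (i \in I); case: (i \in J).
  rewrite !cardsD IJ0 setIC IJ0 cards0 !subn0.
  have [eI|/ha ->] := eqVneq #|I| e; last by rewrite mulr0 mul0r.
  have [eJ|/hb ->] := eqVneq #|J| e'; last by rewrite mulr0.
  by rewrite eI eJ eqxx.
rewrite ffunE.
have sumP (T : finType) (Q : pred T) (F : T -> {mpoly 'F_p[n]}) (B : bool) :
    (forall x, Q x -> exists2 c, F x = c%:MP & B -> c = 0) ->
    exists2 c, \sum_(x | Q x) F x = c%:MP & B -> c = 0.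
  move=> FP; apply: (big_ind (fun f => exists2 c, f = c%:MP & B -> c = 0)) => //.
    by exists 0; rewrite ?mpolyC0.
  move=> f g [a -> a0] [b -> b0]; exists (a + b); first by rewrite mpolyCD.
  by move=> hB; rewrite a0 ?b0 ?addr0.
apply: (sumP) => I _; apply: (sumP) => J /eqP <-; exact: tP.
Qed.

Lemma exterior_prod n (s : seq 'I_n) :
  exterior (size s) (\big[@hmul p n/hpoly 1]_(i <- s) hx p i).
Proof.
elim: s => [|i s IHs]; rewrite ?big_nil ?big_cons.
  move=> K; rewrite ffunE; case: eqP => [->|K0]; first by exists 1; rewrite ?mpolyC1 ?cards0.
  by exists 0; rewrite ?mpolyC0.
rewrite /= -add1n; apply: exterior_hmul IHs => K.
rewrite ffunE; case: eqP => [->|K0]; first by exists 1; rewrite ?mpolyC1 ?cards1.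
by exists 0; rewrite ?mpolyC0.
Qed.

(** For p odd the total operation fixes the exterior generators. *)
Lemma total_powerE n (z : HV p n) K : exists a : {set 'I_n} -> 'F_p,
  total_power z K = \sum_(I : {set 'I_n} | #|I| == #|K|) a I *: tpow (z I).
Proof.
have extI (I : {set 'I_n}) := exterior_prod (enum I) K.
exists (fun I : {set 'I_n} => ((\big[@hmul p n/hpoly 1]_(i <- enum I) hx p i) K)@_0%MM).
rewrite /total_power /hsubst sum_ffunE (bigID (fun I : {set 'I_n} => #|I| == #|K|)) /=.
rewrite [X in _ + X]big1 ?addr0 => [|I neq_I]; last first.
  rewrite hmul_hpoly //; have [c] := extI I; rewrite -cardE eq_sym neq_I (negbTE p_odd).
  by move=> -> /(_ isT) ->; rewrite mpolyC0 mul0r.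
apply: eq_bigr => I _; rewrite hmul_hpoly // (negbTE p_odd).
by have [c -> _] := extI I; rewrite mcoeffC eqxx mulr1 mul_mpolyC tpow_comp.
Qed.

Lemma msupp_tpow n (f : {mpoly 'F_p[n]}) d m :
  f \is d.-homog -> m \in msupp (tpow f) -> (mdeg m <= d * p)%N.
Proof.
move=> f_hom; apply: contraLR; rewrite -ltnNge => lt_dm; rewrite -mcoeff_eq0 tpowE.
have rpow_gt_d k : (d < k)%N -> rpow k f = 0.
  move=> lt_dk; rewrite (mpolyE f) raddf_sum big_seq big1 // => m' fm' /=.
  rewrite linearZZ /= rpow_gt ?scaler0 //.
  by rewrite (dhomogP _ _ _ f_hom _ fm' : mdeg m' = d).
rewrite raddf_sum big1 //= => j _; apply: memN_msupp_eq0; apply/negP => fm.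
have eq_m : mdeg m = (d + j * p.-1)%N := dhomogP _ _ _ (rpow_homog p_prime j f_hom) _ fm.
suff r0 : rpow j f = 0 by rewrite r0 msupp0 in fm.
apply: rpow_gt_d; move: lt_dm.
by rewrite eq_m -{1}(prednK p_gt0) mulnS ltn_add2l ltn_mul2r => /andP[].
Qed.

End OddTop.

(** For p odd, an element of degree 2 d killed by spart is a sum of terms x_I f with I
  nonempty.  Then f has degree e < d, and the degree of the total operation on x_I f is at most
  #|I| + 2 e p, which is less than 2 d p. *)
Lemma steenrod_top n d (z : HV p n) : homogeneous (ywt p * d) z -> spart z = 0 ->
  steenrod (ywt p * d) (ywt p * (d * p.-1)) z = 0.
Proof.
move=> z_hom s0; have [p2|p2] := boolP (p == 2).
  rewrite (spart_inj2 p2 s0) -(raddf0 (@rpart p n)).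
  by rewrite steenrod_rpart ?rpred0 // (raddf0 (@rpow p n _)).
have z0 : z set0 = 0.
  move: s0; rewrite spartE (bigD1 set0) //= big1 => [|I I0].
    by rewrite /chi big_set0 mul1r addr0 /tau (negbTE p2).
  by rewrite chi_odd // (negbTE I0) mul0r.
rewrite /steenrod -mulnDr; apply/ffunP=> K; rewrite !ffunE big_seq_cond big1 // => m.
case/andP=> zm /eqP; rewrite /ywt (negbTE p2) mul2n => deg_m; exfalso.
have [a eqK] := total_powerE p2 z K; rewrite eqK in zm.
have [K0|K_gt0] := posnP #|K|.
  move: zm; rewrite K0 (big_pred1 set0) => [|I]; last by rewrite cards_eq0.
  by rewrite z0 tpow_comp comp_mpoly0 scaler0 msupp0.
have : exists2 I : {set 'I_n}, #|I| == #|K| & m \in msupp (tpow (z I)).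
  apply/exists_inP; move: zm; apply: contraLR; rewrite negb_exists_in => /forall_inP no.
  rewrite -mcoeff_eq0 raddf_sum big1 //= => I /no.
  by rewrite -mcoeff_eq0 mcoeffZ => /eqP ->; rewrite mulr0.
case=> I /eqP eI Im; have [zI0|zI0] := eqVneq (z I) 0.
  by move: Im; rewrite zI0 tpow_comp comp_mpoly0 msupp0.
have [e] : exists e, z I \is e.-homog /\ (#|K| + e.*2 = d.*2)%N.
  have [m' m'_z] : exists m', m' \in msupp (z I).
    by case E: (msupp (z I)) zI0 => [|m' s]; rewrite -?msupp_eq0 ?E // => _; exists m'; rewrite inE eqxx.
  exists (mdeg m'); have := z_hom _ _ m'_z; rewrite /ywt (negbTE p2) mul2n eI => eq_d; split=> //.
  apply/dhomogP=> m'' m''_z /=; have := z_hom _ _ m''_z.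
  by rewrite /ywt (negbTE p2) mul2n eI -eq_d => /addnI/double_inj.
case=> z_e eq_e; have := msupp_tpow z_e Im.
have p_gt1 := prime_gt1 p_prime.
have eq_dp : (d + d * p.-1 = d * p)%N by rewrite -mulnS prednK.
rewrite eq_dp in deg_m; move: deg_m eq_e K_gt0; clear -p_gt1; nia.
Qed.

End HVDegree.

(** * The affine group *)

(** Together with the next three matrices, the decomposition of V_(m+1) as V_m plus a line:
  inclusion of and projection to V_m, last coordinate form, last basis vector. *)
HB.lock Definition incl_mx (p m : nat) : 'M['F_p]_(m.+1, m) :=
  castmx (addn1 m, erefl m) (col_mx 1%:M 0).
HB.lock Definition proj_mx (p m : nat) : 'M['F_p]_(m, m.+1) :=
  castmx (erefl m, addn1 m) (row_mx 1%:M 0).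
HB.lock Definition last_row (p m : nat) : 'rV['F_p]_m.+1 :=
  castmx (erefl 1%N, addn1 m) (row_mx 0 1%:M).
HB.lock Definition last_col (p m : nat) : 'cV['F_p]_m.+1 :=
  castmx (addn1 m, erefl 1%N) (col_mx 0 1%:M).

(** The action of an affine transformation on the hyperplane where the last coordinate form
  vanishes. *)
HB.lock Definition lin_mx (p m : nat) (x : GL p m.+1) : 'M['F_p]_m :=
  proj_mx p m *m val x *m incl_mx p m.

HB.lock Definition aff (p m : nat) (x : GL p m.+1) : bool :=
  last_row p m *m val x == last_row p m.
HB.lock Definition lin (p m : nat) (x : GL p m.+1) : GL p m := insubd (1%g : GL p m) (lin_mx x).

Section AffineGroup.
Variables p m : nat.
Local Notation J := (incl_mx p m).
Local Notation rho := (proj_mx p m).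
Local Notation mu0 := (last_row p m).
Local Notation eta := (last_col p m).
Local Notation Gam := (GL p m.+1).
Local Notation G := (GL p m).
Implicit Types (x y : Gam) (g : G).

Lemma proj_incl : rho *m J = 1%:M.
Proof.
rewrite proj_mx.unlock incl_mx.unlock; case: _ / (addn1 m).
by rewrite !castmx_id mul_row_col mulmx1 mulmx0 addr0.
Qed.

Lemma last_incl : mu0 *m J = 0.
Proof.
rewrite last_row.unlock incl_mx.unlock; case: _ / (addn1 m).
by rewrite !castmx_id mul_row_col mulmx0 mul0mx addr0.
Qed.

Lemma proj_last : rho *m eta = 0.
Proof.
rewrite proj_mx.unlock last_col.unlock; case: _ / (addn1 m).
by rewrite !castmx_id mul_row_col mulmx0 mul0mx addr0.
Qed.

Lemma last_last : mu0 *m eta = 1%:M.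
Proof.
rewrite last_row.unlock last_col.unlock; case: _ / (addn1 m).
by rewrite !castmx_id mul_row_col mulmx0 mul1mx add0r.
Qed.

Lemma GLemb_mxE (g : 'M_m) : GLemb_mx g = J *m g *m rho + eta *m mu0.
Proof.
rewrite /GLemb_mx proj_mx.unlock last_row.unlock incl_mx.unlock last_col.unlock.
case: _ / (addn1 m); rewrite !castmx_id mul_col_mx mul1mx mul0mx.
rewrite !mul_col_row !mulmx0 !mul0mx !mulmx1 add_block_mx.
by rewrite !addr0 !add0r.
Qed.

Lemma incl_projD : J *m rho + eta *m mu0 = 1%:M.
Proof.
have := GLemb_mxE 1%:M; rewrite mulmx1 => <-.
by have /(congr1 val) := GLemb1 p m.
Qed.

Lemma affE (x : Gam) : aff x = (mu0 *m val x == mu0).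
Proof. by rewrite aff.unlock. Qed.
Lemma lin_mxE (x : Gam) : lin_mx x = rho *m val x *m J.
Proof. by rewrite lin_mx.unlock. Qed.

Lemma aff_incl x : aff x -> val x *m J = J *m lin_mx x.
Proof.
rewrite affE => /eqP x_aff; rewrite -[LHS]mul1mx -incl_projD mulmxDl -!mulmxA [mu0 *m _]mulmxA x_aff.
by rewrite last_incl mulmx0 addr0 lin_mxE -!mulmxA.
Qed.

Lemma lin_mxM x y : aff y -> lin_mx (x * y)%g = lin_mx x *m lin_mx y.
Proof.
move=> y_aff; transitivity (rho *m val x *m (val y *m J)).
  by rewrite lin_mxE val_GLM !mulmxA.
by rewrite (aff_incl y_aff) mulmxA -lin_mxE.
Qed.

Lemma lin_mx1 : lin_mx (1%g : Gam) = 1%:M.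
Proof. by rewrite lin_mxE val_GL1 mulmx1 proj_incl. Qed.

Lemma aff1 : aff (1%g : Gam). Proof. by rewrite affE val_GL1 mulmx1. Qed.

Lemma affM x y : aff x -> aff (x * y)%g = aff y.
Proof. by rewrite !affE val_GLM mulmxA => /eqP ->. Qed.

Lemma affMr x y : aff y -> aff (x * y)%g = aff x.
Proof.
rewrite !affE val_GLM mulmxA => /eqP y_aff.
rewrite -[X in _ == X]y_aff (can_eq (mulmxK _)) //; exact: (valP y).
Qed.

Lemma affV x : aff x^-1%g = aff x.
Proof.
apply/idP/idP => xaff; last by rewrite -(affM _ xaff) mulgV aff1.
by rewrite -(affM _ xaff) mulVg aff1.
Qed.

Lemma lin_mx_unit x : aff x -> lin_mx x \in unitmx.
Proof.
move=> x_aff; have x1 : lin_mx x *m lin_mx x^-1%g = 1%:M.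
  by rewrite -lin_mxM ?affV // mulgV lin_mx1.
by have [x_unit _] := mulmx1_unit x1; exact: x_unit.
Qed.

Lemma val_lin x : aff x -> val (lin x) = lin_mx x.
Proof. by move=> x_aff; rewrite lin.unlock val_insubd (lin_mx_unit x_aff). Qed.

Lemma linM x y : aff x -> aff y -> lin (x * y)%g = (lin x * lin y)%g.
Proof.
move=> xa ya; have xya : aff (x * y)%g by rewrite affM.
by apply: val_inj; rewrite (val_lin xya) (lin_mxM _ ya) val_GLM (val_lin xa) (val_lin ya).
Qed.

Lemma aff_emb (g : G) : aff (GLemb g).
Proof.
rewrite affE /GLemb /= GLemb_mxE mulmxDr !mulmxA last_incl !mul0mx add0r last_last.
by rewrite mul1mx.
Qed.

Lemma lin_mx_emb (g : G) : lin_mx (GLemb g) = val g.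
Proof.
rewrite lin_mxE /= GLemb_mxE mulmxDr mulmxDl !mulmxA proj_incl mul1mx proj_last !mul0mx addr0.
by rewrite -mulmxA proj_incl mulmx1.
Qed.

Lemma lin_emb (g : G) : lin (GLemb g) = g.
Proof. by apply: val_inj; rewrite (val_lin (aff_emb g)) lin_mx_emb. Qed.

Lemma GLembV (g : G) : GLemb g^-1%g = (GLemb g)^-1%g.
Proof. by apply: (mulgI (GLemb g)); rewrite -GLembM !mulgV GLemb1. Qed.

(** The unipotent radical of the affine group. *)
Definition unip (x : Gam) : bool := aff x && (lin x == 1%g).

Lemma unip_aff x : unip x -> aff x. Proof. by case/andP. Qed.
Lemma unip_lin x : unip x -> lin x = 1%g. Proof. by case/andP => _ /eqP. Qed.

Lemma unip1 : unip (1%g : Gam).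
Proof. by rewrite /unip aff1 -(GLemb1 p m) lin_emb eqxx. Qed.

Lemma linV x : aff x -> lin x^-1%g = (lin x)^-1%g.
Proof.
move=> xa; apply: (mulgI (lin x)); rewrite -linM ?affV // !mulgV.
by apply/eqP; case/andP: unip1.
Qed.

Lemma unipM x y : unip x -> unip (x * y)%g = unip y.
Proof.
move=> /andP[xa /eqP x1]; rewrite /unip affM //; case: (boolP (aff y)) => // ya.
by rewrite linM // x1 mul1g.
Qed.

Lemma unipMr x y : unip y -> unip (x * y)%g = unip x.
Proof.
move=> /andP[ya /eqP y1]; rewrite /unip affMr //; case: (boolP (aff x)) => // xa.
by rewrite linM // y1 mulg1.
Qed.

Lemma unipV x : unip x^-1%g = unip x.
Proof.
by rewrite /unip affV; case: (boolP (aff x)) => // xa; rewrite linV // invg_eq1.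
Qed.

Lemma unip_conj x y : aff y -> unip (y^-1 * x * y)%g = unip x.
Proof.
move=> ya; rewrite /unip affMr // affM ?affV //; case: (boolP (aff x)) => // xa.
rewrite !linM ?affM ?affV // linV //; apply/eqP/eqP => [|->]; last by rewrite mulg1 mulVg.
by move/(canRL (mulgK _)); rewrite mul1g -[RHS]mulg1 => /mulgI.
Qed.

Lemma big_aff (V : nmodType) (F : Gam -> V) :
  \sum_(x | aff x) F x = \sum_(u | unip u) \sum_(g : G) F (GLemb g * u)%g.
Proof.
rewrite [RHS]exchange_big (partition_big (@lin p m) predT) //=; apply: eq_bigr => g _.
rewrite (reindex (fun u => GLemb g * u)%g); last first.
  exists (fun x => (GLemb g)^-1 * x)%g => x _; [exact: mulKg | exact: mulKVg].
apply: eq_bigl => u; rewrite affM ?aff_emb // /unip; case: (boolP (aff u)) => // ua /=.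
by rewrite linM ?aff_emb // lin_emb -{2}[g]mulg1 (inj_eq (mulgI g)).
Qed.

Lemma last_transitive (nu : 'rV['F_p]_m.+1) : nu != 0 -> exists x : Gam, mu0 *m val x = nu.
Proof.
move=> nu_neq0; have mu0_neq0 : mu0 != 0.
  apply/eqP => mu00; have := last_last; rewrite mu00 mul0mx => /matrixP/(_ 0 0).
  by rewrite !mxE eqxx => /esym/eqP; rewrite oner_eq0.
have [|g g_unit eq_g] := @complete_unitmx _ _ _ mu0 (eta *m nu).
  by rewrite mulmxA last_last mul1mx !rank_rV nu_neq0 mu0_neq0.
exists (MkGL g_unit); rewrite /= -eq_g mulmxA last_last mul1mx.
by [].
Qed.

Lemma last_row_neq0 : mu0 != 0.
Proof.
apply/eqP => mu00; have := last_last; rewrite mu00 mul0mx => /matrixP/(_ 0 0).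
by rewrite !mxE eqxx => /esym/eqP; rewrite oner_eq0.
Qed.

Lemma last_rowM_neq0 (x : Gam) : mu0 *m val x != 0.
Proof.
apply: contraNneq last_row_neq0 => mx0.
by rewrite -[mu0](mulmxK (valP x)) mx0 mul0mx.
Qed.

End AffineGroup.

(** * Dickson's product of the nonzero linear forms *)

HB.lock Definition linform (p n : nat) (mu : 'rV['F_p]_n) : {mpoly 'F_p[n]} :=
  pull mu ('X_ord0 : {mpoly 'F_p[1]}).
HB.lock Definition dickson (p n : nat) : {mpoly 'F_p[n]} :=
  \prod_(mu : 'rV['F_p]_n | mu != 0) linform mu.

Section Dickson.
Variables (p : nat) (p_prime : prime p).

Lemma linformE n (mu : 'rV['F_p]_n) : linform mu = \sum_j mu 0 j *: 'X_j.
Proof. by rewrite linform.unlock pullXi; apply: eq_bigr => j _; rewrite ord1. Qed.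

Lemma pull_linform n k (A : 'M['F_p]_(n, k)) mu : pull A (linform mu) = linform (mu *m A).
Proof. by rewrite !linform.unlock pull_comp. Qed.

Lemma linform_eq0 n (mu : 'rV['F_p]_n) : (linform mu == 0) = (mu == 0).
Proof.
apply/eqP/eqP => [mu0|->]; last by rewrite linformE big1 // => j _; rewrite mxE scale0r.
apply/rowP=> j; have := congr1 (mcoeff U_(j)) mu0; rewrite mcoeff0 mxE => <-.
rewrite linformE raddf_sum (bigD1 j) //= mcoeffZ mcoeffXU eqxx mulr1 big1 ?addr0 // => i ne_ij.
by rewrite mcoeffZ mcoeffXU (negbTE ne_ij) mulr0.
Qed.

Lemma linform_homog n (mu : 'rV['F_p]_n) : linform mu \is 1.-homog.
Proof. by rewrite linform.unlock; apply: pull_homog; rewrite dhomogX /= mdeg1. Qed.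

Lemma dickson_neq0 n : dickson p n != 0.
Proof. by rewrite dickson.unlock; apply/prodf_neq0 => mu; rewrite linform_eq0. Qed.

Lemma pull_dickson n (g : GL p n) : pull (val g) (dickson p n) = dickson p n.
Proof.
rewrite dickson.unlock (big_morph _ (pullM _) (pull1 _)).
rewrite [RHS](reindex (fun mu => mu *m val g)) /=; last first.
  by exists (fun mu => mu *m invmx (val g)) => mu _; rewrite ?mulmxK ?mulmxKV ?(valP g).
apply: eq_big => mu; last by rewrite pull_linform.
by rewrite -(inj_eq (can_inj (mulmxK (valP g)))) mul0mx.
Qed.

(** Some nonzero linear form pulls back to 0 under a singular matrix. *)
Lemma pull_dickson_sing n (A : 'M['F_p]_n) : A \notin unitmx -> pull A (dickson p n) = 0.
Proof.
move=> A_sing; have : kermx A != 0 by rewrite kermx_eq0 row_free_unit.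
case/rowV0Pn=> mu /sub_kermxP muA mu_neq0.
rewrite dickson.unlock (bigD1 mu) //= pullM pull_linform muA.
by rewrite (_ : linform 0 = 0) ?mul0r //; apply/eqP; rewrite linform_eq0.
Qed.

(** Multiplication by an invariant nonzero polynomial does not affect the independence of
  invertible substitutions. *)
Lemma dickson_indep n (s : GL p n -> 'F_p) :
  (forall k : {mpoly 'F_p[n]}, \sum_g s g *: pull (val g) (dickson p n * k) = 0) -> forall g, s g = 0.
Proof.
move=> sum0 g; pose s' (A : 'M['F_p]_n) : {mpoly 'F_p[n]} := (s (insubd (1%g : GL p n) A))%:MP.
have s'E h : s' (val h) = (s h)%:MP by rewrite /s' valKd.
suff : s' (val g) = 0 by rewrite s'E => /eqP; rewrite mpolyC_eq0 => /eqP.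
apply: (@pull_indep p n n [seq val h | h <- enum {: GL p n}] s').
- by rewrite (map_inj_uniq val_inj) enum_uniq.
- move=> k; rewrite big_map big_enum /=; apply: (mulfI (dickson_neq0 n)).
  rewrite mulr0 -[RHS](sum0 k) mulr_sumr; apply: eq_bigr => h _.
  by rewrite s'E mul_mpolyC pullM pull_dickson -scalerAr.
by apply: map_f; rewrite mem_enum.
Qed.

End Dickson.

(** * The Steinberg module as the module of cycles of the building *)

(** The chambers of the panel of type i of the flag of x are those of x and of the
  [panel i j a * x], for j = i + 1. *)
HB.lock Definition panel (p n : nat) (i j : 'I_n) (a : 'F_p) : GL p n :=
  (perm_GL p (tperm i j) * insubd (1%g : GL p n) (1%:M + a *: delta_mx i j))%g.

Section Panels.
Variables p n : nat.
Implicit Types (i j k r c : 'I_n) (a : 'F_p) (x y : GL p n) (v w : galg p n).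

Lemma transvection_unit i j a : i != j -> 1%:M + a *: delta_mx i j \in @unitmx 'F_p n.
Proof.
move=> ne_ij; have eq1 : (1%:M + a *: delta_mx i j) *m (1%:M - a *: delta_mx i j) = 1%:M.
  rewrite mulmxDl mul1mx mulmxBr mulmx1 -scalemxAr -scalemxAl mul_delta_mx_0.
    by rewrite !scaler0 subr0 subrK.
  by rewrite eq_sym.
by have [uP _] := mulmx1_unit eq1; exact: uP.
Qed.

Lemma val_panelM i j a x r c : i != j ->
  val (panel i j a * x)%g r c =
  if r == i then val x j c else if r == j then val x i c + a * val x j c else val x r c.
Proof.
move=> ne_ij; rewrite panel.unlock val_GLM val_GLM val_insubd transvection_unit //.
rewrite -mulmxA -row_permE mxE mulmxDl mul1mx mxE -scalemxAl mxE.
have delta_row k : (delta_mx i j *m val x) k c = (k == i)%:R * val x j c.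
  rewrite mxE (bigD1 j) //= mxE eqxx andbT big1 ?addr0 // => l ne_lj.
  by rewrite mxE (negbTE ne_lj) andbF mul0r.
rewrite delta_row; case: tpermP => [->|->|/eqP/negbTE ri /eqP/negbTE rj].
- by rewrite [j == i]eq_sym (negbTE ne_ij) mul0r mulr0 addr0 eqxx.
- by rewrite eqxx mul1r [j == i]eq_sym (negbTE ne_ij) eqxx.
by rewrite ri rj mul0r mulr0 addr0.
Qed.

Lemma borelP x : reflect (forall r c, (c < r)%N -> val x r c = 0) (x \in borel p n).
Proof.
rewrite inE; apply: (iffP is_trig_mxP) => [x0 r c lt_cr|x0 c r lt_cr].
  by have := x0 c r lt_cr; rewrite mxE.
by rewrite mxE x0.
Qed.

Lemma borelM x y : x \in borel p n -> y \in borel p n -> (x * y)%g \in borel p n.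
Proof.
move=> /borelP x0 /borelP y0; apply/borelP=> r c lt_cr; rewrite val_GLM mxE big1 // => k _.
have [lt_kr|le_rk] := ltnP k r; first by rewrite x0 ?mul0r.
by rewrite y0 ?mulr0 // (leq_trans lt_cr).
Qed.

Lemma borel1 : (1%g : GL p n) \in borel p n.
Proof. by apply/borelP=> r c lt_cr; rewrite val_GL1 mxE -val_eqE /= gtn_eqF. Qed.

Lemma borelV x : x \in borel p n -> x^-1%g \in borel p n.
Proof.
move=> xB; rewrite -[x^-1%g]mul1g -(expg_order x) -(prednK (order_gt0 x)) expgSr mulgK.
by elim: #[x]%g.-1 => [|k IHk]; rewrite ?expg0 ?borel1 // expgS borelM.
Qed.

Lemma borelMl x y : x \in borel p n -> ((x * y)%g \in borel p n) = (y \in borel p n).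
Proof.
move=> xB; apply/idP/idP => [xyB|]; last exact: borelM.
by rewrite -[y](mulKg x) borelM ?borelV.
Qed.

Lemma borel_diag x r : x \in borel p n -> val x r r != 0.
Proof.
move=> xB; have : \det (val x)^T != 0 by rewrite det_tr -unitfE -unitmxE (valP x).
have xT : is_trig_mx (val x)^T by move: xB; rewrite inE.
by rewrite det_trig // => /prodf_neq0/(_ r isT); rewrite mxE.
Qed.

(** Functions on flags, the cosets of the Borel subgroup, whose sum over every panel
  vanishes: the cycles of top dimension of the Tits building. *)
Definition flag_cycle v : Prop :=
  (forall b x, b \in borel p n -> v (b * x)%g = v x) /\
  (forall i j x, j = i.+1 :> nat -> v x + \sum_a v (panel i j a * x)%g = 0).

Lemma steinberg_eltE x :
  steinberg_elt p n x
  = \sum_(s : 'S_n) (-1) ^+ s * (x * (perm_GL p s)^-1 \in borel p n)%g%:R :> 'F_p.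
Proof.
have sumB h : (\sum_(b in borel p n) gconst b) h = (h \in borel p n)%:R :> 'F_p.
  rewrite sum_ffunE; case: (boolP (h \in _)) => [hB|hB].
    rewrite (bigD1 h) //= ffunE eqxx big1 ?addr0 // => b /andP[_ /negbTE ne_bh].
    by rewrite ffunE eq_sym ne_bh.
  rewrite big1 // => b bB; rewrite ffunE; case: eqP => // eq_hb.
  by rewrite eq_hb bB in hB.
have sumW y : (\sum_(s : 'S_n) (-1) ^+ s *: gconst (perm_GL p s)) y
    = \sum_(s : 'S_n) (-1) ^+ s * (y == perm_GL p s)%:R :> 'F_p.
  by rewrite sum_ffunE; apply: eq_bigr => s _; rewrite !ffunE.
rewrite /steinberg_elt /gmul ffunE.
transitivity (\sum_h \sum_(s : 'S_n)
    (-1) ^+ s * ((h \in borel p n)%:R * (h^-1 * x == perm_GL p s)%g%:R) : 'F_p).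
  apply: eq_bigr => h _; rewrite sumB sumW mulr_sumr; apply: eq_bigr => s _.
  by rewrite mulrCA.
rewrite exchange_big /=; apply: eq_bigr => s _; rewrite -mulr_sumr; congr (_ * _).
rewrite (bigD1 (x * (perm_GL p s)^-1)%g) //= big1 => [|h ne_h].
  by rewrite addr0 invMg invgK mulgKV eqxx mulr1.
case: eqP => [eq_s|_]; last by rewrite mulr0.
by rewrite -eq_s invMg invgK mulKVg eqxx in ne_h.
Qed.

(** The panel of x either contains exactly one chamber in the Borel subgroup or none,
  according to whether x lies in the minimal parabolic subgroup of i and j. *)
Lemma panel_count i j x : j = i.+1 :> nat ->
  (x \in borel p n)%:R + \sum_a (panel i j a * x \in borel p n)%g%:R
  = [forall r, forall c, ((if c == j then val i else c) < (if r == j then val i else r))%N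
       ==> (val x r c == 0)]%:R :> 'F_p.
Proof.
move=> eq_ji; have ne_ij : i != j by rewrite -val_eqE /= eq_ji neq_ltn ltnSn.
set P := [forall r, _].
have PP : reflect (forall r c, ((if c == j then val i else c) < (if r == j then val i else r))%N
    -> val x r c = 0) P.
  apply: (iffP forallP) => [H r c lt|H r].
    by apply/eqP; have /forallP/(_ c)/implyP := H r; apply.
  by apply/forallP=> c; apply/implyP=> lt; apply/eqP/H.
have xB_P : x \in borel p n -> P.
  move=> /borelP xB; apply/PP=> r c; case: eqP => [->|_]; case: eqP => [->|/eqP rj] lt.
  - by rewrite ltnn in lt.
  - by apply: xB; rewrite ltn_neqAle -val_eqE eq_sym in rj *; rewrite rj eq_ji.
  - by apply: xB; rewrite eq_ji ltnS ltnW.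
  - exact: xB.
have pB_P a : (panel i j a * x)%g \in borel p n -> P.
  move=> /borelP pB; apply/PP=> r c lt.
  have pj : forall c : 'I_n, (c < i.+1)%N -> val x i c + a * val x j c = 0.
    by move=> c' lt'; rewrite -(pB j c') ?eq_ji // val_panelM // eq_sym (negbTE ne_ij) eqxx.
  have pi : forall c : 'I_n, (c < i)%N -> val x j c = 0.
    by move=> c' lt'; rewrite -(pB i c') // val_panelM // eqxx.
  have pr : forall c : 'I_n, (c < r)%N -> r != i -> r != j -> val x r c = 0.
    move=> c' lt' ri rj; rewrite -(pB r c') // val_panelM // (negbTE ri) (negbTE rj).
    by [].
  have [rj|rj] := eqVneq r j.
    rewrite rj eqxx in lt *; apply: pi.
    by move: lt; case: eqP => [->|_]; rewrite ?ltnn.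
  rewrite (negbTE rj) in lt.
  have [ri|ri] := eqVneq r i.
    rewrite ri in lt *; have lt_ci : (c < i)%N.
      by move: lt; case: eqP => [->|_]; rewrite ?ltnn.
    by have := pj c (ltnW lt_ci); rewrite pi // mulr0 addr0.
  apply: pr => //; move: lt; case: eqP => [->|_] // lt.
  by move: rj; rewrite -val_eqE eq_sym ltn_neqAle => ->; rewrite eq_ji.
case: (boolP P) => [Px|nPx]; last first.
  case: (boolP (x \in _)) => [/xB_P|_]; first by rewrite (negbTE nPx).
  rewrite big1 ?addr0 // => a _; case: (boolP (_ \in _)) => // /pB_P.
  by rewrite (negbTE nPx).
have {}Px := PP Px.
have xbelow r c : (c < r)%N -> (r, c) != (j, i) -> val x r c = 0.
  move=> lt_cr ne; apply: Px; case: eqP => [cj|_]; case: eqP => [rj|rj].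
  - by rewrite cj rj ltnn in lt_cr.
  - by rewrite cj eq_ji in lt_cr; exact: ltnW.
  - rewrite rj eq_ji ltnS leq_eqVlt in lt_cr; case/orP: lt_cr => // /eqP/val_inj ci.
    by rewrite rj ci eqxx in ne.
  - by [].
have [x0|x0] := eqVneq (val x j i) 0.
  have xB : x \in borel p n.
    apply/borelP=> r c lt_cr; have [[-> ->]|ne] := (r, c) =P (j, i); first exact: x0.
    by apply: xbelow => //; apply/eqP.
  rewrite xB big1 ?addr0 // => a _; case: (boolP (_ \in _)) => // /borelP/(_ j i).
  rewrite val_panelM // eq_sym (negbTE ne_ij) eqxx x0 mulr0 addr0 eq_ji ltnSn => /(_ isT)/eqP.
  by rewrite (negbTE (borel_diag i xB)).
have -> : (x \in borel p n) = false.
  apply/negbTE/negP => /borelP/(_ j i); rewrite eq_ji ltnSn => /(_ isT)/eqP.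
  by rewrite (negbTE x0).
(* The only a for which the entry (j, i) is cleared. *)
rewrite add0r (bigD1 (- val x i i / val x j i)) //= big1 ?addr0 => [|a ne_a].
  set a := - _ / _; have -> // : (panel i j a * x)%g \in borel p n.
  apply/borelP=> r c lt_cr; rewrite val_panelM //; case: eqP => [ri|_].
    by apply: xbelow; [rewrite eq_ji -ri ltnW | apply: contraTneq lt_cr => -[->]; rewrite ri ltnn].
  case: eqP => [rj|/eqP rj]; last by apply: xbelow => //; rewrite xpair_eqE (negbTE rj).
  move: lt_cr; rewrite rj eq_ji ltnS leq_eqVlt => /orP[/eqP/val_inj ->|lt_ci].
    by rewrite /a divfK // subrr.
  rewrite xbelow //; last by rewrite xpair_eqE (negbTE ne_ij).
  rewrite xbelow ?mulr0 ?addr0 ?eq_ji ?(leq_trans lt_ci) //.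
  by rewrite xpair_eqE eqxx -val_eqE /= neq_ltn lt_ci.
case: (boolP (_ \in _)) => // /borelP/(_ j i).
rewrite val_panelM // eq_sym (negbTE ne_ij) eqxx eq_ji ltnSn => /(_ isT)/eqP.
rewrite addr_eq0 => /eqP xii; case/eqP: ne_a.
by rewrite xii opprK mulfK.
Qed.

Lemma perm_GLM (s t : 'S_n) : perm_GL p (s * t)%g = (perm_GL p s * perm_GL p t)%g.
Proof. by apply: val_inj; rewrite val_GLM /= perm_mxM. Qed.

Lemma perm_GLV (s : 'S_n) : perm_GL p s^-1%g = (perm_GL p s)^-1%g.
Proof.
apply: (mulgI (perm_GL p s)); rewrite -perm_GLM !mulgV.
by apply: val_inj; rewrite /= perm_mx1.
Qed.

Lemma steinberg_elt_borel b x : b \in borel p n ->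
  steinberg_elt p n (b * x)%g = steinberg_elt p n x.
Proof.
by move=> bB; rewrite !steinberg_eltE; apply: eq_bigr => s _; rewrite -mulgA (borelMl _ bB).
Qed.

(** Membership in the minimal parabolic subgroup does not change when the two
  basis vectors are exchanged, so the terms of s and of its composite with the transposition
  cancel. *)
Lemma steinberg_elt_panel i j x : j = i.+1 :> nat ->
  steinberg_elt p n x + \sum_a steinberg_elt p n (panel i j a * x)%g = 0.
Proof.
move=> eq_ji; have ne_ij : i != j by rewrite -val_eqE /= eq_ji neq_ltn ltnSn.
pose Q y := [forall r, forall c,
  ((if c == j then val i else c) < (if r == j then val i else r))%N ==> (val y r c == 0)].
transitivity (\sum_(s : 'S_n) (-1) ^+ s * (Q (x * (perm_GL p s)^-1)%g)%:R : 'F_p).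
  rewrite steinberg_eltE; under [X in _ + X]eq_bigr => a _ do rewrite steinberg_eltE.
  rewrite exchange_big -big_split; apply: eq_bigr => s _ /=.
  rewrite -mulr_sumr -mulrDr -(panel_count _ eq_ji); congr (_ * (_ + _)).
  by apply: eq_bigr => a _; rewrite mulgA.
have Qs (s : 'S_n) : Q (x * (perm_GL p (tperm i j * s))^-1)%g = Q (x * (perm_GL p s)^-1)%g.
  rewrite perm_GLM invMg mulgA -(perm_GLV (tperm i j)) tpermV; set y := (x * _)%g.
  have yt r c : val (y * perm_GL p (tperm i j))%g r c = val y r (tperm i j c).
    by rewrite val_GLM /= -[tperm i j in LHS]tpermV -col_permE mxE.
  have bt c : (if tperm i j c == j then val i else tperm i j c) = (if c == j then val i else c).
    by case: tpermP => [->|->|/eqP/negbTE ci /eqP/negbTE ->]; rewrite ?eqxx ?(negbTE ne_ij).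
  apply/forallP/forallP => H r; apply/forallP=> c; apply/implyP=> lt.
    have /forallP/(_ (tperm i j c))/implyP := H r; rewrite yt tpermK bt; exact.
  have /forallP/(_ (tperm i j c))/implyP := H r; rewrite yt bt; exact.
rewrite (bigID (fun s : 'S_n => s i < s j)%N) /= [X in _ + X](reindex_inj (mulgI (tperm i j))) /=.
rewrite [X in _ + X](_ : _ = - \sum_(s : 'S_n | (s i < s j)%N)
   (-1) ^+ s * (Q (x * (perm_GL p s)^-1)%g)%:R) ?subrr // -sumrN.
apply: eq_big => [s|s _].
  rewrite !permM tpermL tpermR -leqNgt ltn_neqAle (inj_eq val_inj) (inj_eq perm_inj).
  by rewrite ne_ij.
by rewrite Qs odd_permM odd_tperm ne_ij /= signrN mulNr.
Qed.

Lemma cycle_right v x : flag_cycle v -> flag_cycle (gact v x).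
Proof.
case=> vB vP; split=> [b y bB|i j y eq_ji]; first by rewrite !ffunE -mulgA (vB _ _ bB).
rewrite ffunE -[RHS](vP i j (y * x^-1)%g eq_ji); congr (_ + _).
by apply: eq_bigr => a _; rewrite ffunE mulgA.
Qed.

Lemma cycleD (e : 'F_p) v w : flag_cycle v -> flag_cycle w -> flag_cycle (e *: v + w).
Proof.
case=> vB vP [wB wP]; split=> [b y bB|i j y eq_ji]; first by rewrite !ffunE (vB _ _ bB) (wB _ _ bB).
under eq_bigr => a _ do rewrite !ffunE.
rewrite !ffunE big_split /= addrACA wP // addr0 -scaler_sumr -scalerDr vP //.
by rewrite scaler0.
Qed.

Lemma in_St_cycle v : in_St v -> flag_cycle v.
Proof.
case/existsP=> u /eqP ->.
have gm x y : gmul (steinberg_elt p n) u (x * y)%g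
    = \sum_h steinberg_elt p n (x * h)%g * u (h^-1 * y)%g.
  rewrite ffunE (reindex_inj (mulgI x)); apply: eq_bigr => h _.
  by rewrite invMg -mulgA mulKg.
split=> [b y bB|i j y eq_ji].
  rewrite gm ffunE; apply: eq_bigr => h _.
  by rewrite (steinberg_elt_borel _ bB).
under eq_bigr => a _ do rewrite gm.
rewrite exchange_big ffunE -big_split big1 // => h _ /=.
by rewrite -mulr_suml -mulrDl steinberg_elt_panel // mul0r.
Qed.

End Panels.

(** * Restriction of cycles to the big cell *)

Section BigCell.
Variables p m : nat.
Local Notation J := (incl_mx p m).
Local Notation rho := (proj_mx p m).
Local Notation mu0 := (last_row p m).
Local Notation eta := (last_col p m).
Local Notation Gam := (GL p m.+1).
Local Notation G := (GL p m).
Implicit Types (g h : G) (x y u : Gam) (v : galg p m.+1) (a b : galg p m).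

Lemma mul_projE k (A : 'M['F_p]_(k, m)) r c : (A *m rho) r (lift ord_max c) = A r c.
Proof.
have -> : A *m rho = castmx (erefl k, addn1 m) (row_mx A 0).
  by rewrite proj_mx.unlock; case: _ / (addn1 m); rewrite !castmx_id mul_mx_row mulmx1 mulmx0.
rewrite castmxE /= cast_ord_id -[RHS](row_mxEl A (0 : 'M_(k, 1))); congr (row_mx _ _ _ _).
by apply: val_inj; rewrite /= /bump leqNgt ltn_ord.
Qed.

Lemma mul_proj_max k (A : 'M['F_p]_(k, m)) r : (A *m rho) r ord_max = 0.
Proof.
have -> : A *m rho = castmx (erefl k, addn1 m) (row_mx A 0).
  by rewrite proj_mx.unlock; case: _ / (addn1 m); rewrite !castmx_id mul_mx_row mulmx1 mulmx0.
rewrite castmxE /= cast_ord_id -[RHS](mxE const_mx_key (fun _ _ => 0) r (0 : 'I_1)).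
rewrite -(row_mxEr A (0 : 'M_(k, 1))); congr (row_mx _ _ _ _).
by apply: val_inj; rewrite /= addn0.
Qed.

Lemma last_rowE c : mu0 0 c = (c == ord_max)%:R.
Proof.
rewrite last_row.unlock castmxE /= mxE -val_eqE /=; case: splitP => k /= eq_k; rewrite mxE eq_k.
  by rewrite ltn_eqF.
by rewrite [k]ord1 addn0 eqxx -val_eqE.
Qed.

Lemma mul_last_col k (A : 'M['F_p]_(k, m.+1)) r : (A *m eta) r 0 = A r ord_max.
Proof.
have etaE c : eta c 0 = (c == ord_max)%:R.
  rewrite last_col.unlock castmxE /= mxE -val_eqE /=; case: splitP => l /= eq_l; rewrite mxE eq_l.
    by rewrite ltn_eqF.
  by rewrite [l]ord1 addn0 eqxx -val_eqE.
rewrite mxE (bigD1 ord_max) //= etaE eqxx mulr1 big1 ?addr0 // => c ne_c.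
by rewrite etaE (negbTE ne_c) mulr0.
Qed.

Definition bigel_mx (L : 'M['F_p]_(m, m.+1)) : 'M['F_p]_m.+1 := col_mx mu0 L.

Lemma bigel_mx0 L c : bigel_mx L ord0 c = (c == ord_max)%:R.
Proof.
rewrite -last_rowE -(col_mxEu mu0 L); congr (col_mx _ _ _ _).
by apply: val_inj.
Qed.

Lemma bigel_mxS L r c : bigel_mx L (lift ord0 r) c = L r c.
Proof.
rewrite -(col_mxEd mu0 L); congr (col_mx _ _ _ _).
by apply: val_inj.
Qed.

Lemma bigel_mxM L x : aff x -> bigel_mx L *m val x = bigel_mx (L *m val x).
Proof. 
rewrite affE => /eqP mu0x; rewrite /bigel_mx -[in RHS]mu0x; exact: (mul_col_mx mu0 L (val x)).
Qed.

Fact bigel_subproof g : bigel_mx (val g *m rho) \in unitmx.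
Proof.
have eq1 : col_mx mu0 (val g *m rho) *m row_mx eta (J *m invmx (val g)) = 1%:M.
  rewrite mul_col_row last_last !mulmxA last_incl mul0mx -[val g *m rho *m eta]mulmxA.
  rewrite proj_last mulmx0 -[val g *m rho *m J]mulmxA proj_incl mulmx1 mulmxV ?(valP g) //.
  by rewrite -scalar_mx_block.
by have [uP _] := mulmx1_unit eq1; exact: uP.
Qed.
(** The cosets of the products of these elements with unipotent ones are the flags whose
  hyperplane does not contain mu0: they form the big cell. *)
Definition bigel g : Gam := MkGL (bigel_subproof g).

Lemma bigelM g h : bigel (g * h)%g = (bigel g * GLemb h)%g.
Proof.
apply: val_inj; rewrite [RHS]val_GLM [RHS]bigel_mxM ?aff_emb // /=; congr bigel_mx.
by rewrite GLemb_mxE mulmxDr !mulmxA -[val g *m rho *m J]mulmxA proj_incl mulmx1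
   -[val g *m rho *m eta]mulmxA proj_last mulmx0 mul0mx addr0.
Qed.

Lemma bigel_unip x : aff x ->
  (forall r, val (bigel 1%g * x)%g (lift ord0 r) ord_max = 0) -> unip x -> x = 1%g.
Proof.
move=> xa x0 xu; apply: val_inj; rewrite val_GL1 -[LHS]mulmx1 -(incl_projD p m) mulmxDr !mulmxA.
have -> : val x *m J = J by rewrite (aff_incl xa) -(val_lin xa) (unip_lin xu) val_GL1 mulmx1.
have rx : rho *m val x *m eta = 0.
  apply/colP=> r; rewrite [RHS]mxE -[RHS](x0 r) val_GLM bigel_mxM // bigel_mxS val_GL1 mul1mx.
  by rewrite mul_last_col.
rewrite -[val x *m eta]mul1mx -(incl_projD p m) [(_ + _) *m (val x *m _)]mulmxDl -!mulmxA.
rewrite [rho *m _]mulmxA rx mulmx0 add0r [mu0 *m (val x *m _)]mulmxA.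
by move: xa; rewrite affE => /eqP ->; rewrite last_last mulmx1.
Qed.

Lemma bigel_unipE x : aff x ->
  val (bigel 1%g * x)%g = bigel_mx (rho *m val x).
Proof. by move=> xa; rewrite val_GLM bigel_mxM // val_GL1 mul1mx. Qed.

(** A permutation with a nonzero contribution at a point of the big cell sends the
  first index to the last one, and is obtained by lifting a permutation of m indices. *)
Lemma steinberg_elt_bigel g u : unip u ->
  steinberg_elt p m.+1 (bigel g * u)%g
  = (u == 1%g)%:R * ((-1) ^+ m * steinberg_elt p m g) :> 'F_p.
Proof.
move=> u_unip; have ua := unip_aff u_unip.
pose L := val g *m rho *m val u.
have guE : val (bigel g * u)%g = bigel_mx L by rewrite val_GLM bigel_mxM.
have valE (s : 'S_m.+1) r c :
    val (bigel g * u * (perm_GL p s)^-1)%g r c = bigel_mx L r (s c).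
  by rewrite -perm_GLV val_GLM guE /= -col_permE mxE.
rewrite steinberg_eltE (bigID (fun s : 'S_m.+1 => s ord0 == ord_max)) /= [X in _ + X]big1 ?addr0.
  rewrite (eq_bigl (fun s => s \in [set lift_perm ord0 ord_max s | s : 'S_m])) => [|s]; last first.
    apply/eqP/imsetP => [s0|[s' _ ->]]; last exact: lift_perm_id.
    have lift_s k : exists k', s (lift ord0 k) = lift ord_max k'.
      case: (unliftP ord_max (s (lift ord0 k))) => [k' ->|]; first by exists k'.
      by rewrite -s0 => /perm_inj/eqP; rewrite eq_sym (negbTE (neq_lift _ _)).
    have [F sF] := fin_all_exists lift_s.
    have F_inj : injective F.
      by move=> k k' eqF; apply/(@lift_inj _ ord0)/(@perm_inj _ s); rewrite !sF eqF.
    exists (perm F_inj) => //; apply/permP=> k; case: (unliftP ord0 k) => [k'|] ->.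
      by rewrite lift_perm_lift permE sF.
    by rewrite lift_perm_id.
  rewrite big_imset => [|s s' _ _ eq_s] /=; last first.
    apply/permP=> k; have := congr1 (fun u : 'S_m.+1 => u (lift ord0 k)) eq_s.
    by rewrite !lift_perm_lift => /lift_inj.
  rewrite steinberg_eltE !mulr_sumr; apply: eq_bigr => s _.
  have -> : (-1) ^+ lift_perm ord0 ord_max s = (-1) ^+ m * (-1) ^+ s :> 'F_p.
    by rewrite odd_lift_perm (_ : odd (ord0 : 'I_m.+1) = false) // addFb signr_addb signr_odd.
  rewrite -mulrA [RHS]mulrCA; congr (_ * _); rewrite [RHS]mulrCA; congr (_ * _); rewrite -natrM mulnb; congr (nat_of_bool _)%:R.
  have gsE r c : val (g * (perm_GL p s)^-1)%g r c = val g r (s c).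
    by rewrite -perm_GLV val_GLM /= -col_permE mxE.
  apply/borelP/andP => [gB|[/eqP u1 /borelP gB] r c lt_cr].
    have u1 : u = 1%g.
      apply: bigel_unip => // r; rewrite bigel_unipE // bigel_mxS -mul_last_col.
      rewrite -[_ *m eta](mulKmx (valP g)) [X in invmx _ *m X](_ : _ = 0) ?mulmx0 ?mxE //.
      apply/colP=> k; rewrite [RHS]mxE !mulmxA mul_last_col -/L.
      by rewrite -[RHS](gB (lift ord0 k) ord0) // valE lift_perm_id bigel_mxS.
    split; first exact/eqP.
    apply/borelP=> r c lt_cr; rewrite gsE -[RHS](gB (lift ord0 r) (lift ord0 c)) //.
    by rewrite valE lift_perm_lift bigel_mxS /L u1 val_GL1 mulmx1 mul_projE.
  rewrite valE; case: (unliftP ord0 r) lt_cr => [r'|] ->; last by rewrite ltn0.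
  rewrite bigel_mxS /L u1 val_GL1 mulmx1; case: (unliftP ord0 c) => [c'|] -> lt_cr.
    by rewrite lift_perm_lift mul_projE -gsE; apply: gB.
  by rewrite lift_perm_id mul_proj_max.
move=> s /negbTE s0; case: (boolP (_ \in borel _ _)) => [sB|]; last by rewrite mulr0.
by have := borel_diag ord0 sB; rewrite valE bigel_mx0 s0 eqxx.
Qed.

Definition cell_restr v : galg p m := [ffun g => v (bigel g)].

Lemma cell_restr_linear : linear cell_restr.
Proof. by move=> c v w; apply/ffunP=> g; rewrite !ffunE. Qed.

Lemma cell_restr_emb v g : cell_restr (gact v (GLemb g)) = gact (cell_restr v) g.
Proof. by apply/ffunP=> h; rewrite !ffunE -GLembV -bigelM. Qed.

Lemma cycle_restr v : flag_cycle v -> flag_cycle (cell_restr v).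
Proof.
case=> vB vP; split=> [b x /borelP bB|i j x eq_ji].
  rewrite !ffunE; pose b' := (bigel (b * x) * (bigel x)^-1)%g.
  have -> : bigel (b * x)%g = (b' * bigel x)%g by rewrite mulgKV.
  apply: vB; have b'V : val b' = (block_mx 1%:M 0 0 (val b) : 'M_(1 + m)).
    have b'E : (block_mx 1%:M 0 0 (val b) : 'M_(1 + m)) *m col_mx mu0 (val x *m rho)
        = col_mx mu0 (val b *m val x *m rho).
      by rewrite mul_block_col !mul0mx mul1mx addr0 add0r mulmxA.
    rewrite val_GLM [val (bigel _)]/= /bigel_mx -b'E; exact: (mulmxK (bigel_subproof x)).
  apply/borelP=> r c; rewrite b'V.
  case: (unliftP ord0 r) => [r'|] -> //; case: (unliftP ord0 c) => [c'|] -> lt_cr.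
    transitivity (val b r' c'); last exact: bB.
    rewrite -(block_mxEdr (1%:M : 'M_1) 0 0 (val b)).
    by congr (block_mx _ _ _ _ _ _); apply: val_inj.
  transitivity ((0 : 'M['F_p]_(m, 1)) r' ord0); last by rewrite mxE.
  rewrite -(block_mxEdl (1%:M : 'M_1) 0 0 (val b)).
  by congr (block_mx _ _ _ _ _ _); apply: val_inj.
rewrite !ffunE -[RHS](vP (lift ord0 i) (lift ord0 j) (bigel x)); last first.
  by rewrite !lift0 eq_ji.
congr (_ + _); apply: eq_bigr => a _; rewrite ffunE; congr (v _).
have ne_ij : i != j by rewrite -val_eqE /= eq_ji neq_ltn ltnSn.
apply: val_inj; apply/matrixP=> r c.
rewrite val_panelM ?(inj_eq lift_inj) //=.
case: (unliftP ord0 r) => [r'|] ->; last first.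
  by rewrite !bigel_mx0 !(negbTE (neq_lift _ _)).
rewrite !bigel_mxS !(inj_eq lift_inj).
case: (unliftP ord_max c) => [c'|] ->; last first.
  by rewrite !mul_proj_max mulr0 addr0 !if_same.
by rewrite !mul_projE val_panelM.
Qed.

(** The linear part of u is trivial and its last column compensates for that of L. *)
Lemma bigel_mx_unit (L : 'M['F_p]_(m, m.+1)) : bigel_mx L \in unitmx ->
  exists g u, unip u /\ bigel_mx L = val (bigel g * u)%g.
Proof.
move=> L_unit; pose R := rsubmx (invmx (bigel_mx L) : 'M_(m.+1, 1 + m)).
have [mu0R LR] : mu0 *m R = 0 /\ L *m R = 1%:M.
  have := mulmxV L_unit; rewrite -[invmx _]/(invmx (bigel_mx L) : 'M_(m.+1, 1 + m)).
  rewrite -[X in _ *m X](hsubmxK (invmx (bigel_mx L) : 'M_(m.+1, 1 + m))) -/R => eq1.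
  have eq2 : col_mx mu0 L *m row_mx (lsubmx (invmx (bigel_mx L) : 'M_(m.+1, 1 + m))) R = 1%:M.
    exact: eq1.
  move: eq2; rewrite mul_col_row.
  by rewrite [X in _ = X](scalar_mx_block 1 m) => /eq_block_mx[_ -> _ ->].
have g_unit : L *m J \in unitmx.
  have eq1 : L *m J *m (rho *m R) = 1%:M.
    rewrite mulmxA -[L *m J *m rho]mulmxA -[J *m rho](addrK (eta *m mu0)) incl_projD.
    by rewrite mulmxBr mulmx1 mulmxBl LR -!mulmxA mu0R !mulmx0 subr0.
  by have [uP _] := mulmx1_unit eq1; exact: uP.
pose g := MkGL g_unit; pose x := MkGL L_unit; exists g, ((bigel g)^-1 * x)%g.
rewrite mulKVg; split=> //.
set u := (_ * x)%g; have : col_mx mu0 (val g *m rho) *m val u = col_mx mu0 L.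
  by rewrite -[LHS](val_GLM (bigel g) u) mulKVg.
rewrite mul_col_mx => /eq_col_mx[mu0u gu].
have ua : aff u by rewrite affE mu0u.
rewrite /unip ua; apply/eqP/val_inj; rewrite (val_lin ua) lin_mxE val_GL1.
by rewrite -[LHS](mulKmx (valP g)) [val g *m (_ *m J)]mulmxA [val g *m (rho *m _)]mulmxA gu mulVmx ?(valP g).
Qed.

(** Induction on the index of the first nonzero coordinate of the row mu0 x^-1: it is the
  first one exactly on the big cell, and the panel relations express the value of a cycle at x
  by its values at elements for which this index is smaller. *)
Lemma cycle_eq0 v : flag_cycle v -> (forall g u, unip u -> v (bigel g * u)%g = 0) -> v = 0.
Proof.
move=> [vB vP] v0.
have claim N (k : 'I_m.+1) (nu : 'rV['F_p]_m.+1) x : k = N :> nat -> nu *m val x = mu0 ->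
    nu 0 k != 0 -> (forall i : 'I_m.+1, (i < k)%N -> nu 0 i = 0) -> v x = 0.
  elim: N k nu x => [|N IHN] k nu x k_N nu_x nuk nu0.
    have {k_N} k0 : k = ord0 by apply: val_inj.
    rewrite {}k0 in nuk nu0.
    (* The Borel subgroup can replace the first row of x by nu x = mu0. *)
    pose L := \matrix_(i < m, j < m.+1) val x (lift ord0 i) j.
    pose b : 'M['F_p]_m.+1 := \matrix_(i < m.+1, j < m.+1) (if i == ord0 then nu 0 j else (i == j)%:R).
    have b_trig : is_trig_mx b^T.
      apply/is_trig_mxP=> i j lt_ij; rewrite !mxE -!val_eqE /=.
      by rewrite (gtn_eqF lt_ij) (gtn_eqF (leq_ltn_trans _ lt_ij)).
    have b_unit : b \in unitmx.
      rewrite unitmxE unitfE -det_tr det_trig //; apply/prodf_neq0 => i _; rewrite !mxE.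
      by case: (i =P ord0) => [i0|_]; rewrite ?i0 ?eqxx ?oner_eq0.
    have bx : b *m val x = bigel_mx L.
      apply/matrixP=> i j; rewrite mxE; case: (unliftP ord0 i) => [i'|] ->.
        rewrite bigel_mxS mxE (bigD1 (lift ord0 i')) //= big1 => [|l ne_l].
          by rewrite mxE eq_sym (negbTE (neq_lift _ _)) eqxx mul1r addr0.
        by rewrite mxE eq_sym (negbTE (neq_lift _ _)) eq_sym (negbTE ne_l) mul0r.
      rewrite bigel_mx0 -last_rowE -nu_x mxE; apply: eq_bigr => l _.
      by rewrite mxE eqxx.
    have [|g [u [u_unip gu]]] := @bigel_mx_unit L.
      by rewrite -bx unitmx_mul b_unit (valP x).
    rewrite -(vB (MkGL b_unit) x) ?inE //.
    by have -> : (MkGL b_unit * x)%g = (bigel g * u)%g; [by apply: val_inj; rewrite val_GLM /= bx gu | exact: v0].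
  have N_lt : (N < m.+1)%N by rewrite ltnW // -k_N.
  pose i := Ordinal N_lt; have eq_ki : k = i.+1 :> nat by [].
  have ne_ik : i != k by rewrite -val_eqE /= eq_ki neq_ltn ltnSn.
  have nui : nu 0 i = 0 by apply: nu0; rewrite eq_ki.
  rewrite -[LHS]addr0 -[RHS](vP i k x eq_ki); congr (_ + _); rewrite big1 // => a _.
  (* As nu vanishes at i, the row of the other chambers is nu with its entries at i and k exchanged. *)
  pose nu' := \row_r nu 0 (tperm i k r).
  apply: (IHN i nu') => [//||| r lt_ri].
  - apply/rowP=> c; rewrite -nu_x [LHS]mxE [RHS]mxE.
    rewrite (bigD1 i) // (bigD1 k) 1?eq_sym //= [RHS](bigD1 i) // [in RHS](bigD1 k) 1?eq_sym //=.
    rewrite !val_panelM // !mxE tpermL tpermR nui !mul0r !add0r eqxx; congr (_ + _).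
    apply: eq_bigr => r /andP[ri rk]; rewrite val_panelM // (negbTE ri) (negbTE rk) mxE.
    by rewrite tpermD // eq_sym.
  - by rewrite mxE tpermL.
  have lt_rk : (r < k)%N by rewrite eq_ki ltnW.
  by rewrite mxE tpermD ?nu0 // -val_eqE gtn_eqF.
apply/ffunP=> x; rewrite [RHS]ffunE; pose nu := mu0 *m val x^-1%g.
have nu_x : nu *m val x = mu0 by rewrite -mulmxA -val_GLM mulVg val_GL1 mulmx1.
have /rV0Pn[k0 nuk0] : nu != 0 by exact: last_rowM_neq0.
case: (@arg_minnP _ k0 (fun k => nu 0 k != 0) (fun k => val k) nuk0) => k nuk k_min.
apply: (claim k k nu) => // i lt_ik; apply/eqP; apply: contraTT lt_ik => /k_min.
by rewrite -leqNgt.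
Qed.

End BigCell.

Section CellLift.
Variables p m : nat.
Local Notation Gam := (GL p m.+1).
Local Notation G := (GL p m).
Implicit Types (g h : G) (x y u : Gam) (v w : galg p m.+1) (a b : galg p m).

Definition cell_lift a w : Prop :=
  forall g u, unip u -> w (bigel g * u)%g = (u == 1%g)%:R * a g :> 'F_p.

Lemma cell_lift_exists a : in_St a -> exists2 w, in_St w & cell_lift a w.
Proof.
case/existsP=> b /eqP ->; pose e := steinberg_elt p m.+1.
(* The sign is that of the lifted permutations in steinberg_elt_bigel. *)
exists ((-1) ^+ m *: gmul e (\sum_h b h *: gconst (GLemb h))) => [|g u u_unip].
  suff : (-1) ^+ m *: gmul e (\sum_h b h *: gconst (GLemb h)) \in @in_St p m.+1 by [].
  by rewrite rpredZ //; apply/existsP; exists (\sum_h b h *: gconst (GLemb h)).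
have gconstE h y : gmul e (gconst (GLemb h)) y = e (y * (GLemb h)^-1)%g.
  rewrite ffunE (bigD1 (y * (GLemb h)^-1)%g) //= big1 => [|k ne_k].
    by rewrite [gconst _ _]ffunE invMg invgK mulgKV eqxx mulr1 addr0.
  rewrite [gconst _ _]ffunE; case: eqP => [eq_k|_]; last by rewrite mulr0.
  by rewrite -eq_k invMg invgK mulKVg eqxx in ne_k.
transitivity ((-1) ^+ m * \sum_h b h * e (bigel g * u * (GLemb h)^-1)%g : 'F_p).
  rewrite ffunE; congr (_ * _); rewrite ffunE.
  transitivity (\sum_k \sum_h b h * (e k * gconst (GLemb h) (k^-1 * (bigel g * u))%g) : 'F_p).
    apply: eq_bigr => k _; rewrite sum_ffunE mulr_sumr; apply: eq_bigr => h _.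
    by rewrite !ffunE mulrCA.
  rewrite exchange_big; apply: eq_bigr => h _.
  by rewrite -gconstE ffunE mulr_sumr.
have valE h : e (bigel g * u * (GLemb h)^-1)%g
    = (u == 1%g)%:R * ((-1) ^+ m * steinberg_elt p m (g * h^-1)%g) :> 'F_p.
  have -> : (bigel g * u * (GLemb h)^-1)%g
      = (bigel (g * h^-1) * ((GLemb h^-1)^-1 * u * GLemb h^-1))%g.
    by rewrite bigelM GLembV invgK -!mulgA mulKg.
  rewrite steinberg_elt_bigel ?unip_conj ?aff_emb // -[(_^-1 * u * _)%g]mulgA.
  by rewrite -[((GLemb h^-1)^-1 * _)%g]/(u ^ GLemb h^-1)%g conjg_eq1.
under eq_bigr => h _ do rewrite valE.
have -> : gmul (steinberg_elt p m) b g = \sum_h steinberg_elt p m (g * h^-1)%g * b h.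
  rewrite ffunE (reindex_inj invg_inj) (reindex_inj (mulIg g^-1%g)) /=.
  by apply: eq_bigr => h _; rewrite invgK mulgKV invMg invgK.
rewrite !mulr_sumr; apply: eq_bigr => h _.
have sgn : (-1) ^+ m * (-1) ^+ m = 1 :> 'F_p by rewrite -expr2 sqrr_sign.
by rewrite -[RHS]mul1r -[X in _ = X * _]sgn; ring.
Qed.

Lemma cell_lift_uniq a w w' : flag_cycle w -> flag_cycle w' -> cell_lift a w -> cell_lift a w' -> w = w'.
Proof.
move=> wC w'C wa w'a; apply/eqP; rewrite -subr_eq0; apply/eqP/cycle_eq0.
  by rewrite addrC -scaleN1r; apply: cycleD.
by move=> g u u_unip; rewrite !ffunE wa // w'a // subrr.
Qed.

End CellLift.

(** Both sides agree on the big cell. *)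
Lemma cycle_decomp p m (v : galg p m.+1) (w : GL p m.+1 -> galg p m.+1) : flag_cycle v ->
  (forall u, unip u -> flag_cycle (w u)) ->
  (forall u, unip u -> cell_lift (cell_restr (gact v u^-1%g)) (w u)) ->
  v = \sum_(u | unip u) gact (w u) u.
Proof.
move=> vC wC wl; apply/eqP; rewrite -subr_eq0; apply/eqP/cycle_eq0.
  rewrite addrC -scaleN1r; apply: cycleD => //; elim/big_rec: _ => [|u s u_unip sC].
    split=> [b x _|i j x _]; rewrite !ffunE // big1 ?addr0 // => a _.
    by rewrite ffunE.
  by rewrite -[gact _ _]scale1r; apply: cycleD => //; apply: cycle_right; apply: wC.
move=> g x x_unip; rewrite !ffunE sum_ffunE (bigD1 x) //= big1 => [|u /andP[u_unip ne_ux]].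
  rewrite addr0 ffunE mulgK -[bigel g]mulg1 wl ?unip1 // eqxx mul1r !ffunE invgK mulg1.
  by rewrite subrr.
rewrite ffunE -mulgA wl ?unipM ?unipV // -(inj_eq (mulIg u)) mulgKV mul1g eq_sym.
by rewrite (negbTE ne_ux) mul0r.
Qed.

(** The theorem of Solomon and Tits: cycles are sums of translates of cycles supported, in
  the big cell, on one translate of the cell of the smaller group, and these lift to the
  Steinberg module by induction. *)
Lemma cycle_in_St p n (v : galg p n) : flag_cycle v -> in_St v.
Proof.
elim: n v => [|m IHm] v vC.
  have all1 x y : x = y :> GL p 0 by apply/val_inj/matrixP=> -[].
  have e1 x : steinberg_elt p 0 x = 1.
    rewrite steinberg_eltE (big_pred1 1%g) => [|s]; last first.
      by have -> : s = (1%g : 'S_0); [apply/permP=> -[] | rewrite /= eqxx].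
    by rewrite odd_perm1 mul1r (_ : _ \in _) //; apply/borelP=> -[].
  apply/existsP; exists v; apply/eqP/ffunP=> x; rewrite ffunE (bigD1 1%g) //= big1 => [|y].
    by rewrite e1 mul1r addr0; congr (v _); apply: all1.
  by rewrite (all1 y 1%g) eqxx.
have [w wS wl] := fin_all_exists2 (fun u =>
  cell_lift_exists (IHm _ (cycle_restr (cycle_right u^-1%g vC)))).
rewrite (@cycle_decomp p m v w) // => [|u _]; last exact: in_St_cycle.
suff : \sum_(u | unip u) gact (w u) u \in @in_St p m.+1 by [].
apply: rpred_sum => u _; exact: (St_act_subproof (StElt (wS u)) u).
Qed.

(** The map c is the restriction to the translate by 1 of the big cell, and j extends by
  zero from it; cycle_eq0 makes the extension unique, hence linear and equivariant. *)
Lemma St_affine p m :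
  exists (c : St p m.+1 -> St p m) (j : St p m -> St p m.+1),
  [/\ linear c /\ linear j,
      forall a u, unip u -> c (act (j a) u) = if u == 1%g then a else 0,
      forall v, \sum_(u | unip u) act (j (c (act v u^-1%g))) u = v
    & forall g, (forall v, c (act v (GLemb g)) = act (c v) g) /\
                (forall a, j (act a g) = act (j a) (GLemb g))].
Proof.
have vC (v : St p m.+1) : flag_cycle (val (v : St_type p m.+1)) by apply: in_St_cycle; exact: valP v.
have cell_restrS (v : St_type p m.+1) : in_St (cell_restr (val v)).
  by apply/cycle_in_St/cycle_restr/in_St_cycle; exact: valP v.
pose c v := StElt (cell_restrS v).
have lift_ex (a : St_type p m) : exists w : St_type p m.+1, [forall g, forall u, unip u ==>
    (val w (bigel g * u)%g == (u == 1%g)%:R * val a g :> 'F_p)].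
  have [w wS wl] := cell_lift_exists (valP a).
  exists (StElt wS); apply/forallP=> g; apply/forallP=> u; apply/implyP=> u_unip.
  exact/eqP/wl.
pose j a := xchoose (lift_ex a).
have jP a : cell_lift (val a) (val (j a)).
  move=> g u u_unip; have /forallP/(_ g)/forallP/(_ u) := xchooseP (lift_ex a).
  by rewrite u_unip => /eqP.
have j_uniq a w : cell_lift (val a) (val w) -> w = j a.
  move=> wa; apply: val_inj; apply: (cell_lift_uniq _ _ wa (jP a)); exact: in_St_cycle (valP _).
exists c, j; split.
- split=> [e v w|e a b]; first by apply: val_inj; apply: cell_restr_linear.
  apply/esym/j_uniq => g u u_unip.
  have -> : val (e *: j a + j b) (bigel g * u)%g
      = e * val (j a) (bigel g * u)%g + val (j b) (bigel g * u)%g :> 'F_p by rewrite !ffunE.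
  rewrite !jP //; have -> : val ((e *: a + b) : St p m) g = e * val a g + val b g :> 'F_p.
    by rewrite !ffunE.
  by rewrite mulrDr mulrCA.
- move=> a u u_unip; apply: val_inj; apply/ffunP=> g.
  rewrite [LHS]ffunE [LHS]ffunE (jP a g _) ?unipV // invg_eq1.
  by case: eqP => [_|_]; rewrite ?mul1r // mul0r ffunE.
- move=> v; apply: val_inj.
  have valS (w : GL p m.+1 -> St_type p m.+1) :
      val (\sum_(u | unip u) w u) = \sum_(u | unip u) val (w u) by rewrite raddf_sum.
  rewrite valS; apply/esym/(cycle_decomp (w := fun u => val (j (c (act v u^-1%g))))) => //.
  by move=> u _; exact: jP.
move=> g; split=> [v|a]; first by apply: val_inj; apply: cell_restr_emb.
apply/esym/j_uniq => h u u_unip.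
rewrite [LHS]ffunE.
have -> : (bigel h * u * (GLemb g)^-1)%g
    = (bigel (h * g^-1) * ((GLemb g^-1)^-1 * u * GLemb g^-1))%g.
  by rewrite bigelM GLembV invgK -!mulgA mulKg.
rewrite jP ?unip_conj ?aff_emb // -[(_^-1 * u * _)%g]mulgA.
rewrite -[((GLemb g^-1)^-1 * _)%g]/(u ^ GLemb g^-1)%g conjg_eq1.
by congr (_ * _); rewrite [RHS]ffunE.
Qed.

(** * Traces and induced modules *)

Section Traces.
Variables (p : nat) (p_prime : prime p).

Definition act_lin (gT : finGroupType) (X : rmodule p gT) g := lin_sum (@act_linear p gT X g).

Section Projectivity.
Variables (gT : finGroupType) (P : rmodule p gT).

Definition trace (D : pred gT) (al : P -> P) (x : P) : P :=
  \sum_(g | D g) act (al (act x g^-1%g)) g.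

(** Higman's criterion: the trace turns a linear lift, composed with al, into an
  equivariant one. *)
Lemma projective_of_trace (al : P -> P) : linear al -> (forall x, trace predT al x = x) ->
  projective P.
Proof.
move=> al_lin tr1 X Y f g f_surj.
have [s s_lin fsK] := linear_section (linearP f) f_surj.
pose h x := \sum_u act (s (g (al (act x u^-1%g)))) u.
have h_lin : linear h.
  move=> c x y; rewrite /h scaler_sumr -big_split; apply: eq_bigr => u _ /=.
  by rewrite act_linear al_lin linearP s_lin act_linear.
have h_act x v : h (act x v) = act (h x) v.
  rewrite /h act_lin (reindex_inj (mulIg v)); apply: eq_bigr => u _ /=.
  by rewrite -!actM invMg mulKVg.
pose H : {linear P -> X} := HB.pack h (GRing.isLinear.Build 'F_p P X *:%R h h_lin).
exists (RHom (rfun := H) h_act) => x.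
transitivity (g (trace predT al x)); last by rewrite tr1.
rewrite /= /h /trace !raddf_sum; apply: eq_bigr => u _.
by rewrite /= !rhom_act fsK.
Qed.

End Projectivity.

Section AffineTrace.
Variables (m : nat) (P : rmodule p (GL p m.+1)).

(** The elements moving the last coordinate form to nu are a coset of the affine
  group. *)
Lemma trace_coset (al : P -> P) nu x : (forall x, trace (@aff p m) al x = x) -> nu != 0 ->
  \sum_(g : GL p m.+1 | last_row p m *m val g == nu) act (al (act x g^-1%g)) g = x.
Proof.
move=> tr1 /last_transitive[y mu0y]; rewrite (reindex_inj (mulIg y)) /=.
transitivity (act (trace (@aff p m) al (act x y^-1%g)) y); last first.
  by rewrite tr1 -actM mulVg act1.
rewrite /trace act_lin; apply: eq_big => g.
  rewrite mulmxA -mu0y affE (can_eq (mulmxK _)) //; exact: valP.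
by rewrite -!actM -invMg.
Qed.

(** The trace over Gamma is the sum over the p ^ (m + 1) - 1 cosets of the affine group of
  traces that are all equal to x. *)
Lemma trace_aff (al : P -> P) : linear al ->
  (forall x, trace (@aff p m) al x = x) -> forall x, trace predT (fun x => - al x) x = x.
Proof.
move=> al_lin tr1 x; pose F g := act (al (act x g^-1%g)) g.
transitivity (- \sum_g F g).
  by rewrite -sumrN; apply: eq_bigr => g _; rewrite (linN (act_linear g)).
rewrite (partition_big (fun g : GL p m.+1 => last_row p m *m val g) (fun nu => nu != 0)) /=; last first.
  by move=> g _; exact: last_rowM_neq0.
rewrite (eq_bigr (fun=> x)) => [|nu nu_neq0]; last exact: trace_coset.
rewrite sumr_const.
have -> : #|(fun nu : 'rV['F_p]_m.+1 => nu != 0)| = (p ^ m.+1).-1.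
  by rewrite cardC1 card_mx card_Fp ?mul1n.
apply/eqP; rewrite eq_sym -addr_eq0 -mulrS prednK ?expn_gt0 ?prime_gt0 //.
by rewrite -scaler_nat expnS natrM pchar_Fp_0 // mul0r scale0r.
Qed.

End AffineTrace.

(** Restricted to the affine group, P is induced from Q along the linear part. *)
Definition affine_induced m (P : rmodule p (GL p m.+1)) (Q : rmodule p (GL p m))
    (c : P -> Q) (j : Q -> P) : Prop :=
  [/\ linear c /\ linear j,
      forall a u, unip u -> c (act (j a) u) = if u == 1%g then a else 0,
      forall v, \sum_(u | unip u) act (j (c (act v u^-1%g))) u = v
    & forall g, (forall v, c (act v (GLemb g)) = act (c v) g) /\
                (forall a, j (act a g) = act (j a) (GLemb g))].

Lemma affine_induced_trace m (P : rmodule p (GL p m.+1)) (Q : rmodule p (GL p m))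
    (c : P -> Q) (j : Q -> P) (be : Q -> Q) :
  affine_induced c j -> linear be -> (forall x, trace predT be x = x) ->
  forall x, trace (@aff p m) (j \o be \o c) x = x.
Proof.
case=> -[c_lin j_lin] cj jc cjE be_lin tr1 x; rewrite /trace big_aff -[RHS]jc.
apply: eq_bigr => u u_unip; rewrite -[c _]tr1 /trace (lin_sum j_lin) act_lin.
apply: eq_bigr => g _ /=.
by rewrite invMg !actM -GLembV (cjE _).1 (cjE _).2.
Qed.

Lemma St_trace n : exists2 be : St p n -> St p n, linear be & forall x, trace predT be x = x.
Proof.
elim: n => [|m [be be_lin tr1]].
  exists id => // x; rewrite /trace (big_pred1 1%g) ?invg1 ?act1 // => y.
  by have -> : y = 1%g; [apply/val_inj/matrixP=> -[] | rewrite /= eqxx].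
have [c [j cjP]] := St_affine p m; have tr_aff := affine_induced_trace cjP be_lin tr1.
case: cjP tr_aff => -[c_lin j_lin] _ _ _ tr_aff.
have al_lin : linear (j \o be \o c) by move=> e x y /=; rewrite c_lin be_lin j_lin.
exists (fun x => - (j \o be \o c) x); last exact: trace_aff.
by move=> e x y; rewrite al_lin opprD scalerN.
Qed.

Section Tensor.
Variables (gT : finGroupType) (A B T : rmodule p gT) (t : A -> B -> T).
Hypothesis tP : tensor_product t.

Lemma tensor_ext (C : lmodType 'F_p) (f f' : T -> C) : linear f -> linear f' ->
  (forall x y, f (t x y) = f' (t x y)) -> f =1 f'.
Proof.
move=> f_lin f'_lin eq_ff' z; have [L LE] := linE f_lin; have [L' L'E] := linE f'_lin.
have [tl tr] := tens_bilinear tP.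
have bil : bilinear_map (fun x y => f (t x y)).
  split=> [x e y y'|y e x x']; first by rewrite tl f_lin.
  by rewrite tr f_lin.
have [h [_ h_uniq]] := tens_universal tP bil.
rewrite -LE -L'E (h_uniq L) ?(h_uniq L') // => x y.
by rewrite L'E -eq_ff'.
Qed.

Lemma tensor_lift (C : lmodType 'F_p) (c : A -> B -> C) : bilinear_map c ->
  exists2 f : T -> C, linear f & forall x y, f (t x y) = c x y.
Proof.
by move=> /(tens_universal tP)[f [fE _]]; exists f => //; apply: linearP.
Qed.

End Tensor.

(** Only the first factor is moved by the endomorphism, and the diagonal actions on the
  second one cancel. *)
Lemma tensor_trace (gT : finGroupType) (A B T : rmodule p gT) (t : A -> B -> T)
    (be : A -> A) :
  tensor_product t -> linear be -> (forall x, trace predT be x = x) ->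
  exists2 be' : T -> T, linear be' & forall x, trace predT be' x = x.
Proof.
move=> tP be_lin tr1; have [tl tr] := tens_bilinear tP.
have [|be' be'_lin be'E] := tensor_lift tP (c := fun x y => t (be x) y).
  by split=> [x e y y'|y e x x']; rewrite ?tl // be_lin tr.
exists be' => //; apply: (tensor_ext tP) => // [e x y|x y].
  rewrite /trace scaler_sumr -big_split; apply: eq_bigr => g _ /=.
  by rewrite act_linear be'_lin act_linear.
rewrite -[x in RHS]tr1 /trace (lin_sum (tr y)); apply: eq_bigr => g _.
by rewrite -(tens_diagonal tP) be'E -(tens_diagonal tP) -actM mulVg act1.
Qed.

(** The tensor identity for induced modules. *)
Lemma tensor_induced m (A B T : rmodule p (GL p m.+1)) (A' T' : rmodule p (GL p m))
    (t : A -> B -> T) (t' : A' -> Res B -> T') (c : A -> A') (j : A' -> A) :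
  tensor_product t -> tensor_product t' -> affine_induced c j ->
  exists (c' : T -> T') (j' : T' -> T), affine_induced c' j'.
Proof.
move=> tP t'P [[c_lin j_lin] cj jc cjE].
have [tl tr] := tens_bilinear tP; have [t'l t'r] := tens_bilinear t'P.
have [|c' c'_lin c'E] := tensor_lift tP (c := fun x y => t' (c x) y).
  by split=> [x e y y'|y e x x']; rewrite ?t'l // c_lin t'r.
have [|j' j'_lin j'E] := tensor_lift t'P (c := fun x y => t (j x) y).
  by split=> [x e y y'|y e x x']; rewrite ?tl // j_lin tr.
exists c', j'; split=> // [a u u_unip|v|g].
- move: a; apply: (tensor_ext t'P) => [e x y|e x y|x y].
  + by rewrite j'_lin act_linear c'_lin.
  + by case: eqP => // _; rewrite scaler0 addr0.
  rewrite j'E -(tens_diagonal tP) c'E cj //; case: eqP => [->|_]; first by rewrite act1.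
  by rewrite (lin0 (t'r _)).
- move: v; apply: (tensor_ext tP) => // [e x y|x y].
    rewrite scaler_sumr -big_split; apply: eq_bigr => g _ /=.
    by rewrite act_linear c'_lin j'_lin act_linear.
  rewrite -[x in RHS]jc (lin_sum (tr y)); apply: eq_bigr => g _.
  by rewrite -(tens_diagonal tP) c'E j'E -(tens_diagonal tP) -actM mulVg act1.
split.
  apply: (tensor_ext tP) => [e x y|e x y|x y].
  + by rewrite act_linear c'_lin.
  + by rewrite c'_lin act_linear.
  by rewrite -(tens_diagonal tP) !c'E -(tens_diagonal t'P) (cjE g).1.
apply: (tensor_ext t'P) => [e x y|e x y|x y].
+ by rewrite act_linear j'_lin.
+ by rewrite j'_lin act_linear.
by rewrite -(tens_diagonal t'P) !j'E -(tens_diagonal tP) (cjE g).2.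
Qed.

End Traces.

(** * Equivariant maps to the augmentation ideal *)

Section HVLinear.
Variables p n : nat.

Lemma hsubstE k (a : 'I_k -> HV p n) (b : 'I_k -> {mpoly 'F_p[n]}) z K :
  hsubst a b z K = \sum_(I : {set 'I_k})
    (\big[@hmul p n/hpoly 1]_(i <- enum I) a i) K * comp_mpoly [tuple b i | i < k] (z I).
Proof. by rewrite /hsubst sum_ffunE; apply: eq_bigr => I _; exact: hmul_hpoly. Qed.

Lemma HV_linE k c (u v : HV p k) I : (c *: u + v) I = c *: u I + v I.
Proof. by rewrite !ffunE. Qed.

Lemma hsubst_linear k (a : 'I_k -> HV p n) (b : 'I_k -> {mpoly 'F_p[n]}) :
  linear (hsubst a b).
Proof.
move=> c u v; apply/ffunP=> K; rewrite HV_linE.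
apply: (etrans (hsubstE a b _ K)).
apply: (etrans _ (congr2 (fun x y => c *: x + y) (esym (hsubstE a b u K)) (esym (hsubstE a b v K)))).
rewrite scaler_sumr -big_split; apply: eq_bigr => I _ /=.
by rewrite HV_linE comp_mpolyD comp_mpolyZ mulrDr scalerAr.
Qed.

Lemma pullback_linear k (A : 'M['F_p]_(k, n)) : linear (pullback A).
Proof. exact: hsubst_linear. Qed.

Lemma homogeneous_lin d c (u v : HV p n) :
  homogeneous d u -> homogeneous d v -> homogeneous d (c *: u + v).
Proof.
move=> uh vh I m; rewrite !ffunE => /msuppD_le; rewrite mem_cat => /orP[/msuppZ_le|]; first exact: uh.
exact: vh.
Qed.

Lemma homogeneous0 d : homogeneous d (0 : HV p n).
Proof. by move=> I m; rewrite ffunE msupp0. Qed.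

Lemma FVH_linE c (F G : FVH p n) nu : (c *: F + G) nu = c *: F nu + G nu.
Proof. by rewrite !ffunE. Qed.

Lemma FVH_actE (F : FVH p n) g nu :
  FVH_act F g nu = pullback (val g) (F (nu *m val (g^-1)%g)).
Proof. by rewrite ffunE. Qed.

Lemma FVH_act_linear g : linear ((@FVH_act p n)^~ g).
Proof.
move=> c F G; apply/ffunP=> nu; pose mu := nu *m val (g^-1)%g.
apply: (etrans (FVH_actE (c *: F + G) g nu)); rewrite -/mu.
apply: (etrans (congr1 (pullback (val g)) (FVH_linE c F G mu))).
apply: (etrans (pullback_linear (val g) c (F mu) (G mu))).
apply: (etrans _ (esym (FVH_linE c (FVH_act F g) (FVH_act G g) nu))).
exact: (congr2 (fun a b => c *: a + b) (esym (FVH_actE F g nu)) (esym (FVH_actE G g nu))).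
Qed.

Lemma in_N_lin (P : rmodule p (GL p n)) d c (F G : P -> FVH p n) :
  in_N d F -> in_N d G -> in_N d (fun x => c *: F x + G x).
Proof.
case=> F_lin F_I F_act F_h [G_lin G_I G_act G_h]; split=> [e x y|x|x g|x mu].
- by rewrite F_lin G_lin; exact: lin_exchange.
- rewrite /in_IVH; under eq_bigr => mu _ do rewrite FVH_linE.
  by rewrite big_split -scaler_sumr /= (F_I x) (G_I x) scaler0 addr0.
- by rewrite F_act G_act; apply/esym/FVH_act_linear.
by rewrite FVH_linE; apply: homogeneous_lin.
Qed.

End HVLinear.

Section Average.
Variables (p : nat) (p_prime : prime p) (m : nat).
Local Notation J := (incl_mx p m).
Local Notation rho := (proj_mx p m).
Local Notation mu0 := (last_row p m).
Local Notation Gam := (GL p m.+1).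
Local Notation G := (GL p m).
Local Notation S := {mpoly 'F_p[m.+1]}.
Variable (P : rmodule p Gam).

(** Multiplication by the classes of H of positive degree becomes 0 after this restriction. *)
Definition hyper_res (F : P -> FVH p m.+1) (x : P) : {mpoly 'F_p[m]} := pull J (spart (F x mu0)).

(** The values of hyper_res: maps that are equivariant for the affine group acting through
  linear parts. *)
Definition affmap d (f : P -> {mpoly 'F_p[m]}) : Prop :=
  [/\ linear f, forall x a, aff a -> f (act x a) = pull (lin_mx a) (f x)
    & forall x, f x \is d.-homog].

Lemma pull_linear k n (A : 'M['F_p]_(k, n)) : linear (pull A).
Proof. by move=> c f g; rewrite pullD pullZ. Qed.

Lemma in_N_act d (F : P -> FVH p m.+1) x (g : Gam) nu : in_N d F ->
  F (act x g) (nu *m val g) = pullback (val g) (F x nu).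
Proof.
case=> _ _ F_act _; rewrite F_act ffunE -mulmxA -val_GLM mulgV val_GL1 mulmx1.
by [].
Qed.

Lemma hyper_res_affmap d (F : P -> FVH p m.+1) : in_N (ywt p * d) F -> affmap d (hyper_res F).
Proof.
move=> FN; have [F_lin _ _ F_h] := FN; split=> [c x y|x a aa|x].
- by rewrite /hyper_res F_lin FVH_linE (spart_linear p_prime) pull_linear.
- rewrite /hyper_res; move: (aa); rewrite affE => /eqP mu0a.
  rewrite -{1}mu0a (in_N_act _ _ _ FN) spart_pullback // !pull_comp //.
  by rewrite (aff_incl aa).
by rewrite /hyper_res; apply: pull_homog; apply: spart_homog.
Qed.

Lemma pull0_const k n f : pull (0 : 'M['F_p]_(k, n)) f = (f@_0%MM)%:MP.
Proof.
elim/mpoly_alg_ind: f => [c|f g IHf IHg|i f IHf]; first by rewrite pullC mcoeffC eqxx mulr1.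
  by rewrite pullD IHf IHg mcoeffD mpolyCD.
rewrite pullM pullXi big1 ?mul0r => [|j _]; last by rewrite mxE scale0r.
by rewrite (rmorphM (mcoeff 0%MM)) /= mcoeffX mnm1_eq0 mul0r.
Qed.

Lemma spart_mcoeff0 k e (u : HV p k) : (0 < e)%N -> homogeneous e u -> (spart u)@_0%MM = 0.
Proof.
move=> e_gt0 u_h; case: (boolP (p == 2)) => [p2|p_odd].
  have /dhomogP su_h : spart u \is e.-homog.
    by apply: spart_homog => //; rewrite /ywt p2 mul1n.
  by apply: contraTeq e_gt0; rewrite -mcoeff_msupp => /su_h /= <-; rewrite mdeg0.
rewrite spartE (bigD1 set0) //= chi_odd // eqxx mul1r big1 => [|I I0]; last first.
  by rewrite chi_odd // (negbTE I0) mul0r.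
rewrite addr0 /tau (negbTE p_odd).
by apply: contraTeq e_gt0; rewrite -mcoeff_msupp => /u_h <-; rewrite mdeg0 cards0.
Qed.

Lemma Hact_neq0 u (F : FVH p m.+1) nu : nu != 0 -> Hact u F nu = hmul (pullback nu u) (F nu).
Proof.
move=> nu_neq0; rewrite /Hact sum_ffunE (bigD1 nu) //= big1 => [|mu ne_mu].
  by rewrite ffunE eqxx (negbTE nu_neq0) scale1r scale0r subr0 addr0.
by rewrite ffunE [nu == mu]eq_sym (negbTE ne_mu) (negbTE nu_neq0) !scale0r subr0.
Qed.

(** At mu0, a class of H of positive degree acts through a multiple of the class of
  mu0, up to exterior classes. *)
Lemma hyper_res_HplusN d (F : P -> FVH p m.+1) : in_HplusN d F -> forall x, hyper_res F x = 0.
Proof.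
case=> r [e [d' [u [H [uH FE]]]]] x; rewrite /hyper_res FE sum_ffunE spart_sum // pull_sum big1 // => k _.
have [e_gt0 _ u_h _] := uH k; rewrite Hact_neq0 ?last_row_neq0 // spartM // pullM.
rewrite spart_pullback // pull_comp // last_incl pull0_const (spart_mcoeff0 e_gt0 u_h).
by rewrite mul0r.
Qed.

Section WithTrace.
Variable al : P -> P.
Hypotheses (al_lin : linear al) (al_tr : forall x, trace (@aff p m) al x = x).

(** The sum over Gamma of the translates of (mu0) (x) k, precomposed with al. *)
Definition avgS (k : P -> S) (x : P) (nu : 'rV['F_p]_m.+1) : S :=
  \sum_(g : Gam) ((nu == mu0 *m val g)%:R - (nu == 0)%:R : 'F_p)
                 *: pull (val g) (k (al (act x g^-1%g))).

Definition avg k x : FVH p m.+1 := [ffun nu => rpart (avgS k x nu)].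

Lemma avg_in_N d k : linear k -> (forall x, k x \is d.-homog) -> in_N (ywt p * d) (avg k).
Proof.
move=> k_lin k_h; split=> [c x y|x|x g|x mu].
- apply/ffunP=> nu; rewrite !ffunE -linearZ -raddfD /=; congr rpart.
  rewrite /avgS scaler_sumr -big_split; apply: eq_bigr => g _ /=.
  by rewrite act_linear al_lin k_lin pull_linear scalerDr !scalerA mulrC.
- rewrite /in_IVH; under eq_bigr => nu _ do rewrite ffunE.
  rewrite -(raddf_sum (rpart (n := m.+1))) /= /avgS exchange_big big1 ?raddf0 // => g _.
  rewrite -scaler_suml sumrB (bigD1 (mu0 *m val g)) //= eqxx big1 => [|nu /negbTE -> //].
  by rewrite (bigD1 0) //= eqxx big1 => [|nu /negbTE -> //]; rewrite subrr scale0r.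
- apply/ffunP=> nu; rewrite !ffunE pullback_rpart //; congr rpart.
  rewrite /avgS pull_sum (reindex_inj (mulIg g)); apply: eq_bigr => h _ /=.
  rewrite pullZ pull_comp // -actM invMg mulKVg; congr ((_%:R - _%:R) *: _).
    by congr nat_of_bool; apply/idP/idP => /eqP E; apply/eqP; [rewrite E mulmxA mulmxK ?(valP g) | rewrite mulmxA -E mulmxKV ?(valP g)].
  congr nat_of_bool; apply/idP/idP => /eqP E; apply/eqP; first by rewrite E mul0mx.
  by rewrite -[nu](mulmxKV (valP g)) E mul0mx.
rewrite ffunE; apply: rpart_homog => //; rewrite /avgS.
apply: rpred_sum => g _; apply: rpredZ; apply: pull_homog; exact: k_h.
Qed.

Lemma avgS_neq0 k x nu : nu != 0 ->
  avgS k x nu = \sum_(g : Gam | mu0 *m val g == nu) pull (val g) (k (al (act x g^-1%g))).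
Proof.
move=> nu_neq0; rewrite /avgS (negbTE nu_neq0) [RHS]big_mkcond; apply: eq_bigr => g _.
by rewrite subr0 eq_sym; case: eqP; rewrite ?scale1r ?scale0r.
Qed.

(** Only the affine elements contribute to the component at mu0, and they add up to the
  trace of al. *)
Lemma hyper_res_avg d f : affmap d f -> forall x, hyper_res (avg (fun y => pull rho (f y))) x = f x.
Proof.
case=> f_lin f_act _ x; rewrite /hyper_res ffunE rpartK // avgS_neq0 ?last_row_neq0 // pull_sum.
rewrite -[in RHS](al_tr x) /trace (lin_sum f_lin); apply: eq_big => g; first by rewrite affE.
rewrite -affE => ga; rewrite !pull_comp // mulmxA -lin_mxE.
by rewrite f_act.
Qed.

(** An equivariant map is determined by its component at mu0, as Gamma permutes the nonzero
  forms transitively. *)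
Lemma in_N_avg d (F : P -> FVH p m.+1) x nu : in_N d F -> nu != 0 ->
  spart (F x nu) = avgS (fun y => spart (F y mu0)) x nu.
Proof.
move=> FN nu_neq0; have [F_lin _ _ _] := FN; rewrite avgS_neq0 //.
rewrite -[in LHS](trace_coset x al_tr nu_neq0) (lin_sum F_lin) sum_ffunE spart_sum //.
apply: eq_bigr => g /eqP <-; rewrite (in_N_act _ _ _ FN) spart_pullback //.
Qed.

End WithTrace.
End Average.

Section Divisibility.
Variables (p : nat) (p_prime : prime p) (m : nat).
Local Notation J := (incl_mx p m).
Local Notation rho := (proj_mx p m).
Local Notation mu0 := (last_row p m).
Local Notation S := {mpoly 'F_p[m.+1]}.

Lemma linform_last : linform mu0 = 'X_ord_max :> S.
Proof.
rewrite linformE (bigD1 ord_max) //= last_rowE eqxx scale1r big1 ?addr0 // => j /negbTE ne_j.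
by rewrite last_rowE ne_j scale0r.
Qed.

Lemma pull_incl_projX (e : 'X_{1..m.+1}) :
  pull (J *m rho) ('X_[e] : S) = (e ord_max == 0)%:R *: 'X_[e].
Proof.
have pX i : pull (J *m rho) ('X_i : S) = (i != ord_max)%:R *: 'X_i.
  rewrite pullXi; have JrE j : (J *m rho) i j = (i == j)%:R - (i == ord_max)%:R * (j == ord_max)%:R.
    rewrite -[J *m rho](addrK (last_col p m *m mu0)) incl_projD !mxE; congr (_ - _).
    by rewrite big_ord1 last_rowE -[last_col p m]mul1mx mul_last_col mxE.
  under eq_bigr => j _ do rewrite JrE scalerBl -scalerA.
  rewrite sumrB -scaler_sumr (bigD1 i) //= eqxx scale1r big1 => [|j ne_j]; last first.
    by rewrite eq_sym (negbTE ne_j) scale0r.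
  rewrite (bigD1 ord_max) //= eqxx scale1r [X in _ - _ *: (_ + X)]big1 => [|j /negbTE ->]; last first.
    by rewrite scale0r.
  by rewrite !addr0; case: eqP => [->|_]; rewrite ?scale1r ?subrr ?scale0r ?subr0.
rewrite mpolyXE_id rmorph_prod; have [e0|e0] := eqVneq (e ord_max) 0%N.
  rewrite scale1r; apply: eq_bigr => i _; rewrite rmorphXn /= pX.
  by case: eqP => [->|_]; rewrite ?e0 ?expr0 // scale1r.
rewrite scale0r (bigD1 ord_max) //= rmorphXn /= pX eqxx scale0r expr0n (negbTE e0) mul0r.
by [].
Qed.

(** A polynomial vanishing on the hyperplane is divisible by the last coordinate, so that
  averaging its quotient provides a preimage under multiplication by the generator of H. *)
Lemma last_divides d (f : S) : f \is d.-homog -> pull J f = 0 ->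
  exists2 f', f' \is d.-1.-homog & f = linform mu0 * f'.
Proof.
move=> f_h f0; have /dhomogP fd := f_h.
have eU (e : 'X_{1..m.+1}) : e ord_max != 0%N -> (U_(ord_max) + (e - U_(ord_max)) = e)%MM.
  by move=> e0; rewrite addmC submK // lep1mP.
(* The monomials without the last variable form the restriction of f to the hyperplane. *)
exists (\sum_(e <- msupp f | e ord_max != 0%N) f@_e *: 'X_[e - U_(ord_max)]).
  rewrite big_seq_cond; apply: rpred_sum => e /andP[ef e0]; apply: rpredZ.
  have de : mdeg e = (mdeg (e - U_(ord_max))%MM).+1 by rewrite -{1}(eU e e0) mdegD mdeg1.
  by rewrite dhomogX; apply/eqP; have <- : mdeg e = d := fd _ ef; rewrite de.
rewrite linform_last mulr_sumr [LHS]mpolyE (bigID (fun e : 'X_{1..m.+1} => e ord_max == 0%N)) /=.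
rewrite [X in X + _](_ : _ = 0) ?add0r.
  apply: eq_bigr => e e0; rewrite -scalerAr -mpolyXD; congr (_ *: 'X_[_]).
  by rewrite eU.
transitivity (pull rho (pull J f)); last by rewrite f0 pull0.
rewrite pull_comp // [in RHS](mpolyE f) pull_sum big_mkcond; apply: eq_bigr => e _.
by rewrite pullZ pull_incl_projX; case: eqP; rewrite ?scale1r // scale0r scaler0.
Qed.

End Divisibility.

Section Indecomposables.
Variables (p : nat) (p_prime : prime p) (m : nat).
Local Notation J := (incl_mx p m).
Local Notation rho := (proj_mx p m).
Local Notation mu0 := (last_row p m).
Local Notation Gam := (GL p m.+1).
Local Notation S := {mpoly 'F_p[m.+1]}.

Lemma in_IVH_ext (F F' : FVH p m.+1) : in_IVH F -> in_IVH F' ->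
  (forall nu, nu != 0 -> F nu = F' nu) -> F = F'.
Proof.
rewrite /in_IVH (bigD1 0) //= => F0; rewrite (bigD1 0) //= => F'0 eqF.
apply/ffunP=> nu; have [->|] := eqVneq nu 0; last exact: eqF.
by apply: (addIr (\sum_(i | i != 0) F i)); rewrite F0 (eq_bigr F' eqF) F'0.
Qed.

Lemma sum_aug (V : lmodType 'F_p) (mu : 'rV['F_p]_m.+1) (z : V) :
  \sum_nu ((nu == mu)%:R *: z - (nu == 0)%:R *: z) = 0.
Proof.
rewrite sumrB -!scaler_suml (bigD1 mu) //= eqxx big1 => [|nu /negbTE -> //].
by rewrite (bigD1 0) //= eqxx big1 => [|nu /negbTE -> //]; rewrite subrr.
Qed.

Lemma Hact_IVH u (F : FVH p m.+1) : in_IVH (Hact u F).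
Proof.
rewrite /in_IVH; under eq_bigr => nu _ do rewrite /Hact sum_ffunE.
rewrite exchange_big big1 // => mu _; apply: etrans (sum_aug mu _).
by apply: eq_bigr => nu _; rewrite ffunE.
Qed.

Variable P : rmodule p Gam.
Variable al : P -> P.
Hypotheses (al_lin : linear al) (al_tr : forall x, trace (@aff p m) al x = x).

Lemma avg_HplusN d (k : P -> S) : linear k -> (forall x, k x \is d.-homog) ->
  (forall x, pull J (k x) = 0) -> in_HplusN (ywt p * d) (avg al k).
Proof.
move=> k_lin k_h k0; case: d k_h => [|d] k_h.
  have k_eq0 x : k x = 0.
    have [f' f'_h kE] := last_divides p_prime (k_h x) (k0 x).
    have /dhomogP k1 : k x \is 1.-homog.
      by rewrite kE -[1%N]addn0; apply: dhomogM => //; apply: linform_homog.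
    apply/eqP; rewrite -msupp_eq0; case: (msupp _) k1 (dhomogP _ _ _ (k_h x)) => // e s k1 k0'.
    by have := k1 e (mem_head _ _); rewrite /= (k0' e (mem_head _ _)).
  exists 0%N, (fun=> 0%N), (fun=> 0%N), (fun=> 0), (fun _ _ => 0); split=> [[]//|x].
  rewrite big_ord0; apply/ffunP=> nu; rewrite !ffunE /avgS big1 ?raddf0 // => g _.
  by rewrite k_eq0 pull0 scaler0.
have k_div x : {f' : S | f' \is d.-homog /\ k x = linform mu0 * f'}.
  apply: boolp.constructive_indefinite_description.
  by have [f' f'_h kE] := last_divides p_prime (k_h x) (k0 x); exists f'.
pose k' x := sval (k_div x).
have k'_h x : k' x \is d.-homog by case: (svalP (k_div x)).
have kE x : k x = linform mu0 * k' x by case: (svalP (k_div x)).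
have mu0_neq0 : linform mu0 != 0 by rewrite linform_eq0 last_row_neq0.
have k'_lin : linear k'.
  move=> c x y; apply: (mulfI mu0_neq0).
  by rewrite -kE k_lin !kE mulrDr scalerAr.
have avgN := avg_in_N p_prime al_lin k_lin k_h.
have avgN' := avg_in_N p_prime al_lin k'_lin k'_h.
exists 1%N, (fun=> ywt p), (fun=> (ywt p * d)%N), (fun=> rpart ('X_ord0 : {mpoly 'F_p[1]})),
  (fun _ => avg al k'); split=> [_|x].
  split=> //; first by rewrite /ywt; case: eqP.
    by rewrite mulnS.
  by rewrite -[X in homogeneous X _]muln1; apply: rpart_homog => //; rewrite dhomogX /= mdeg1.
rewrite big_ord1; apply: in_IVH_ext; [by case: avgN | exact: Hact_IVH | move=> nu nu_neq0].
rewrite Hact_neq0 // [avg al k x nu]ffunE [avg al k' x nu]ffunE pullback_rpart // rpartM //.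
congr rpart; rewrite !avgS_neq0 // mulr_sumr; apply: eq_bigr => g /eqP <-.
by rewrite kE pullM pull_linform // linform.unlock.
Qed.

(** The part of F without exterior classes. *)
Definition pure (F : P -> FVH p m.+1) (x : P) : FVH p m.+1 :=
  [ffun nu => rpart (spart (F x nu))].

Lemma pure_in_N d (F : P -> FVH p m.+1) : in_N (ywt p * d) F -> in_N (ywt p * d) (pure F).
Proof.
case=> F_lin F_I F_act F_h; split=> [c x y|x|x g|x nu].
- apply/ffunP=> nu; rewrite FVH_linE [LHS]ffunE F_lin FVH_linE (spart_linear p_prime).
  by rewrite [pure F x nu]ffunE [pure F y nu]ffunE linearP.
- rewrite /in_IVH; under eq_bigr => nu _ do rewrite ffunE.
  by rewrite -(raddf_sum (rpart (n := m.+1))) /= -spart_sum // F_I spart0 // raddf0.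
- apply/ffunP=> nu; rewrite FVH_actE [LHS]ffunE F_act FVH_actE [pure F x _]ffunE.
  by rewrite spart_pullback // pullback_rpart.
by rewrite ffunE; apply: rpart_homog => //; apply: spart_homog.
Qed.

Lemma pure_avg d (F : P -> FVH p m.+1) x : in_N (ywt p * d) F ->
  pure F x = avg al (fun y => spart (F y mu0)) x.
Proof.
move=> FN; have [F_lin _ _ F_h] := FN.
have kN : in_N (ywt p * d) (avg al (fun y => spart (F y mu0))).
  apply: avg_in_N => // [c y z|y]; first by rewrite F_lin FVH_linE (spart_linear p_prime).
  exact: spart_homog.
apply: in_IVH_ext; [by case: (pure_in_N FN) | by case: kN | move=> nu nu_neq0].
by rewrite [LHS]ffunE [RHS]ffunE (in_N_avg p_prime al_tr x FN nu_neq0).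
Qed.

Lemma pure_HplusN d (F : P -> FVH p m.+1) : in_N (ywt p * d) F ->
  (forall x, hyper_res F x = 0) -> in_HplusN (ywt p * d) (pure F).
Proof.
move=> FN F0; have [F_lin _ _ F_h] := FN.
have [|||r [e [d' [u [H [uH FE]]]]]] := @avg_HplusN d (fun y => spart (F y mu0)).
- by move=> c y z; rewrite F_lin FVH_linE (spart_linear p_prime).
- by move=> y; apply: spart_homog.
- exact: F0.
by exists r, e, d', u, H; split=> // x; rewrite (pure_avg x FN).
Qed.

End Indecomposables.

(** * Equivariant maps on the values of the functor *)

Section DeltaMaps.
Variables (p : nat) (p_prime : prime p) (m : nat) (delta : delta_functor p m).
Local Notation J := (incl_mx p m).
Local Notation rho := (proj_mx p m).
Local Notation mu0 := (last_row p m).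
Local Notation Gam := (GL p m.+1).
Local Notation T := {mpoly 'F_p[m]}.

Definition aff_split (P : rmodule p Gam) (al : P -> P) : Prop :=
  linear al /\ forall x, trace (@aff p m) al x = x.

Definition eqmap (Q : rmodule p (GL p m)) d (f : Q -> T) : Prop :=
  [/\ linear f, forall y g, f (act y g) = pull (val g) (f y) & forall y, f y \is d.-homog].

Section OneModule.
Variables (P : projmod p Gam) (al : P -> P).
Hypothesis alP : aff_split al.
Implicit Types (F : P -> FVH p m.+1) (f : P -> T) (y : delta P).

Lemma in_N0 d : in_N d (fun _ : P => 0 : FVH p m.+1).
Proof.
split=> [c x y|x|x g|x nu].
- by rewrite scaler0 addr0.
- by rewrite /in_IVH big1 // => nu _; rewrite ffunE.
- exact/esym/(lin0 (FVH_act_linear g)).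
by rewrite ffunE; apply: homogeneous0.
Qed.

Lemma dquo0 d y : dquo (P := P) d (fun _ => 0) y = 0.
Proof.
have E := dquo_linear (-1) (in_N0 d) (in_N0 d) y.
apply: etrans (etrans E _); last by rewrite scaleN1r addNr.
congr (dquo d _ y); apply: boolp.funext => x.
by rewrite scaler0 addr0.
Qed.

(** The top operation annihilates the difference of F and of its polynomial part, and
  its value on a polynomial is a p-th power. *)
Lemma spart_dquo_pure d F y : in_N (ywt p * d) F ->
  spart (dquo (ywt p * d) F y) = spart (dquo (ywt p * d) (pure F) y).
Proof.
move=> FN; have pN := pure_in_N p_prime FN.
pose E x := (-1) *: pure F x + F x; have EN : in_N (ywt p * d) E by apply: in_N_lin.
apply/eqP; rewrite -subr_eq0 addrC -scaleN1r -(spart_linear p_prime).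
rewrite -(dquo_linear (-1) pN FN); set z := dquo _ _ y.
have [_ _ /(_ y) z_h] := dquo_in_M delta EN.
have z_top := dquo_steenrod (ywt p * (d * p.-1)) EN y.
have E0 : (fun x => [ffun mu => steenrod (ywt p * d) (ywt p * (d * p.-1)) (E x mu)]) = fun=> 0.
  apply: boolp.funext => x; apply/ffunP=> nu; rewrite ffunE [RHS]ffunE.
  apply: steenrod_top => //; first by case: EN.
  rewrite /E FVH_linE (spart_linear p_prime) [pure F x nu]ffunE rpartK // scaleN1r addNr.
  by [].
rewrite E0 dquo0 in z_top.
have := spart_steenrod p_prime d z_h; rewrite -z_top spart0 // (rpow_top p_prime).
  by move/esym/eqP; rewrite expf_eq0 => /andP[_].
exact: spart_homog.
Qed.

Lemma hyper_resD c F F' x : hyper_res (fun x => c *: F x + F' x) x = c *: hyper_res F x + hyper_res F' x.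
Proof. by rewrite /hyper_res FVH_linE (spart_linear p_prime) pull_linear. Qed.

(** The difference of the two maps has a polynomial part that is divisible by the
  generator of H. *)
Lemma hyper_res_dquo d F F' y : in_N (ywt p * d) F -> in_N (ywt p * d) F' ->
  (forall x, hyper_res F x = hyper_res F' x) ->
  spart (dquo (ywt p * d) F y) = spart (dquo (ywt p * d) F' y).
Proof.
have [al_lin al_tr] := alP; move=> FN F'N eqR.
pose E x := (-1) *: F x + F' x; have EN : in_N (ywt p * d) E by apply: in_N_lin.
have E0 x : hyper_res E x = 0 by rewrite hyper_resD eqR scaleN1r addNr.
have /(dquo_ker delta (pure_in_N p_prime EN)) pE0 := pure_HplusN p_prime al_lin al_tr EN E0.
have := spart_dquo_pure y EN; rewrite pE0 spart0 // (dquo_linear (-1) FN F'N).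
by rewrite (spart_linear p_prime) scaleN1r addrC => /eqP; rewrite subr_eq0 => /eqP.
Qed.

(** The equivariant map on delta P corresponding to an affine-equivariant map on P. *)
Definition delta_map d f y : T :=
  spart (dquo (ywt p * d) (avg al (fun x => pull rho (f x))) y).

Lemma avg_rho_in_N d f : affmap d f -> in_N (ywt p * d) (avg al (fun x => pull rho (f x))).
Proof.
case=> f_lin _ f_h; apply: avg_in_N => //; first by case: alP.
  by move=> c x y; rewrite f_lin pull_linear.
by move=> x; apply: pull_homog.
Qed.

Lemma delta_map_spec d f F y : affmap d f -> in_N (ywt p * d) F -> (forall x, hyper_res F x = f x) ->
  spart (dquo (ywt p * d) F y) = delta_map d f y.
Proof.
move=> fA FN RF; apply: hyper_res_dquo => // [|x]; first exact: avg_rho_in_N.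
by rewrite RF (hyper_res_avg p_prime alP.2 fA).
Qed.

Lemma delta_map_eqmap d f : affmap d f -> eqmap d (delta_map d f).
Proof.
move=> fA; have [q_lin q_act q_h] := dquo_in_M delta (avg_rho_in_N fA); split=> [c y z|y g|y].
- by rewrite /delta_map q_lin (spart_linear p_prime).
- by rewrite /delta_map q_act spart_pullback.
exact: spart_homog.
Qed.

Lemma affmap_lin d c f f' : affmap d f -> affmap d f' -> affmap d (fun x => c *: f x + f' x).
Proof.
case=> f_lin f_act f_h [f'_lin f'_act f'_h]; split=> [e x y|x a aa|x].
- by rewrite f_lin f'_lin; exact: lin_exchange.
- by rewrite f_act // f'_act // pull_linear.
by apply: rpredD; [apply: rpredZ|].
Qed.

Lemma delta_mapD d c f f' y : affmap d f -> affmap d f' ->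
  delta_map d (fun x => c *: f x + f' x) y = c *: delta_map d f y + delta_map d f' y.
Proof.
move=> fA f'A; have fN := avg_rho_in_N fA; have f'N := avg_rho_in_N f'A.
rewrite -(spart_linear p_prime) -(dquo_linear c fN f'N); apply/esym/delta_map_spec.
- exact: affmap_lin.
- exact: in_N_lin.
by move=> x; rewrite hyper_resD !(hyper_res_avg p_prime alP.2 (d := d)).
Qed.

Lemma affmap_rpow d j f : affmap d f -> affmap (d + j * p.-1) (fun x => rpow j (f x)).
Proof.
case=> f_lin f_act f_h; split=> [c x y|x a aa|x].
- by rewrite f_lin linearP.
- by rewrite f_act // pull_rpow.
exact: rpow_homog.
Qed.

Lemma dquo_avg_rpow d j f y : affmap d f ->
  dquo (ywt p * (d + j * p.-1)) (avg al (fun x => pull rho (rpow j (f x)))) y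
  = steenrod (ywt p * d) (ywt p * (j * p.-1)) (dquo (ywt p * d) (avg al (fun x => pull rho (f x))) y).
Proof.
move=> fA; have fN := avg_rho_in_N fA; rewrite -(dquo_steenrod _ fN) mulnDr.
congr (dquo _ _ y); apply: boolp.funext => x; apply/ffunP=> nu; rewrite !ffunE.
have [f_lin _ f_h] := fA.
rewrite (steenrod_rpart p_prime); last first.
  by apply: rpred_sum => g _; apply: rpredZ; do 2!apply: pull_homog; apply: f_h.
congr rpart; rewrite /avgS (raddf_sum (rpow j)); apply: eq_bigr => g _ /=.
by rewrite linearZZ /= !pull_rpow.
Qed.

Lemma delta_map_rpow d j f y : affmap d f ->
  delta_map (d + j * p.-1) (fun x => rpow j (f x)) y = rpow j (delta_map d f y).
Proof.
move=> fA; have [_ _ q_h] := dquo_in_M delta (avg_rho_in_N fA).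
by rewrite /delta_map dquo_avg_rpow // (spart_steenrod p_prime j (q_h y)).
Qed.

(** The classes of dquo that spart annihilates are killed by the top operation, which
  takes f to its p-th power before averaging. *)
Lemma delta_map_inj d f : affmap d f -> (forall y, delta_map d f y = 0) -> forall x, f x = 0.
Proof.
move=> fA delta_map0 x; have [_ _ q_h] := dquo_in_M delta (avg_rho_in_N fA).
have fA' := affmap_rpow d fA; have [_ _ f_h] := fA.
have /(dquo_ker delta (avg_rho_in_N fA')) fH y :
    dquo (ywt p * (d + d * p.-1)) (avg al (fun x => pull rho (rpow d (f x)))) y = 0.
  by rewrite dquo_avg_rpow // steenrod_top //; exact: delta_map0.
have := hyper_res_HplusN p_prime fH x; rewrite (hyper_res_avg p_prime alP.2 fA') (rpow_top p_prime) //.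
by move/eqP; rewrite expf_eq0 => /andP[_ /eqP].
Qed.

Lemma delta_map_surj d (h : delta P -> T) : eqmap d h ->
  exists2 f, affmap d f & forall y, delta_map d f y = h y.
Proof.
case=> h_lin h_act h_h; have hM : in_M (ywt p * d) (fun y => rpart (h y)).
  split=> [c y z|y g|y]; first by rewrite h_lin linearP.
    by rewrite h_act pullback_rpart.
  exact: rpart_homog.
have [F FN FE] := dquo_surj hM; exists (hyper_res F); first exact: hyper_res_affmap.
by move=> y; rewrite -(delta_map_spec y _ FN) // ?FE ?rpartK //; exact: hyper_res_affmap.
Qed.

End OneModule.

Lemma affmap_comp (P Q : rmodule p Gam) (h : rhom P Q) d (f : Q -> T) :
  affmap d f -> affmap d (fun x => f (h x)).
Proof.
case=> f_lin f_act f_h; split=> [c x z|x a aa|x]; last exact: f_h.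
  by rewrite linearP f_lin.
by rewrite rhom_act f_act.
Qed.

Lemma delta_map_natural (P Q : projmod p Gam) (al : P -> P) (be : Q -> Q) (h : rhom P Q) d
    (f : Q -> T) (y : delta P) : aff_split al -> aff_split be -> affmap d f ->
  delta_map al d (fun x => f (h x)) y = delta_map be d f (dmap delta h y).
Proof.
move=> alP beP fA; have fN := avg_rho_in_N beP fA; have [f_lin f_act f_h] := fA.
rewrite /delta_map -dquo_natural //; apply/esym/delta_map_spec => // [||x].
- exact: affmap_comp.
- case: fN => F_lin F_I F_act F_h; split=> [c x z|x|x g|x nu] //.
    by rewrite linearP F_lin.
  by rewrite rhom_act F_act.
by rewrite -[RHS](hyper_res_avg p_prime beP.2 fA).
Qed.

End DeltaMaps.

Section Glue.
Variables (p : nat) (p_prime : prime p) (m : nat).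
Local Notation T := {mpoly 'F_p[m]}.
Implicit Types (k : T) (s : 'M['F_p]_m -> 'F_p).

Lemma pihomog_ge d k : (msize k <= d)%N -> pihomog mdeg d k = 0.
Proof.
move=> le_kd; rewrite pihomogE big_seq_cond big1 // => e /andP[ek /eqP ed].
by have := msize_mdeg_lt ek; rewrite ed ltnNge le_kd.
Qed.

(** The homogeneous pieces are assembled in one morphism of unstable modules, to which
  the classification applies. *)
Lemma graded_pullspan (phi : nat -> T -> T) :
  (forall d c k k', k \is d.-homog -> k' \is d.-homog ->
    phi d (c *: k + k') = c *: phi d k + phi d k') ->
  (forall d k, k \is d.-homog -> phi d k \is d.-homog) ->
  (forall d j k, k \is d.-homog -> phi (d + j * p.-1)%N (rpow j k) = rpow j (phi d k)) ->
  exists s, forall d k, k \is d.-homog -> phi d k = \sum_B s B *: pull B k.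
Proof.
move=> phi_lin phi_h phi_r.
have phi0 d : phi d 0 = 0.
  have := phi_lin d (-1) 0 0 (rpred0 _) (rpred0 _).
  by rewrite scaler0 addr0 scaleN1r addNr.
pose psi k := \sum_(d < msize k) phi d (pihomog mdeg d k).
have psiE N k : (msize k <= N)%N -> psi k = \sum_(d < N) phi d (pihomog mdeg d k).
  move=> le_kN; rewrite /psi (big_ord_widen _ (fun d => phi d (pihomog mdeg d k)) le_kN).
  rewrite big_mkcond; apply: eq_bigr => d _; case: ltnP => // le_kd.
  by rewrite pihomog_ge.
have psi_lin : linear psi.
  move=> c k k'; pose N := maxn (msize (c *: k + k')) (maxn (msize k) (msize k')).
  rewrite !(psiE N) ?leq_max ?leqnn ?orbT // scaler_sumr -big_split.
  by apply: eq_bigr => d _; rewrite linearP phi_lin ?pihomogP.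
have psi_h d k : k \is d.-homog -> psi k = phi d k.
  move=> k_h; rewrite (psiE (maxn (msize k) d.+1)) ?leq_maxl //.
  have lt_d : (d < maxn (msize k) d.+1)%N by rewrite leq_maxr.
  rewrite (bigD1 (Ordinal lt_d)) //= pihomog_dE // big1 ?addr0 // => e ne_e.
  by rewrite (pihomog_ne0 _ k_h) ?phi0 // eq_sym.
have psiU : umap psi.
  split=> // [d k k_h|j k]; first by rewrite (psi_h d) //; apply: phi_h.
  have L := lin_sum psi_lin; rewrite (pihomog_partitionE (mf := mdeg) (leqnn (msize k))).
  rewrite (raddf_sum (rpow j)) !L (raddf_sum (rpow j)); apply: eq_bigr => d _ /=.
  rewrite [psi (pihomog _ _ _)](psi_h d) ?pihomogP // -phi_r ?pihomogP // (psi_h (d + j * p.-1)%N) //.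
  by apply: rpow_homog => //; apply: pihomogP.
have [s sE] := umap_pullspan p_prime psiU.
by exists s => d k k_h; rewrite -(psi_h d) // sE.
Qed.

Lemma pull_homog_indep s :
  (forall d k, k \is d.-homog -> \sum_B s B *: pull B k = 0) -> forall B, s B = 0.
Proof.
move=> s0 B; have s0' k : \sum_B s B *: pull B k = 0.
  rewrite (pihomog_partitionE (mf := mdeg) (leqnn (msize k))).
  under eq_bigr => A _ do rewrite pull_sum scaler_sumr.
  by rewrite exchange_big big1 // => d _; apply: s0 (pihomogP _ _ _).
suff : (s B)%:MP_[m] = 0 by move/eqP; rewrite mpolyC_eq0 => /eqP.
apply: (@pull_indep p m m (index_enum _) (fun A => (s A)%:MP)) => [|k|].
- exact: index_enum_uniq.
- by rewrite -[RHS](s0' k); apply: eq_bigr => A _; rewrite mul_mpolyC.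
exact: mem_index_enum.
Qed.

Lemma dickson_homog : exists N, dickson p m \is N.-homog.
Proof.
rewrite dickson.unlock; elim/big_rec: _ => [|mu f _ [N f_h]].
  by exists 0%N; rewrite dhomog1.
by exists (1 + N)%N; apply: dhomogM => //; apply: linform_homog.
Qed.

Lemma dickson_homog_indep (s : GL p m -> 'F_p) :
  (forall d k, k \is d.-homog -> \sum_g s g *: pull (val g) (dickson p m * k) = 0) ->
  forall g, s g = 0.
Proof.
move=> s0; apply: (dickson_indep p_prime) => k.
rewrite (pihomog_partitionE (mf := mdeg) (leqnn (msize k))) mulr_sumr.
under eq_bigr => A _ do rewrite pull_sum scaler_sumr.
by rewrite exchange_big big1 // => d _; apply: s0 (pihomogP _ _ _).
Qed.

Section Dual.
Variable Q : rmodule p (GL p m).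

(** The equivariant map to polynomials obtained from a linear form by coinduction. *)
Definition dualmap (la : Q -> ('F_p)^o) k (y : Q) : T :=
  \sum_g la (act y g^-1%g) *: pull (val g) k.

Lemma dualmap_eqmap la d k : linear la -> k \is d.-homog -> eqmap d (dualmap la k).
Proof.
move=> la_lin k_h; split=> [c x y|y h|y].
- rewrite /dualmap scaler_sumr -big_split; apply: eq_bigr => g _ /=.
  by rewrite act_linear la_lin scalerDl scalerA.
- rewrite /dualmap pull_sum (reindex_inj (mulIg h)); apply: eq_bigr => g _ /=.
  by rewrite pullZ pull_comp // -actM invMg mulKVg.
by apply: rpred_sum => g _; apply: rpredZ; apply: pull_homog.
Qed.

(** A linear form that is nonzero at y gives a dualmap that is nonzero at y, by the
  independence of substitutions. *)
Lemma eqmap_sep (y : Q) : (forall d h, eqmap d h -> h y = 0) -> y = 0.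
Proof.
move=> h0; case: (boolp.pselect (y = 0)) => // y_neq0.
have [|la la_lin [_ la1]] := @linear_functional 'F_p Q (fun x => x = 0) y erefl _ y_neq0.
  by move=> c x z -> ->; rewrite scaler0 addr0.
have [N D_h] := dickson_homog.
have /(_ 1%g)/eqP := @dickson_homog_indep (fun g => la (act y g^-1%g))
  (fun d k k_h => h0 _ _ (dualmap_eqmap la_lin (dhomogM D_h k_h))).
by rewrite invg1 act1 la1 oner_eq0.
Qed.

End Dual.
End Glue.

(** * The regular representation *)

Section Regular.
Variables p n : nat.
Local Notation A := (galg p n).
Implicit Types (a b : A) (x y g : GL p n).

Fact gact_linear g : linear ((@gact p n)^~ g).
Proof. by move=> c a b; apply/ffunP=> h; rewrite !ffunE. Qed.
Fact gact1 a : gact a 1%g = a.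
Proof. by apply/ffunP=> h; rewrite ffunE invg1 mulg1. Qed.
Fact gactM a g h : gact a (g * h)%g = gact (gact a g) h.
Proof. by apply/ffunP=> k; rewrite !ffunE invMg mulgA. Qed.

Definition regular : rmodule p (GL p n) := RModule A (@gact p n) gact_linear gact1 gactM.

Lemma gact_gconst x g : gact (gconst x) g = gconst (x * g)%g.
Proof. by apply/ffunP=> h; rewrite !ffunE -(inj_eq (mulIg g)) mulgKV. Qed.

Lemma galg_sum a : a = \sum_x a x *: gconst x.
Proof.
apply/ffunP=> h; rewrite sum_ffunE (bigD1 h) //= big1 => [|x /negbTE ne_x].
  by rewrite !ffunE eqxx addr0 [RHS]mulr1.
by rewrite !ffunE eq_sym ne_x scaler0.
Qed.

Lemma regular_linear (V : lmodType 'F_p) (f : A -> V) a : linear f ->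
  f a = \sum_x a x *: f (gconst x).
Proof.
move=> f_lin; rewrite [a in LHS]galg_sum (lin_sum f_lin).
by apply: eq_bigr => x _; rewrite (linZ f_lin).
Qed.

Definition lmul x a : A := [ffun h => a (x^-1 * h)%g].

Lemma lmul_gconst x y : lmul x (gconst y) = gconst (x * y)%g.
Proof. by apply/ffunP=> h; rewrite !ffunE -(inj_eq (mulgI x)) mulKVg. Qed.

Fact lmul_linear x : linear (lmul x).
Proof. by move=> c a b; apply/ffunP=> h; rewrite !ffunE. Qed.
Definition lmul_lin x : {linear regular -> regular} :=
  HB.pack (lmul x) (GRing.isLinear.Build 'F_p regular regular *:%R (lmul x) (lmul_linear x)).

Fact lmul_act x (a : regular) g : lmul x (act a g) = act (r := regular) (lmul x a) g.
Proof. by apply/ffunP=> h; rewrite !ffunE mulgA. Qed.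
Definition lmulh x : rhom regular regular := RHom (rfun := lmul_lin x) (lmul_act x).

Section Orbit.
Variables (P : rmodule p (GL p n)) (t : P).

Definition orb a : P := \sum_h a h *: act t h.

Fact orb_linear : linear orb.
Proof.
move=> c a b; rewrite /orb scaler_sumr -big_split; apply: eq_bigr => h _ /=.
by rewrite !ffunE scalerDl scalerA.
Qed.
Definition orb_lin : {linear regular -> P} :=
  HB.pack orb (GRing.isLinear.Build 'F_p regular P *:%R orb orb_linear).

Fact orb_act (a : regular) g : orb (act a g) = act (orb a) g.
Proof.
rewrite /orb act_lin (reindex_inj (mulIg g)); apply: eq_bigr => h _ /=.
by rewrite ffunE mulgK (linZ (act_linear g)) actM.
Qed.
Definition orbh : rhom regular P := RHom (rfun := orb_lin) orb_act.

Lemma orb_gconst x : orb (gconst x) = act t x.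
Proof.
rewrite /orb (bigD1 x) //= ffunE eqxx scale1r big1 ?addr0 // => y /negbTE ne_y.
by rewrite ffunE ne_y scale0r.
Qed.

End Orbit.

Lemma orb_lmul (P : rmodule p (GL p n)) (t : P) x a : orb t (lmul x a) = orb (act t x) a.
Proof.
rewrite /orb (reindex_inj (mulgI x)); apply: eq_bigr => h _ /=.
by rewrite ffunE mulKg actM.
Qed.

End Regular.

Section AffineWeight.
Variables (p m : nat).
Local Notation Gam := (GL p m.+1).

(** The indicator function of a set of representatives of the left cosets of the affine
  group. *)
Lemma aff_weight : exists w : Gam -> 'F_p, forall y, \sum_(a | aff a) w (y * a)%g = 1.
Proof.
pose rep (nu : 'rV['F_p]_m.+1) : Gam :=
  odflt 1%g [pick x : Gam | last_row p m *m val x == nu].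
have repE (y : Gam) : last_row p m *m val (rep (last_row p m *m val y)) = last_row p m *m val y.
  by rewrite /rep; case: pickP => [x /eqP //|/(_ y)]; rewrite eqxx.
exists (fun y : Gam => (y^-1%g == rep (last_row p m *m val y^-1%g))%:R) => y.
pose r : Gam := rep (last_row p m *m val y^-1%g).
have ra : aff (y^-1 * r^-1)%g.
  rewrite affE val_GLM mulmxA -repE -/r -mulmxA -val_GLM mulgV val_GL1 mulmx1.
  by [].
have rE : last_row p m *m val r = last_row p m *m val y^-1%g by exact: repE.
rewrite (bigD1 _ ra) mulKVg invgK rE eqxx big1 => [|a /andP[aa ne_a]]; first by rewrite /= addr0.
have -> : last_row p m *m val (y * a)^-1%g = last_row p m *m val y^-1%g.
  rewrite invMg val_GLM mulmxA; move: aa; rewrite -affV affE => /eqP ->.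
  by [].
rewrite -/r; case: eqP => // ya; case/eqP: ne_a.
by rewrite -ya invgK mulKg.
Qed.

End AffineWeight.

Section DeltaMapSums.
Variables (p : nat) (p_prime : prime p) (m : nat) (delta : delta_functor p m).
Local Notation T := {mpoly 'F_p[m]}.
Variables (P : projmod p (GL p m.+1)) (al : P -> P).
Hypothesis alP : aff_split al.

Lemma eq_delta_map d f f' y : f =1 f' -> delta_map (delta := delta) al d f y = delta_map al d f' y.
Proof. by move/boolp.funext ->. Qed.

Lemma affmap0 d : affmap d (fun _ : P => 0 : T).
Proof.
split=> [c x y|x a _|x]; first by rewrite scaler0 addr0.
  by rewrite pull0.
exact: rpred0.
Qed.

Lemma delta_map0 d y : delta_map (delta := delta) al d (fun=> 0) y = 0.
Proof.
have E := delta_mapD p_prime (delta := delta) alP (-1) y (affmap0 d) (affmap0 d).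
apply: etrans (etrans E _); last by rewrite scaleN1r addNr.
by apply: eq_delta_map => x; rewrite scaler0 addr0.
Qed.

Lemma delta_map_sum d (I : eqType) (r : seq I) (c : I -> 'F_p) (f : I -> P -> T) y :
  (forall i, i \in r -> affmap d (f i)) ->
  affmap d (fun x => \sum_(i <- r) c i *: f i x) /\
  delta_map (delta := delta) al d (fun x => \sum_(i <- r) c i *: f i x) y
  = \sum_(i <- r) c i *: delta_map al d (f i) y.
Proof.
elim: r => [|i r IHr] fA.
  have nilE : (fun x => \sum_(i <- [::]) c i *: f i x) = fun=> 0.
    by apply: boolp.funext => x; rewrite big_nil.
  by rewrite nilE big_nil delta_map0; split; first exact: affmap0.
have [|A E] := IHr; first by move=> j jr; apply: fA; rewrite inE jr orbT.
have iA := fA i (mem_head _ _).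
have consE : (fun x => \sum_(i <- i :: r) c i *: f i x)
    = fun x => c i *: f i x + \sum_(i <- r) c i *: f i x.
  by apply: boolp.funext => x; rewrite big_cons.
by rewrite consE big_cons -E -(delta_mapD p_prime alP) //; split=> //; apply: affmap_lin.
Qed.

End DeltaMapSums.

Section DualDickson.
Variables (p : nat) (p_prime : prime p) (m : nat) (delta : delta_functor p m).
Local Notation T := {mpoly 'F_p[m]}.
Variables (P : projmod p (GL p m.+1)) (al : P -> P).
Hypothesis alP : aff_split al.

Lemma delta_map_inj2 d f f' : affmap d f -> affmap d f' ->
  (forall y : delta P, delta_map al d f y = delta_map al d f' y) -> f =1 f'.
Proof.
move=> fA f'A eq_dm x; apply/eqP; rewrite -subr_eq0 addrC -scaleN1r.
apply/eqP; apply: (delta_map_inj p_prime (delta := delta) alP (affmap_lin (-1) f'A fA)) => y.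
by rewrite (delta_mapD p_prime alP) // eq_dm scaleN1r addNr.
Qed.

(** The map F corresponding to dualmap la k is natural in k, so its values are
  combinations of pullbacks of k; when k is a multiple of Dickson's product, singular
  substitutions annihilate them. *)
Lemma dual_dickson (la : delta P -> ('F_p)^o) d k0 : linear la -> k0 \is d.-homog ->
  exists e F, [/\ affmap e F,
    forall y, delta_map al e F y = dualmap la (dickson p m * k0) y
    & forall B x, B \notin unitmx -> pull B (F x) = 0].
Proof.
move=> la_lin k0_h.
have /boolp.choice[F FP] : forall dk : nat * T, exists f : P -> T, dk.2 \is dk.1.-homog ->
    affmap dk.1 f /\ forall y, delta_map al dk.1 f y = dualmap la dk.2 y.
  move=> [e k] /=; case: (boolP (k \is e.-homog)) => [k_h|_]; last by exists (fun=> 0).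
  have [f fA fE] := delta_map_surj p_prime alP (dualmap_eqmap p_prime la_lin k_h).
  by exists f => _; split.
have FA e k : k \is e.-homog -> affmap e (F (e, k)) by move=> k_h; have [] := FP (e, k) k_h.
have FE e k : k \is e.-homog -> forall y, delta_map al e (F (e, k)) y = dualmap la k y.
  by move=> k_h; have [] := FP (e, k) k_h.
have [N D_h] := dickson_homog p m.
have Dk_h := dhomogM D_h k0_h.
exists (N + d)%N, (F ((N + d)%N, dickson p m * k0)); split=> [||B x B_sing]; [exact: FA | exact: FE |].
have [|||b bE] := @graded_pullspan p p_prime m (fun e k => F (e, k) x).
- move=> e c k k' k_h k'_h.
  have h_h : c *: k + k' \is e.-homog by apply: rpredD => //; apply: rpredZ.
  apply: (delta_map_inj2 (FA _ _ h_h) (affmap_lin c (FA _ _ k_h) (FA _ _ k'_h))) => y.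
  rewrite (delta_mapD p_prime alP) ?FE //; try exact: FA.
  rewrite /dualmap scaler_sumr -big_split; apply: eq_bigr => g _ /=.
  by rewrite pull_linear scalerDr !scalerA mulrC.
- by move=> e k k_h; have [_ _] := FA _ _ k_h.
- move=> e j k k_h; have r_h := rpow_homog p_prime j k_h.
  apply: (delta_map_inj2 (FA _ _ r_h) (affmap_rpow p_prime j (FA _ _ k_h))) => y.
  rewrite (delta_map_rpow p_prime alP) ?FE //; last exact: FA.
  rewrite /dualmap (raddf_sum (rpow j)); apply: eq_bigr => g _ /=.
  by rewrite linearZZ /= pull_rpow.
rewrite bE // pull_sum big1 // => C _; rewrite pullZ pull_comp // pullM.
rewrite pull_dickson_sing ?mul0r ?scaler0 //.
by rewrite unitmx_mul negb_and B_sing orbT.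
Qed.

End DualDickson.

Section Coefficients.
Variables (p : nat) (p_prime : prime p) (m : nat) (delta : delta_functor p m).
Local Notation T := {mpoly 'F_p[m]}.
Local Notation Gam := (GL p m.+1).
Local Notation G := (GL p m).
Local Notation R := (regular p m.+1).
Variable w : Gam -> 'F_p.
Hypothesis w_sum : forall y : Gam, \sum_(a | aff a) w (y * a)%g = 1.

Definition weigh (a : R) : R := [ffun y => w y *: (a : galg p m.+1) y].

Lemma weigh_split : aff_split weigh.
Proof.
split=> [c a b|a]; apply/ffunP=> y; first by rewrite !ffunE scalerDr !scalerA mulrC.
rewrite /trace sum_ffunE -[RHS]mul1r -(w_sum y) mulr_suml (reindex_inj invg_inj) /=.
apply: eq_big => g; first by rewrite affV.
by rewrite !ffunE !invgK mulgK.
Qed.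

Lemma regular_projective : projective R.
Proof.
have [w_lin w_tr] := weigh_split.
apply: (projective_of_trace (al := fun x => - weigh x)); last exact: (trace_aff p_prime w_lin).
by move=> c x y; rewrite w_lin opprD scalerN.
Qed.

Definition regP : projmod p Gam := ProjMod regular_projective.
Let al : regP -> regP := weigh.
Let alP : aff_split al := weigh_split.

(** The affine map that vanishes outside the affine group and takes the value k at 1. *)
Definition aff_extend (k : T) (a : regP) : T :=
  \sum_(g | aff g) (a : galg p m.+1) g *: pull (lin_mx g) k.

Lemma aff_extend_affmap d k : k \is d.-homog -> affmap d (aff_extend k).
Proof.
move=> k_h; split=> [c a b|a x xa|a].
- rewrite /aff_extend scaler_sumr -big_split; apply: eq_bigr => g _ /=.
  by rewrite !ffunE scalerDl scalerA.
- rewrite /aff_extend pull_sum (reindex_inj (mulIg x)); apply: eq_big => [g|g].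
    by rewrite affMr.
  by rewrite affMr // => ga; rewrite ffunE mulgK pullZ pull_comp // -lin_mxM.
by apply: rpred_sum => g _; apply: rpredZ; apply: pull_homog.
Qed.

Lemma aff_extend_gconst k x : aff_extend k (gconst x) = if aff x then pull (lin_mx x) k else 0.
Proof.
rewrite /aff_extend; case: ifP => xa.
  rewrite (bigD1 x) //= ffunE eqxx scale1r big1 ?addr0 // => g /andP[_ /negbTE ne_g].
  by rewrite ffunE ne_g scale0r.
rewrite big1 // => g ga; rewrite ffunE; case: eqP => [gx|_]; last by rewrite scale0r.
by rewrite -gx ga in xa.
Qed.

Lemma aff_extend_lmul k x a : aff x -> aff_extend k (lmul x a) = aff_extend (pull (lin_mx x) k) a.
Proof.
move=> xa; rewrite /aff_extend (reindex_inj (mulgI x)); apply: eq_big => [g|g]; first by rewrite affM.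
by rewrite affM // => ga; rewrite [lmul _ _ _]ffunE mulKg (pull_comp p_prime) -(lin_mxM _ ga).
Qed.

Lemma pull_coef_ex (q : delta regP) : exists s : 'M['F_p]_m -> 'F_p, forall d k, k \is d.-homog ->
  delta_map al d (aff_extend k) q = \sum_B s B *: pull B k.
Proof.
apply: (graded_pullspan p_prime (phi := fun d k => delta_map al d (aff_extend k) q)).
- move=> d c k k' k_h k'_h; rewrite -(delta_mapD p_prime alP c q (aff_extend_affmap k_h) (aff_extend_affmap k'_h)).
  apply: eq_delta_map => a; rewrite /aff_extend scaler_sumr -big_split; apply: eq_bigr => g _ /=.
  by rewrite pull_linear scalerDr !scalerA mulrC.
- by move=> d k k_h; have [_ _] := delta_map_eqmap p_prime delta alP (aff_extend_affmap k_h).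
move=> d j k k_h; rewrite -(delta_map_rpow p_prime alP); last exact: aff_extend_affmap.
apply: eq_delta_map => a; rewrite /aff_extend (raddf_sum (rpow j)); apply: eq_bigr => g _ /=.
by rewrite linearZZ /= pull_rpow.
Qed.

(** The coefficients of the substitutions in the value at q of the maps that correspond to
  the aff_extend k; they exist because this value is natural in k. *)
Definition pull_coef q := sval (boolp.constructive_indefinite_description (pull_coef_ex q)).

Lemma pull_coefP q d k : k \is d.-homog -> delta_map al d (aff_extend k) q = \sum_B pull_coef q B *: pull B k.
Proof. exact: (svalP (boolp.constructive_indefinite_description (pull_coef_ex q))). Qed.

Lemma pull_coef_uniq q (s : 'M['F_p]_m -> 'F_p) :
  (forall d k, k \is d.-homog -> delta_map al d (aff_extend k) q = \sum_B s B *: pull B k) -> pull_coef q =1 s.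
Proof.
move=> sE B; apply/eqP; rewrite -subr_eq0; apply/eqP.
apply: (pull_homog_indep (s := fun B => pull_coef q B - s B)) => d k k_h.
under eq_bigr => A _ do rewrite scalerBl.
by rewrite sumrB -(pull_coefP q k_h) (sE _ _ k_h) subrr.
Qed.

Lemma pull_coef_linear c q q' B : pull_coef (c *: q + q') B = c * pull_coef q B + pull_coef q' B.
Proof.
move: B; apply: pull_coef_uniq => d k k_h.
have [P_lin _ _] := delta_map_eqmap p_prime delta alP (aff_extend_affmap k_h).
rewrite P_lin !(pull_coefP _ k_h) scaler_sumr -big_split; apply: eq_bigr => B _ /=.
by rewrite scalerDl scalerA.
Qed.

Lemma pull_coef_act q (g : G) B : pull_coef (act q g) B = pull_coef q (B *m val g^-1%g).
Proof.
move: B; apply: pull_coef_uniq => d k k_h.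
have [_ P_act _] := delta_map_eqmap p_prime delta alP (aff_extend_affmap k_h).
rewrite P_act (pull_coefP _ k_h) pull_sum (reindex (fun B : 'M_m => B *m val g^-1%g)); last first.
  exists (fun B : 'M_m => B *m val g) => B _; first by rewrite mulmxKV ?(valP g).
  by rewrite mulmxK ?(valP g).
apply: eq_bigr => B _; rewrite pullZ pull_comp // mulmxKV ?(valP g) //.
Qed.

Definition dlmul (x : Gam) : rhom (delta regP) (delta regP) :=
  dmap delta (P := regP) (Q := regP) (lmulh x).

Lemma pull_coef_lmul (q : delta regP) x B : aff x -> pull_coef (dlmul x q) B = pull_coef q (lin_mx x^-1%g *m B).
Proof.
move=> xa; move: B; apply: pull_coef_uniq => d k k_h.
rewrite -(delta_map_natural p_prime (lmulh x : rhom regP regP) q alP alP (aff_extend_affmap k_h)).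
have k'_h := pull_homog (lin_mx x) k_h.
have -> : delta_map al d (fun a => aff_extend k ((lmulh x : rhom regP regP) a)) q
    = delta_map al d (aff_extend (pull (lin_mx x) k)) q by apply: eq_delta_map => a; exact: aff_extend_lmul.
rewrite (pull_coefP _ k'_h) (reindex (fun B : 'M_m => lin_mx x^-1%g *m B)); last first.
  exists (fun B : 'M_m => lin_mx x *m B) => B _.
    by rewrite mulmxA -lin_mxM ?affV // mulgV lin_mx1 mul1mx.
  by rewrite mulmxA -lin_mxM // mulVg lin_mx1 mul1mx.
apply: eq_bigr => B _; rewrite pull_comp // mulmxA -lin_mxM ?affV // mulgV lin_mx1.
by rewrite mul1mx.
Qed.

Lemma dmap_lmulM (q : delta regP) x y :
  dlmul (x * y)%g q = dlmul x (dlmul y q).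
Proof.
apply: (dmap_comp (d0 := delta) (P := regP) (Q := regP) (R := regP)
  (f := lmulh y) (g := lmulh x) (h := lmulh (x * y)%g)).
by move=> a; apply/ffunP=> h; rewrite /= !ffunE invMg mulgA.
Qed.

(** The coefficient of the identity substitution, as a function of left translations. *)
Definition id_coef (q : delta regP) x : 'F_p := pull_coef (dlmul x q) 1%:M.

Lemma id_coef_linear c q q' x : id_coef (c *: q + q') x = c * id_coef q x + id_coef q' x.
Proof. by rewrite /id_coef linearP pull_coef_linear. Qed.

Lemma pull_coef_unit q x (g : G) : pull_coef (dlmul x q) (val g) = id_coef q (GLemb g^-1 * x)%g.
Proof.
rewrite /id_coef dmap_lmulM [RHS](pull_coef_lmul _ _ (aff_emb _)) -GLembV invgK lin_mx_emb mulmx1.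
by [].
Qed.

Lemma id_coef_act q x (g : G) : id_coef (act q g) x = id_coef q (GLemb g * x)%g.
Proof. by rewrite /id_coef rhom_act pull_coef_act mul1mx pull_coef_unit invgK. Qed.

Lemma id_coef_lmul q x y : id_coef (dlmul y q) x = id_coef q (x * y)%g.
Proof. by rewrite /id_coef -dmap_lmulM. Qed.

Lemma sum_unitmx (V : nmodType) (F : 'M['F_p]_m -> V) : (forall B, B \notin unitmx -> F B = 0) ->
  \sum_B F B = \sum_(g : G) F (val g).
Proof.
move=> F0; rewrite (bigID (fun B => B \in unitmx)) /= [X in _ + X]big1 // addr0.
rewrite (reindex_onto (fun g : G => val g) (insubd (1%g : G))) /= => [|B Bu]; last first.
  by rewrite val_insubd Bu.
by apply: eq_bigl => g; rewrite (valP g) valKd eqxx.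
Qed.

(** An affine map on the group algebra is a sum over the cosets of the affine group, on
  each of which it is extended from one value. *)
Lemma affmap_decomp d F (a : regP) : affmap d F ->
  F a = \sum_(x : Gam) w x *: aff_extend (F (gconst x)) (lmul x^-1%g a).
Proof.
case=> F_lin F_act _; rewrite (regular_linear a F_lin).
transitivity (\sum_(x : Gam) \sum_(g | aff g)
    (w x * (a : galg p m.+1) (x * g)%g) *: F (gconst (x * g)%g)); last first.
  apply: eq_bigr => x _; rewrite /aff_extend scaler_sumr; apply: eq_bigr => g ga.
  by rewrite -F_act // [act _ _]gact_gconst [lmul _ _ _]ffunE invgK scalerA.
rewrite exchange_big /=.
transitivity (\sum_(x : Gam) \sum_(g | aff g)
    (w (x * g^-1)%g * (a : galg p m.+1) x) *: F (gconst x)).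
  apply: eq_bigr => x _; rewrite -scaler_suml -mulr_suml (reindex_inj invg_inj) /=.
  rewrite (eq_bigl (fun g => aff g)) => [|g]; last by rewrite affV.
  by under eq_bigr => g _ do rewrite invgK; rewrite w_sum mul1r.
rewrite exchange_big /=; apply: eq_bigr => g _.
rewrite (reindex_inj (mulIg g)); apply: eq_bigr => x _.
by rewrite mulgK.
Qed.

(** The hypothesis on F removes the coefficients of singular substitutions, and the
  others are values of id_coef. *)
Lemma delta_map_decomp d F q : affmap d F -> (forall B x, B \notin unitmx -> pull B (F x) = 0) ->
  delta_map (delta := delta) al d F q
  = \sum_(x : Gam) \sum_(g : G)
      (w x * id_coef q (GLemb g^-1 * x^-1)%g) *: pull (val g) (F (gconst x)).
Proof.
move=> FA F0; have [_ _ F_h] := FA.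
have xA x : affmap d (fun a : regP => aff_extend (F (gconst x)) ((lmulh x^-1%g : rhom regP regP) a)).
  exact/affmap_comp/aff_extend_affmap.
transitivity (delta_map (delta := delta) al d (fun a => \sum_(x : Gam)
    w x *: aff_extend (F (gconst x)) ((lmulh x^-1%g : rhom regP regP) a)) q).
  by apply: eq_delta_map => a; exact: affmap_decomp FA.
have [_ ->] := delta_map_sum p_prime alP (r := index_enum _) w q (fun x _ => xA x).
apply: eq_bigr => x _.
rewrite (delta_map_natural p_prime (lmulh x^-1%g : rhom regP regP) q alP alP (aff_extend_affmap (F_h (gconst x)))).
rewrite (pull_coefP _ (F_h _)) sum_unitmx => [|B Bs]; last by rewrite F0 ?scaler0.
by rewrite scaler_sumr; apply: eq_bigr => g _; rewrite pull_coef_unit scalerA.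
Qed.

(** By delta_map_decomp, the functions id_coef determine the values at q of the maps
  dualmap la k with k a multiple of Dickson's product, hence la q for every linear form la. *)
Lemma id_coef_eq0 q : (forall x, id_coef q x = 0) -> q = 0.
Proof.
move=> q0; case: (boolp.pselect (q = 0)) => // q_neq0.
have [|la la_lin [_ la1]] := @linear_functional 'F_p (delta regP) (fun y => y = 0) q erefl _ q_neq0.
  by move=> c x z -> ->; rewrite scaler0 addr0.
suff /(_ 1%g)/eqP : forall g : G, la (act q g^-1%g) = 0 by rewrite invg1 act1 la1 oner_eq0.
apply: (dickson_homog_indep p_prime) => d k k_h.
have [e [F [FA FE F0]]] := dual_dickson p_prime alP la_lin k_h.
rewrite -[LHS](FE q) (delta_map_decomp q FA F0) big1 // => x _; rewrite big1 // => g _.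
by rewrite q0 mulr0 scale0r.
Qed.

(** Otherwise a linear form on the functions on Gamma would vanish on all id_coef q and not
  on the indicator function of U.  Its coefficients give a combination of left translates of
  aff_extend k, for k a multiple of Dickson's product, that delta_map sends to 0 and which is
  therefore 0; by independence, the coefficients have sum 0 over U. *)
Lemma unit_elt : exists b, forall x, id_coef b x = (unip x)%:R.
Proof.
pose W (f : galg p m.+1) := exists q, forall x, f x = id_coef q x.
pose f1 : galg p m.+1 := [ffun x => (unip x)%:R].
case: (boolp.pselect (W f1)) => [[b bE]|nW].
  by exists b => x; rewrite -bE ffunE.
have [|c f f' [q qE] [q' q'E]|phi phi_lin [phiW phi1]] := @linear_functional 'F_p (galg p m.+1) W f1 _ _ nW.
- by exists 0 => x; rewrite ffunE; have := id_coef_linear (-1) 0 0 x; rewrite scaler0 addr0 mulN1r addNr.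
- by exists (c *: q + q') => x; rewrite id_coef_linear -qE -q'E !ffunE.
pose c x : 'F_p := phi (gconst x).
have phiE f : phi f = \sum_x f x * c x.
  by rewrite (regular_linear (V := ('F_p)^o) f phi_lin).
have cW q : \sum_x id_coef q x * c x = 0.
  rewrite -[RHS](phiW [ffun x => id_coef q x]) ?phiE; last by exists q => x; rewrite ffunE.
  by apply: eq_bigr => x _; rewrite ffunE.
suff /(_ 1%g) c0 : forall g : G, \sum_(x : Gam | aff x && (lin x == g)) c x = 0.
  have /eqP := phi1; rewrite phiE (_ : \sum_x _ = 0) 1?eq_sym ?oner_eq0 // -[RHS]c0 [RHS]big_mkcond.
  apply: eq_bigr => x _; rewrite ffunE -/(unip x).
  by case: (unip x); rewrite ?mul1r ?mul0r.
apply: (dickson_homog_indep p_prime) => d k0 k0_h.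
have [N D_h] := dickson_homog p m; set k := dickson p m * k0.
have k_h : k \is (N + d).-homog by apply: dhomogM.
have xA x : affmap (N + d) (fun a : regP => aff_extend k ((lmulh x : rhom regP regP) a)).
  exact/affmap_comp/aff_extend_affmap.
have sumA q := delta_map_sum (delta := delta) p_prime alP (r := index_enum _) c q (fun x _ => xA x).
have sum0 := delta_map_inj p_prime (delta := delta) alP (sumA 0).1.
transitivity (\sum_x c x *: aff_extend k (lmul x (gconst 1%g))).
  under [RHS]eq_bigr => x _ do rewrite lmul_gconst mulg1 aff_extend_gconst (fun_if (fun f => c x *: f)) scaler0.
  rewrite -big_mkcond /= (partition_big (@lin p m) predT) //=; apply: eq_bigr => g _.
  rewrite scaler_suml; apply: eq_bigr => x /andP[xa /eqP <-].
  by rewrite val_lin.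
apply: (sum0 _ (gconst 1%g)) => q; rewrite (sumA q).2.
under eq_bigr => x _.
  rewrite (delta_map_natural p_prime (lmulh x : rhom regP regP) q alP alP (aff_extend_affmap k_h)).
  rewrite (pull_coefP _ k_h) sum_unitmx; last first.
    by move=> B Bs; rewrite pullM pull_dickson_sing // mul0r scaler0.
  over.
under eq_bigr => x _ do rewrite scaler_sumr.
rewrite exchange_big big1 // => g _ /=.
transitivity ((\sum_x id_coef (act q g^-1%g) x * c x) *: pull (val g) k); last first.
  by rewrite cW scale0r.
rewrite scaler_suml; apply: eq_bigr => x _; rewrite scalerA mulrC id_coef_act pull_coef_unit.
by [].
Qed.

Section Unit.
Variable b : delta regP.
Hypothesis bE : forall x, id_coef b x = (unip x)%:R.

Lemma id_coef_inj q q' : (forall x, id_coef q x = id_coef q' x) -> q = q'.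
Proof.
move=> eq_lam; apply/eqP; rewrite -subr_eq0 addrC -scaleN1r; apply/eqP/id_coef_eq0 => x.
by rewrite id_coef_linear eq_lam mulN1r addNr.
Qed.

Lemma unit_unip u : unip u -> dlmul u b = b.
Proof. by move=> uu; apply: id_coef_inj => x; rewrite id_coef_lmul !bE unipMr. Qed.

Lemma unit_emb (g : G) : dlmul (GLemb g) b = act b g.
Proof.
apply: id_coef_inj => x; rewrite id_coef_lmul id_coef_act !bE; congr (nat_of_bool _)%:R.
rewrite -(unip_conj (GLemb g * x)%g (aff_emb g)).
by rewrite mulKg.
Qed.

(** In delta_map_decomp, the indicator function of U selects the terms in which g is the
  inverse of the linear part of x, and these all contribute the value at 1. *)
Lemma delta_map_unit d F : affmap d F -> (forall B x, B \notin unitmx -> pull B (F x) = 0) ->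
  delta_map (delta := delta) al d F b = F (gconst 1%g).
Proof.
move=> FA F0; rewrite (delta_map_decomp b FA F0); have [_ F_act _] := FA.
transitivity ((\sum_(x : Gam | aff x) w x) *: F (gconst 1%g)); last first.
  have := w_sum 1%g; under eq_bigr => a _ do rewrite mul1g.
  by move=> ->; rewrite scale1r.
rewrite scaler_suml [RHS]big_mkcond; apply: eq_bigr => x _.
have unipE g : unip (GLemb g^-1 * x^-1)%g = aff x && (g == (lin x)^-1%g).
  rewrite /unip affM ?aff_emb // affV; case: (boolP (aff x)) => //= xa.
  rewrite linM ?aff_emb ?affV // lin_emb linV // -invMg invg_eq1.
  by rewrite -[RHS](inj_eq (mulgI (lin x))) mulgV.
case: ifP => xa; last by rewrite big1 // => g _; rewrite bE unipE xa mulr0 scale0r.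
rewrite (bigD1 (lin x)^-1%g) //= big1 => [|g /negbTE ne_g]; last first.
  by rewrite bE unipE ne_g andbF mulr0 scale0r.
rewrite bE unipE xa eqxx mulr1 addr0; congr (_ *: _).
have -> : gconst x = act (r := R) (gconst 1%g) x by rewrite /= gact_gconst mul1g.
have x1 : lin_mx x *m val (lin x)^-1%g = 1%:M.
  by rewrite -(val_lin xa); exact: (congr1 val (mulgV (lin x))).
by rewrite F_act // pull_comp // x1 pull_id.
Qed.

Section Orbits.
Variables (P : projmod p Gam) (be : P -> P).
Hypothesis beP : aff_split be.
Implicit Types t : P.

(** The image of b under the equivariant map sending 1 to t: evaluation at t of the affine
  maps on P. *)
Definition aff_point t : delta P := dmap delta (P := regP) (orbh t : rhom regP P) b.

Lemma delta_map_point d F t : affmap d F ->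
  delta_map be d F (aff_point t) = delta_map al d (fun a => F ((orbh t : rhom regP P) a)) b.
Proof. by move=> FA; rewrite /aff_point -(delta_map_natural p_prime _ b alP beP FA). Qed.

(** The values of equivariant maps at these points are linear in t, and equivariant
  maps separate points. *)
Lemma aff_point_linear : linear aff_point.
Proof.
move=> c t t'; apply/eqP; rewrite -subr_eq0; apply/eqP/(eqmap_sep p_prime) => d h hE.
have [F FA FE] := delta_map_surj p_prime beP hE; have [h_lin _ _] := hE.
rewrite (linB h_lin) h_lin -!FE !delta_map_point //.
rewrite -(delta_mapD p_prime alP c b (affmap_comp (orbh t : rhom regP P) FA) (affmap_comp (orbh t' : rhom regP P) FA)).
apply/eqP; rewrite subr_eq0; apply/eqP/eq_delta_map => a /=.
case: FA => F_lin _ _; rewrite -F_lin; congr F; rewrite /orb scaler_sumr -big_split.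
apply: eq_bigr => g _ /=.
by rewrite act_linear scalerDr !scalerA mulrC.
Qed.

Lemma aff_point_act t x : aff_point (act t x) = dmap delta (orbh t : rhom regP P) (dlmul x b).
Proof.
rewrite /aff_point /dlmul; apply: (dmap_comp (P := regP) (Q := regP) (R := P)
  (f := lmulh x) (g := orbh t) (h := orbh (act t x))) => a.
by rewrite /= orb_lmul.
Qed.

Lemma aff_point_unip t u : unip u -> aff_point (act t u) = aff_point t.
Proof. by move=> uu; rewrite aff_point_act unit_unip. Qed.

Lemma aff_point_emb t g : aff_point (act t (GLemb g)) = act (aff_point t) g.
Proof. by rewrite aff_point_act unit_emb rhom_act. Qed.

Lemma aff_point_eval d F t : affmap d F -> (forall B x, B \notin unitmx -> pull B (F x) = 0) ->
  delta_map be d F (aff_point t) = F t.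
Proof.
move=> FA F0; rewrite delta_map_point // (delta_map_unit (affmap_comp (orbh t : rhom regP P) FA)) => [|B x Bs].
  by rewrite /= orb_gconst act1.
exact: F0.
Qed.

End Orbits.
End Unit.
End Coefficients.

(** * Modules induced on the affine group *)

Lemma riso_of_bij (p : nat) (gT : finGroupType) (X Y : rmodule p gT) (f : X -> Y) :
  linear f -> (forall x g, f (act x g) = act (f x) g) -> (forall x, f x = 0 -> x = 0) ->
  surj f -> riso Y X.
Proof.
move=> f_lin f_act f_inj f_surj.
have fI : injective f.
  move=> x y fxy; apply/eqP; rewrite -subr_eq0; apply/eqP/f_inj.
  by rewrite (linB f_lin) fxy subrr.
have [h fK] := boolp.choice f_surj.
have hK : cancel f h by move=> x; apply: fI; rewrite fK.
have h_lin : linear h by move=> c x y; apply: fI; rewrite f_lin !fK.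
have h_act x g : h (act x g) = act (h x) g by apply: fI; rewrite f_act !fK.
pose H : {linear Y -> X} := HB.pack h (GRing.isLinear.Build 'F_p Y X *:%R h h_lin).
by exists (RHom (rfun := H) h_act); exists f.
Qed.

Section Induced.
Variables (p : nat) (p_prime : prime p) (m : nat) (delta : delta_functor p m).
Local Notation Gam := (GL p m.+1).
Local Notation G := (GL p m).
Local Notation S := {mpoly 'F_p[m]}.
Variables (P : projmod p Gam) (Q : rmodule p G) (c : P -> Q) (j : Q -> P) (al : P -> P).
Hypotheses (cjP : affine_induced c j) (alP : aff_split al).

(** The projection of P on the coinvariants of U, identified with Q. *)
Definition coinv (t : P) : Q := \sum_(u | unip u) c (act t u).

Lemma coinv_linear : linear coinv.
Proof.
have [[c_lin _] _ _ _] := cjP; move=> e x y; rewrite /coinv scaler_sumr -big_split.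
by apply: eq_bigr => u _; rewrite act_linear c_lin.
Qed.

Lemma coinv_aff t a : aff a -> coinv (act t a) = act (coinv t) (lin a).
Proof.
have [_ _ _ cjE] := cjP; move=> aa; rewrite /coinv act_lin.
pose e := GLemb (lin a); pose v := (e^-1 * a)%g.
have v_unip : unip v.
  have va : aff v by rewrite affM // affV aff_emb.
  by rewrite /unip va linM ?affV ?aff_emb // linV ?aff_emb // lin_emb mulVg eqxx.
rewrite (reindex (fun u => (v^-1 * (e^-1 * u * e))%g)) /=; last first.
  exists (fun u => (e * (v * u) * e^-1)%g) => u _.
    by rewrite mulKVg -[(e^-1 * u * e)%g]mulgA mulKVg mulgK.
  by rewrite -[(e * (v * u) * e^-1)%g]mulgA mulKg mulgKV mulKg.
apply: eq_big => u; first by rewrite unipM ?unipV // unip_conj ?aff_emb.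
move=> _; rewrite -(cjE _).1 -!actM -/e; congr (c (act t _)).
have {1}-> : a = (e * v)%g by rewrite mulKVg.
by rewrite -(mulgA e v) mulKVg -[(e^-1 * u * e)%g]mulgA mulKVg.
Qed.

Lemma coinvK a : coinv (j a) = a.
Proof.
have [_ cj _ _] := cjP; rewrite /coinv (bigD1 1%g) ?unip1 //= cj ?unip1 // eqxx.
by rewrite big1 ?addr0 // => u /andP[uu /negbTE ne_u]; rewrite cj // ne_u.
Qed.

Variables (w : Gam -> 'F_p) (w_sum : forall y : Gam, \sum_(a | aff a) w (y * a)%g = 1).
Variable b : delta (regP p_prime w_sum).
Hypothesis bE : forall x, id_coef b x = (unip x)%:R.
Local Notation point := (aff_point b (P := P)).

(** The points are constant on the orbits of U, and every t is a sum of translates by U of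
  elements j a. *)
Lemma point_coinv t : point t = point (j (coinv t)).
Proof.
have [[c_lin j_lin] _ jc _] := cjP; have pt_lin := aff_point_linear b alP.
rewrite -{1}(jc t) (lin_sum pt_lin) /coinv (lin_sum j_lin) (lin_sum pt_lin).
rewrite [RHS](reindex_inj invg_inj); apply: eq_big => u; first by rewrite unipV.
by move=> uu; rewrite (aff_point_unip bE).
Qed.

(** The maps dickson * (h o coinv), with h an equivariant map on Q, are affine and can be
  evaluated at the points. *)
Lemma point_inj a : point (j a) = 0 -> a = 0.
Proof.
move=> a0; apply: (eqmap_sep p_prime) => d h [h_lin h_act h_h].
have [N D_h] := dickson_homog p m; pose F t := dickson p m * h (coinv t).
have FA : affmap (N + d) F.
  split=> [e x y|x g ga|x]; last by apply: dhomogM.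
    by rewrite /F coinv_linear h_lin mulrDr scalerAr.
  by rewrite /F coinv_aff // h_act -(val_lin ga) pullM pull_dickson.
have F0 B x : B \notin unitmx -> pull B (F x) = 0.
  by move=> Bs; rewrite pullM pull_dickson_sing // mul0r.
have := aff_point_eval bE alP (j a) FA F0; rewrite a0 /F coinvK => /esym/eqP.
have [P_lin _ _] := delta_map_eqmap p_prime delta alP FA.
by rewrite (lin0 P_lin) mulf_eq0 (negbTE (dickson_neq0 p m)) => /eqP.
Qed.

(** A linear form that vanishes on the points and not at y would give, by dual_dickson,
  affine maps vanishing at all t, whose images do not all vanish at y. *)
Lemma point_surj : surj (fun a => point (j a)).
Proof.
move=> y; pose W z := exists a, point (j a) = z.
have [[c_lin j_lin] _ _ cjE] := cjP; have pt_lin := aff_point_linear b alP.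
case: (boolp.pselect (W y)) => // nWy.
have [|e z z' [a az] [a' a'z']|la la_lin [laW la1]] := @linear_functional 'F_p (delta P) W y _ _ nWy.
- by exists 0; rewrite (lin0 j_lin) (lin0 pt_lin).
- by exists (e *: a + a'); rewrite j_lin pt_lin az a'z'.
have Wpt t : W (point t) by exists (coinv t); rewrite -point_coinv.
suff /(_ 1%g)/eqP : forall g : G, la (act y g^-1%g) = 0 by rewrite invg1 act1 la1 oner_eq0.
apply: (dickson_homog_indep p_prime) => d k k_h.
have [e [F [FA FE F0]]] := dual_dickson p_prime alP la_lin k_h.
rewrite -[LHS](FE y); apply: etrans (delta_map0 p_prime alP e y); apply: eq_delta_map => t.
rewrite -(aff_point_eval bE alP t FA F0) FE /dualmap big1 // => g _.
by rewrite -(aff_point_emb bE) laW ?scale0r.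
Qed.

Lemma delta_induced : riso (delta P) Q.
Proof.
have [[c_lin j_lin] _ _ cjE] := cjP; have pt_lin := aff_point_linear b alP.
apply: (riso_of_bij (f := fun a => point (j a))) => [e x y|x g||].
- by rewrite j_lin pt_lin.
- by rewrite (cjE g).2 (aff_point_emb bE).
- exact: point_inj.
exact: point_surj.
Qed.

End Induced.

Theorem theorem1p10 (p m : nat) (p_prime : prime p) (delta : delta_functor p m)
    (X : rmodule p (GL p m.+1))
    (T : rmodule p (GL p m.+1)) (t : St p m.+1 -> X -> T)
    (T' : rmodule p (GL p m)) (t' : St p m -> Res X -> T') :
  tensor_product t -> tensor_product t' ->
  exists projT : projective T, riso (delta (ProjMod projT)) T'.
Proof.
move=> tP t'P; have [c0 [j0 cj0]] := St_affine p m.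
have [c [j cjP]] := tensor_induced tP t'P cj0.
have [be0 be0_lin be0_tr] := St_trace p_prime m.
have [be be_lin be_tr] := tensor_trace t'P be0_lin be0_tr.
pose al := j \o be \o c; have al_tr := affine_induced_trace cjP be_lin be_tr.
have alP : aff_split al.
  by split=> // e x y; have [[c_lin j_lin] _ _ _] := cjP; rewrite /al /= c_lin be_lin j_lin.
have projT : projective T.
  apply: (projective_of_trace (al := fun x => - al x)); last exact: (trace_aff p_prime alP.1).
  by move=> e x y; rewrite alP.1 opprD scalerN.
have [w w_sum] := aff_weight p m.
have [b bE] := unit_elt p_prime delta w_sum.
exists projT; exact: (delta_induced (P := ProjMod projT) cjP alP bE).
Qed.
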